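(* Let $\tau=\frac{-b+\sqrt{-d}}{2a}$ where $a,b,c$ are mutually coprime integers with $a>0$, $a\tau^2+b\tau+c=0$ and $-d=b^2-4ac$, and suppose $\tau$ lies in $C_{1/v,\infty}$. Then $$\frac{F^2}{6}\left[\frac{t+2}{t+1}-\frac{(t-1)(t+8)}{(t-4)(t+1)}s_2(\tau)\right]-v\frac{d}{dv}F^2=\frac{a}{\pi\sqrt{d}}\,\frac{t-1}{t+1},$$ where $v=v(\tau)$, $t=t(\tau)$, $F={}_2F_1\!\left(\frac18,\frac38;1;\frac1v\right)$, and $\frac{d}{dv}F^2$ denotes the derivative of $x\mapsto{}_2F_1(\frac18,\frac38;1;\frac1x)^2$ evaluated at $x=v(\tau)$.
   Context: $\mathfrak H$ is the upper half-plane, $q=e^{2\pi i\tau}$, $E_2=1-24\sum_{n\ge1}n\frac{q^n}{1-q^n}$, $E_4=1+240\sum_{n\ge1}n^3\frac{q^n}{1-q^n}$, $E_6=1-504\sum_{n\ge1}n^5\frac{q^n}{1-q^n}$, $E_2^*(\tau)=E_2(\tau)-\frac{3}{\pi\mathrm{Im}(\tau)}$, $s_2(\tau)=\frac{E_4(\tau)}{E_6(\tau)}E_2^*(\tau)$. ${}_2F_1$ is the Gauss hypergeometric function. $t(\tau)=-\frac{1}{64}\left(\frac{\eta(\tau)}{\eta(2\tau)}\right)^{24}$ ($\eta$ the Dedekind eta function) is the Hauptmodul of $\Gamma_0(2)$ and $v(\tau)=\frac{1}{16}\left(\frac{\vartheta_3(\tau)^4+\vartheta_4(\tau)^4}{\vartheta_2(\tau)^2\vartheta_3(\tau)\vartheta_4(\tau)}\right)^4$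 ($\vartheta_i$ Jacobi theta functions) is the Hauptmodul of $\Gamma_0^+(2)$; they satisfy $v=-\frac{(1-t)^2}{4t}$. With $\mathcal{F}_{2A}=\{z\in\mathfrak{H}:|z|^2>1/2,|\mathrm{Re}(z)|<1/2\}$, $C_{1/v,\infty}$ is the connected component of $\{\tau\in\mathcal F_{2A}:|1/v(\tau)|<1\}$ whose closure contains the cusp $\infty$ (i.e. containing points of arbitrarily large imaginary part). *)

(* Defs.v *)
(* Complex analysis over Stdlib's R and Coquelicot's C. *)
From Stdlib Require Import Reals ZArith.
From Coquelicot Require Import Coquelicot.
Open Scope R_scope.
Open Scope C_scope.

Definition Cexp (z : C) : C :=
  RtoC (exp (Re z)) * (cos (Im z), sin (Im z)).

(* Like Lim_seq, this is only meaningful for a sequence converging in C. *)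
Definition CLim_seq (u : nat -> C) : C :=
  (real (Lim_seq (fun n => Re (u n))), real (Lim_seq (fun n => Im (u n)))).

Definition CSeries (a : nat -> C) : C := CLim_seq (sum_n a).

Definition CSeriesZ (a : Z -> C) : C :=
  CSeries (fun n => a (Z.of_nat n)) + CSeries (fun n => a (- Z.of_nat (S n))%Z).

(* a 0 * ... * a (n - 1) *)
Fixpoint Cprod_n (a : nat -> C) (n : nat) : C :=
  match n with
  | O => 1
  | S m => Cprod_n a m * a m
  end.

Definition CProd (a : nat -> C) : C := CLim_seq (Cprod_n a).

Fixpoint pochhammer (x : R) (n : nat) : R :=
  match n with
  | O => 1%R
  | S m => (pochhammer x m * (x + INR m))%R
  end.

(* Gauss's 2F1(a, b; c; z) as its power series, hence for Cmod z < 1. *)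
Definition hyp2F1 (a b c : R) (z : C) : C :=
  CSeries (fun n =>
    RtoC (pochhammer a n * pochhammer b n / (pochhammer c n * INR (fact n)))
    * z ^ n).

Definition nome (tau : C) : C := Cexp (2 * PI * Ci * tau).

(* sum over m >= 1 of m^k q^m / (1 - q^m), indexed by m = n + 1 *)
Definition lambert (k : nat) (q : C) : C :=
  CSeries (fun n => RtoC (INR (S n)) ^ k * (q ^ (S n) / (1 - q ^ (S n)))).

Definition E2 (tau : C) : C := 1 - 24 * lambert 1 (nome tau).
Definition E4 (tau : C) : C := 1 + 240 * lambert 3 (nome tau).
Definition E6 (tau : C) : C := 1 - 504 * lambert 5 (nome tau).

Definition E2star (tau : C) : C := E2 tau - 3 / (PI * Im tau).

(* At a zero of E6 (such as Ci) this is 0 by the convention / 0 = 0. *)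
Definition s2 (tau : C) : C := E4 tau / E6 tau * E2star tau.

(* The factor q^(1/24) is exp (2 pi i tau / 24). *)
Definition eta (tau : C) : C :=
  Cexp (2 * PI * Ci * tau / 24) * CProd (fun n => 1 - nome tau ^ (S n)).

(* Jacobi's theta constants, with the convention theta3 = sum_n exp (pi i n^2 tau). *)
Definition theta2 (tau : C) : C :=
  CSeriesZ (fun n => Cexp (PI * Ci * (IZR n + / 2) ^ 2 * tau)).
Definition theta3 (tau : C) : C :=
  CSeriesZ (fun n => Cexp (PI * Ci * IZR n ^ 2 * tau)).
Definition theta4 (tau : C) : C :=
  CSeriesZ (fun n => RtoC (powerRZ (-1) n) * Cexp (PI * Ci * IZR n ^ 2 * tau)).

Definition t_haupt (tau : C) : C :=
  - / 64 * (eta tau / eta (2 * tau)) ^ 24.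

Definition v_haupt (tau : C) : C :=
  / 16 * ((theta3 tau ^ 4 + theta4 tau ^ 4)
          / (theta2 tau ^ 2 * theta3 tau * theta4 tau)) ^ 4.

Definition F_2A (z : C) : Prop :=
  (0 < Im z)%R /\ (Cmod z ^ 2 > 1 / 2)%R /\ (Rabs (Re z) < 1 / 2)%R.

(* |1/v| < 1 is meant with 1/v infinite at a zero of v, whereas / 0 = 0 in C;
   hence the explicit v <> 0. *)
Definition region_inv_v (z : C) : Prop :=
  F_2A z /\ v_haupt z <> 0 /\ (Cmod (1 / v_haupt z) < 1)%R.

(* Connectedness of K in the subspace topology. *)
Definition connected_set (K : C -> Prop) : Prop :=
  forall U V : C -> Prop, open U -> open V ->
    (forall z, K z -> U z \/ V z) ->
    (exists z, K z /\ U z) -> (exists z, K z /\ V z) ->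
    exists z, K z /\ U z /\ V z.

Definition component (S : C -> Prop) (x y : C) : Prop :=
  exists K : C -> Prop,
    connected_set K /\ (forall z, K z -> S z) /\ K x /\ K y.

(* C_{1/v,oo}: the points whose connected component in region_inv_v reaches
   the cusp at infinity. *)
Definition C_inv_v_infty (tau : C) : Prop :=
  region_inv_v tau /\
  forall M : R, exists z, component region_inv_v tau z /\ (M < Im z)%R.

(* Main.v *)
(* All functions are regarded as functions of q, with D = q d/dq.  Put P = 2 E2(2 tau) - E2(tau), T = 1/t and w = 1/v.
   A Lambert-series form of Liouville's convolution identity gives Ramanujan's formulas for D E2 and D E4 together with
   their level 2 analogues, hence D P, E4 (1 - T) = P^2 (1 - 4 T), E6 (1 - T) = P^3 (1 + 8 T) and D T = T P.
   Theta function identities and Gauss's product formulas identify v with (1 - T)^2 / (-4 T).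
   By these derivatives the defects f^2 - P and f D P - 2 P D f, where f = 2F1(1/8, 3/8; 1; w), satisfy a homogeneous
   linear system; they vanish near the cusp and so, by uniqueness and connectedness, on all of C_{1/v,oo}.
   The claim is then algebra in P, T and E2, with Im tau = sqrt d / (2 a).
   At points with t = -8, that is E6 = 0, the convention / 0 = 0 gives s2 = 0, and one needs E2^* = 0 there: E4 and E6 are
   lattice sums by the Lipschitz formula, hence transform under tau -> -1/tau, and so does E2 = (3 D E4 + E6) / E4;
   the only zero of E6 high in the upper half-plane is i (mod 1), because the q-series of E6 is injective for small q. *)
Require Import Defs.
From Stdlib Require Import Reals ZArith Lra Lia List Permutation Classical ClassicalEpsilon.
From Coquelicot Require Import Coquelicot.
Import ListNotations.
Open Scope R_scope.
Open Scope C_scope.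

(** * Unordered sums *)

(** The proof stays clear of contour integrals and of the identity theorem. Power series are
    differentiated termwise by a Taylor estimate, and each uniqueness claim is a Gronwall estimate
    on a segment or a ray. This dictates the variable: with [D], an identity between q-series
    becomes a differential equation with a regular singular point at the cusp [q = 0], where a known
    value and a bound on the exponent determine the solution. Comparing [f ^ 2] with [P], not [f]
    with a root of [P], avoids a branch, and the second defect makes the system first order and
    triangular. Sums run over arbitrary index types through finite subsets, so that rearrangements
    of double series are changes of index. The level 2 relations come from the same convolution
    identity with a sign [(-1)^n] inserted, which brings in [q ^ 2]. Modularity is needed at a
    single place: q-expansions give no value of E2 at a zero of E6, whereas a fixed point of
    [tau -> -1/tau] turns the transformation law into an equation for that value. *)

Definition eq_dec_cl {I : Type} (x y : I) : {x = y} + {x <> y} :=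
  excluded_middle_informative (x = y).

Definition lsum {I : Type} (f : I -> C) (l : list I) : C :=
  fold_right (fun i s => f i + s) 0 l.

Definition lsumR {I : Type} (f : I -> R) (l : list I) : R :=
  fold_right (fun i s => (f i + s)%R) 0%R l.

(** Convergence along the net of finite subsets, each represented by a duplicate-free list, so that
    no enumeration of the index type is involved. *)
Definition has_sum {I : Type} (f : I -> C) (s : C) : Prop :=
  forall eps : R, (0 < eps)%R -> exists l0, NoDup l0 /\
    forall l, NoDup l -> incl l0 l -> (Cmod (lsum f l - s) < eps)%R.

(** Absolute summability; boundedness of the finite sums of moduli needs no candidate for the
    value. *)
Definition summable {I : Type} (f : I -> C) : Prop :=
  exists M : R, forall l, NoDup l -> (lsumR (fun i => Cmod (f i)) l <= M)%R.

Section Sums.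
Context {I : Type}.
Implicit Types (f g : I -> C) (l : list I).

Lemma lsum_app f l l' : lsum f (l ++ l') = lsum f l + lsum f l'.
Proof. induction l; simpl; [ring|rewrite IHl; ring]. Qed.

Lemma lsum_perm f l l' : Permutation l l' -> lsum f l = lsum f l'.
Proof.
  induction 1; simpl; auto; [now rewrite IHPermutation|ring|congruence].
Qed.

Lemma lsum_ext f g l : (forall i, In i l -> f i = g i) -> lsum f l = lsum g l.
Proof.
  induction l; simpl; intros H; auto.
  rewrite H, IHl; auto.
Qed.

Lemma lsum_plus f g l : lsum (fun i => f i + g i) l = lsum f l + lsum g l.
Proof. induction l; simpl; [ring|rewrite IHl; ring]. Qed.

Lemma lsum_scal c f l : lsum (fun i => c * f i) l = c * lsum f l.
Proof. induction l; simpl; [ring|rewrite IHl; ring]. Qed.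

Lemma lsumR_app (f : I -> R) l l' : lsumR f (l ++ l') = (lsumR f l + lsumR f l')%R.
Proof. induction l; simpl; [ring|rewrite IHl; ring]. Qed.

Lemma lsumR_perm (f : I -> R) l l' : Permutation l l' -> lsumR f l = lsumR f l'.
Proof.
  induction 1; simpl; auto; [now rewrite IHPermutation|ring|congruence].
Qed.

Lemma lsumR_scal c (f : I -> R) l : lsumR (fun i => c * f i)%R l = (c * lsumR f l)%R.
Proof. induction l; simpl; [ring|rewrite IHl; ring]. Qed.

Lemma lsumR_plus (f g : I -> R) l :
  lsumR (fun i => f i + g i)%R l = (lsumR f l + lsumR g l)%R.
Proof. induction l; simpl; [ring|rewrite IHl; ring]. Qed.

Lemma lsumR_le (f g : I -> R) l :
  (forall i, In i l -> (f i <= g i)%R) -> (lsumR f l <= lsumR g l)%R.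
Proof.
  induction l; simpl; intros H; [lra|].
  assert (f a <= g a)%R by auto.
  assert (lsumR f l <= lsumR g l)%R by auto. lra.
Qed.

Lemma lsumR_pos (f : I -> R) l : (forall i, (0 <= f i)%R) -> (0 <= lsumR f l)%R.
Proof. intros H; induction l; simpl; [lra|specialize (H a); lra]. Qed.

Lemma Cmod_lsum f l : (Cmod (lsum f l) <= lsumR (fun i => Cmod (f i)) l)%R.
Proof.
  induction l; simpl; [rewrite Cmod_0; lra|].
  eapply Rle_trans; [apply Cmod_triangle|]. lra.
Qed.

Lemma incl_split (l l' : list I) : NoDup l -> NoDup l' -> incl l l' ->
  exists r, NoDup r /\ Permutation l' (l ++ r) /\ (forall i, In i r <-> In i l' /\ ~ In i l).
Proof.
  intros Hl Hl' Hi.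
  set (p := fun i => if in_dec eq_dec_cl i l then false else true).
  assert (Hin : forall i, In i (filter p l') <-> In i l' /\ ~ In i l).
  { intros i. rewrite filter_In. unfold p.
    destruct (in_dec eq_dec_cl i l); intuition congruence. }
  exists (filter p l'). split; [|split; [|exact Hin]].
  - apply NoDup_filter; auto.
  - apply NoDup_Permutation; auto.
    + apply NoDup_app; auto. { apply NoDup_filter; auto. }
      intros i H1 H2. apply Hin in H2. tauto.
    + intros i. rewrite in_app_iff, Hin.
      split; [|intros [H|[H _]]; auto].
      intros H. destruct (in_dec eq_dec_cl i l); tauto.
Qed.

Lemma lsumR_incl (f : I -> R) l l' : (forall i, (0 <= f i)%R) ->
  NoDup l -> NoDup l' -> incl l l' -> (lsumR f l <= lsumR f l')%R.
Proof.
  intros Hf Hl Hl' Hi.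
  destruct (incl_split l l' Hl Hl' Hi) as (r & _ & Hp & _).
  rewrite (lsumR_perm _ _ _ Hp), lsumR_app.
  pose proof (lsumR_pos f r Hf). lra.
Qed.

Lemma union_nodup (l l' : list I) : exists r, NoDup r /\ incl l r /\ incl l' r.
Proof.
  exists (nodup eq_dec_cl (l ++ l')). split; [apply NoDup_nodup|].
  split; intros i Hi; apply nodup_In, in_app_iff; auto.
Qed.

Lemma has_sum_ext f g s : (forall i, f i = g i) -> has_sum f s -> has_sum g s.
Proof.
  intros H Hf eps He. destruct (Hf eps He) as (l0 & H0 & H1).
  exists l0; split; auto. intros l Hl Hi.
  rewrite <- (lsum_ext f g); auto.
Qed.

Lemma has_sum_unique f s s' : has_sum f s -> has_sum f s' -> s = s'.
Proof.
  intros H H'. apply NNPP; intros Hne.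
  assert (Hd : (0 < Cmod (s - s'))%R).
  { apply Cmod_gt_0. now apply Cminus_eq_contra. }
  destruct (H (Cmod (s - s') / 2)%R) as (l & _ & Hl); [lra|].
  destruct (H' (Cmod (s - s') / 2)%R) as (l' & _ & Hl'); [lra|].
  destruct (union_nodup l l') as (r & Hr & Hi & Hi').
  specialize (Hl r Hr Hi). specialize (Hl' r Hr Hi').
  assert (Cmod (s - s') <= Cmod (lsum f r - s) + Cmod (lsum f r - s'))%R.
  { replace (s - s') with (- (lsum f r - s) + (lsum f r - s')) by ring.
    eapply Rle_trans; [apply Cmod_triangle|]. rewrite Cmod_opp. lra. }
  lra.
Qed.

Lemma has_sum_plus f g s t :
  has_sum f s -> has_sum g t -> has_sum (fun i => f i + g i) (s + t).
Proof.
  intros H H' eps He.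
  destruct (H (eps / 2)%R) as (l & _ & Hl); [lra|].
  destruct (H' (eps / 2)%R) as (l' & _ & Hl'); [lra|].
  destruct (union_nodup l l') as (r & Hr & Hi & Hi').
  exists r; split; auto. intros k Hk Hki.
  rewrite lsum_plus.
  replace (lsum f k + lsum g k - (s + t)) with ((lsum f k - s) + (lsum g k - t)) by ring.
  eapply Rle_lt_trans; [apply Cmod_triangle|].
  assert (incl l k) by (eapply incl_tran; eauto).
  assert (incl l' k) by (eapply incl_tran; eauto).
  specialize (Hl k Hk H0). specialize (Hl' k Hk H1). lra.
Qed.

Lemma has_sum_scal c f s : has_sum f s -> has_sum (fun i => c * f i) (c * s).
Proof.
  intros H eps He.
  destruct (H (eps / (Cmod c + 1))%R) as (l & Hn & Hl).
  { apply Rdiv_lt_0_compat; auto. pose proof (Cmod_ge_0 c); lra. }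
  exists l; split; auto. intros k Hk Hi.
  rewrite lsum_scal. replace (c * lsum f k - c * s) with (c * (lsum f k - s)) by ring.
  rewrite Cmod_mult. specialize (Hl k Hk Hi).
  pose proof (Cmod_ge_0 c).
  pose proof (Cmod_ge_0 (lsum f k - s)).
  apply Rlt_div_r in Hl; [|lra]. nra.
Qed.

Lemma has_sum_opp f s : has_sum f s -> has_sum (fun i => - f i) (- s).
Proof.
  intros H. apply has_sum_scal with (c := - (1)) in H.
  replace (- (1) * s) with (- s) in H by ring.
  eapply has_sum_ext; [|exact H]. intros; simpl; ring.
Qed.

Lemma has_sum_minus f g s t :
  has_sum f s -> has_sum g t -> has_sum (fun i => f i - g i) (s - t).
Proof. intros H H'. apply has_sum_plus; auto. now apply has_sum_opp. Qed.

Lemma has_sum_0 : has_sum (fun _ : I => 0) 0.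
Proof.
  intros eps He. exists []. split; [constructor|]. intros l _ _.
  replace (lsum (fun _ => 0) l) with (RtoC 0) by (induction l; simpl; [auto|rewrite <- IHl; ring]).
  replace (0 - 0) with (RtoC 0) by ring. now rewrite Cmod_0.
Qed.

Lemma has_sum_finite f l : NoDup l -> (forall i, ~ In i l -> f i = 0) ->
  has_sum f (lsum f l).
Proof.
  intros Hl H eps He. exists l; split; auto. intros k Hk Hi.
  destruct (incl_split l k Hl Hk Hi) as (r & _ & Hp & Hr).
  rewrite (lsum_perm _ _ _ Hp), lsum_app.
  assert (H0 : lsum f r = 0).
  { rewrite (lsum_ext f (fun _ => 0)); [|intros i Hi'; apply H, Hr, Hi'].
    clear. induction r; simpl; [auto|rewrite IHr; ring]. }
  rewrite H0. replace (lsum f l + 0 - lsum f l) with (RtoC 0) by ring.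
  now rewrite Cmod_0.
Qed.

Lemma summable_ext f g : (forall i, f i = g i) -> summable f -> summable g.
Proof.
  intros H (M & HM). exists M. intros l Hl.
  eapply Rle_trans; [|apply (HM l Hl)].
  apply lsumR_le; intros i _. rewrite H; lra.
Qed.

Lemma summable_le f g : (forall i, (Cmod (f i) <= Cmod (g i))%R) -> summable g -> summable f.
Proof.
  intros H (M & HM). exists M. intros l Hl.
  eapply Rle_trans; [|apply (HM l Hl)].
  apply lsumR_le; intros i _. apply H.
Qed.

Lemma summable_scal c f : summable f -> summable (fun i => c * f i).
Proof.
  intros (M & HM). exists (Cmod c * M)%R. intros l Hl.
  eapply Rle_trans; [|apply Rmult_le_compat_l; [apply Cmod_ge_0|apply (HM l Hl)]].
  rewrite <- lsumR_scal. apply lsumR_le; intros i _. rewrite Cmod_mult; lra.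
Qed.

Lemma summable_le_scal K f g : (forall i, (Cmod (f i) <= K * Cmod (g i))%R) ->
  summable g -> summable f.
Proof.
  intros H Hg. apply (summable_le f (fun i => RtoC (Rabs K) * g i)); [|now apply summable_scal].
  intros i. rewrite Cmod_mult, Cmod_R, Rabs_Rabsolu.
  eapply Rle_trans; [apply H|]. apply Rmult_le_compat_r; [apply Cmod_ge_0|apply Rle_abs].
Qed.

Lemma summable_plus f g : summable f -> summable g -> summable (fun i => f i + g i).
Proof.
  intros (M & HM) (N & HN). exists (M + N)%R. intros l Hl.
  specialize (HM l Hl). specialize (HN l Hl).
  eapply Rle_trans; [apply (lsumR_le _ (fun i => Cmod (f i) + Cmod (g i))%R); intros; apply Cmod_triangle|].
  rewrite lsumR_plus. lra.
Qed.

(** The value is the supremum of the finite sums; by monotonicity one list close to it controls all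
    larger lists. *)
Lemma has_sum_nonneg (f : I -> R) M : (forall i, (0 <= f i)%R) ->
  (forall l, NoDup l -> (lsumR f l <= M)%R) -> exists s : R, has_sum (fun i => RtoC (f i)) s.
Proof.
  intros Hf HM.
  destruct (completeness (fun x => exists l, NoDup l /\ x = lsumR f l)) as (s & Hs1 & Hs2).
  - exists M. intros x (l & Hl & ->). auto.
  - exists 0%R, []. split; [constructor|reflexivity].
  - exists s. intros eps He.
    destruct (classic (exists l, NoDup l /\ (s - eps < lsumR f l)%R)) as [(l0 & H0 & H1)|Hn].
    + exists l0. split; auto. intros l Hl Hi.
      assert (lsumR f l0 <= lsumR f l)%R by (apply lsumR_incl; auto).
      assert (lsumR f l <= s)%R by (apply Hs1; eauto).
      replace (lsum (fun i => RtoC (f i)) l) with (RtoC (lsumR f l)).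
      2:{ clear. induction l; simpl; [auto|]. now rewrite <- IHl, RtoC_plus. }
      rewrite <- RtoC_minus, Cmod_R. apply Rabs_def1; lra.
    + assert (s <= s - eps)%R; [|lra]. apply Hs2. intros x (l & Hl & ->).
      destruct (Rle_lt_dec (lsumR f l) (s - eps)); auto. exfalso; apply Hn; eauto.
Qed.

Lemma Cmod_Re_Im (z : C) : (Rabs (Re z) <= Cmod z)%R /\ (Rabs (Im z) <= Cmod z)%R.
Proof.
  pose proof (Rmax_Cmod z). unfold Re, Im.
  split; eapply Rle_trans; [apply Rmax_l|apply H|apply Rmax_r|apply H].
Qed.

(** Real and imaginary parts are each written as a difference of two bounded nonnegative
    families. *)
Lemma summable_has_sum f : summable f -> exists s, has_sum f s.
Proof.
  intros (M & HM).
  assert (key : forall h : I -> R, (forall i, (Rabs (h i) <= Cmod (f i))%R) ->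
     exists s, has_sum (fun i => RtoC (h i)) s).
  { intros h Hh.
    destruct (has_sum_nonneg (fun i => Rmax (h i) 0) M) as (s & Hs).
    { intros; apply Rmax_r. }
    { intros l Hl. eapply Rle_trans; [|apply (HM l Hl)]. apply lsumR_le. intros i _.
      specialize (Hh i). apply Rmax_lub; [|apply Cmod_ge_0].
      eapply Rle_trans; [apply Rle_abs|auto]. }
    destruct (has_sum_nonneg (fun i => Rmax (- h i) 0) M) as (t & Ht).
    { intros; apply Rmax_r. }
    { intros l Hl. eapply Rle_trans; [|apply (HM l Hl)]. apply lsumR_le. intros i _.
      specialize (Hh i). apply Rmax_lub; [|apply Cmod_ge_0].
      eapply Rle_trans; [apply Rle_abs|rewrite Rabs_Ropp; auto]. }
    exists (RtoC s - RtoC t). eapply has_sum_ext; [|apply (has_sum_minus _ _ _ _ Hs Ht)].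
    intros i; simpl. rewrite <- RtoC_minus. f_equal. unfold Rmax.
    destruct (Rle_dec (h i) 0), (Rle_dec (- h i) 0); lra. }
  destruct (key (fun i => Re (f i))) as (s & Hs); [intros; apply Cmod_Re_Im|].
  destruct (key (fun i => Im (f i))) as (t & Ht); [intros; apply Cmod_Re_Im|].
  exists (s + Ci * t).
  eapply has_sum_ext; [|apply (has_sum_plus _ _ _ _ Hs (has_sum_scal Ci _ _ Ht))].
  intros i; simpl. destruct (f i) as [x y]; simpl.
  unfold Cplus, Cmult, Ci, RtoC; simpl. f_equal; ring.
Qed.

Lemma has_sum_norm_le f s M :
  has_sum f s -> (forall l, NoDup l -> (lsumR (fun i => Cmod (f i)) l <= M)%R) ->
  (Cmod s <= M)%R.
Proof.
  intros H HM. apply Rnot_lt_le. intros Hlt.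
  destruct (H (Cmod s - M)%R) as (l & Hl & H1); [lra|].
  specialize (H1 l Hl (incl_refl l)). specialize (HM l Hl).
  pose proof (Cmod_lsum f l).
  assert (Cmod s <= Cmod (lsum f l) + Cmod (lsum f l - s))%R.
  { replace s with (lsum f l + - (lsum f l - s)) at 1 by ring.
    eapply Rle_trans; [apply Cmod_triangle|]. rewrite Cmod_opp; lra. }
  lra.
Qed.

End Sums.

Lemma lsum_map {I J : Type} (h : J -> I) (f : I -> C) l :
  lsum f (map h l) = lsum (fun j => f (h j)) l.
Proof. induction l; simpl; congruence. Qed.

Lemma lsumR_map {I J : Type} (h : J -> I) (f : I -> R) l :
  lsumR f (map h l) = lsumR (fun j => f (h j)) l.
Proof. induction l; simpl; congruence. Qed.

Lemma NoDup_map_inj {I J : Type} (h : J -> I) l :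
  (forall x y, h x = h y -> x = y) -> NoDup l -> NoDup (map h l).
Proof.
  intros Hinj. induction 1; simpl; constructor; auto.
  rewrite in_map_iff. intros (y & E & Hy). apply Hinj in E. subst; auto.
Qed.

Lemma preimage_list {I J : Type} (h : J -> I) (f : I -> C) (l : list I) :
  (forall x y, h x = h y -> x = y) -> (forall i, f i <> 0 -> exists j, h j = i) ->
  NoDup l ->
  exists k, NoDup k /\ (forall j, In (h j) l <-> In j k) /\
    lsum f l = lsum (fun j => f (h j)) k /\
    lsumR (fun i => Cmod (f i)) l = lsumR (fun j => Cmod (f (h j))) k.
Proof.
  intros Hinj Hsup. induction 1 as [|i l Hi Hl (k & Hk & Hin & E & E')].
  - exists []. split; [constructor|]. split; [simpl; tauto|]. simpl; auto.
  - destruct (classic (exists j, h j = i)) as [(j & <-)|Hn].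
    + exists (j :: k). split; [|split; [|split]].
      * constructor; auto. rewrite <- Hin; auto.
      * intros j'. simpl. rewrite Hin. split; intros [H|H]; auto; left; auto; congruence.
      * simpl. now rewrite E.
      * simpl. now rewrite E'.
    + assert (f i = 0) by (apply NNPP; intros H0; apply Hn, Hsup, H0).
      exists k. split; [|split; [|split]]; auto.
      * intros j. simpl. rewrite <- Hin. split; [intros [H0|H0]; auto|auto].
        subst. exfalso; eauto.
      * simpl. rewrite H, E. ring.
      * simpl. rewrite H, E', Cmod_0. ring.
Qed.

(** Only the support of [f] has to lie in the image of [h]. A sum over a triangle, a half line or a
    parity class can thus be extended by zero to the whole index type, which is how all later
    splittings are made. *)
Lemma has_sum_reindex {I J : Type} (h : J -> I) (f : I -> C) s :
  (forall x y, h x = h y -> x = y) -> (forall i, f i <> 0 -> exists j, h j = i) ->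
  has_sum (fun j => f (h j)) s <-> has_sum f s.
Proof.
  intros Hinj Hsup. split; intros H eps He.
  - destruct (H eps He) as (k0 & Hk0 & Hk).
    exists (map h k0). split; [now apply NoDup_map_inj|]. intros l Hl Hi.
    destruct (preimage_list h f l Hinj Hsup Hl) as (k & Hkn & Hin & E & _).
    rewrite E. apply Hk; auto. intros j Hj. apply Hin, Hi, in_map, Hj.
  - destruct (H eps He) as (l0 & Hl0 & Hl).
    destruct (preimage_list h f l0 Hinj Hsup Hl0) as (k0 & Hkn & Hin & E & _).
    exists k0. split; auto. intros k Hk Hi.
    (* The image of [k] may miss elements of [l0], but these lie outside the image of [h]. So [f]
       vanishes on them and they can be appended freely. *)
    set (l1 := map h k).
    assert (Hl1 : NoDup l1) by (now apply NoDup_map_inj).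
    set (p := fun i => if in_dec eq_dec_cl i l1 then false else true).
    assert (Hp : forall i, In i (filter p l0) <-> In i l0 /\ ~ In i l1).
    { intros i. rewrite filter_In. unfold p.
      destruct (in_dec eq_dec_cl i l1); intuition congruence. }
    assert (Hz : lsum f (l1 ++ filter p l0) = lsum (fun j => f (h j)) k).
    { rewrite lsum_app. unfold l1. rewrite lsum_map.
      assert (Hf : lsum f (filter p l0) = 0).
      { rewrite (lsum_ext f (fun _ => 0)).
        - generalize (filter p l0). clear. induction l; simpl; [auto|rewrite IHl; ring].
        - intros i Hi'. apply Hp in Hi'. destruct Hi' as [Hi1 Hi2].
          apply NNPP; intros H0. apply Hi2. destruct (Hsup i H0) as (j & <-).
          apply in_map, Hi, Hin, Hi1. }
      rewrite Hf; ring. }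
    rewrite <- Hz. apply Hl.
    + apply NoDup_app; auto. { apply NoDup_filter; auto. }
      intros i H1 H2. apply Hp in H2; tauto.
    + intros i Hi'. apply in_app_iff. rewrite Hp.
      destruct (in_dec eq_dec_cl i l1); tauto.
Qed.

Lemma summable_reindex {I J : Type} (h : J -> I) (f : I -> C) :
  (forall x y, h x = h y -> x = y) -> (forall i, f i <> 0 -> exists j, h j = i) ->
  summable (fun j => f (h j)) <-> summable f.
Proof.
  intros Hinj Hsup. split; intros (M & HM); exists M.
  - intros l Hl.
    destruct (preimage_list h f l Hinj Hsup Hl) as (k & Hkn & _ & _ & E).
    rewrite E. auto.
  - intros l Hl. rewrite <- (lsumR_map h (fun i => Cmod (f i))).
    apply HM. now apply NoDup_map_inj.
Qed.

Lemma summable_inj {I J : Type} (h : J -> I) (f : I -> C) :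
  (forall x y, h x = h y -> x = y) -> summable f -> summable (fun j => f (h j)).
Proof.
  intros Hinj (M & HM). exists M. intros l Hl.
  rewrite <- (lsumR_map h (fun i => Cmod (f i))). apply HM. now apply NoDup_map_inj.
Qed.

Section Fubini.
Context {I J : Type}.

Lemma lsum_prod (f : I * J -> C) (l : list I) (k : list J) :
  lsum f (list_prod l k) = lsum (fun i => lsum (fun j => f (i, j)) k) l.
Proof.
  induction l; simpl; auto. now rewrite lsum_app, IHl, lsum_map.
Qed.

Lemma lsumR_prod (f : I * J -> R) (l : list I) (k : list J) :
  lsumR f (list_prod l k) = lsumR (fun i => lsumR (fun j => f (i, j)) k) l.
Proof.
  induction l; simpl; auto. now rewrite lsumR_app, IHl, lsumR_map.
Qed.

Lemma NoDup_list_prod (l : list I) (k : list J) : NoDup l -> NoDup k -> NoDup (list_prod l k).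
Proof.
  intros Hl Hk. induction Hl; simpl; [constructor|].
  apply NoDup_app; auto.
  - apply NoDup_map_inj; auto. congruence.
  - intros [a b] H1 H2. apply in_map_iff in H1. destruct H1 as (y & E & _).
    inversion E; subst. apply in_prod_iff in H2. tauto.
Qed.

(** One finite set of columns serves finitely many rows at once, with an error proportional to the
    number of rows. *)
Lemma rows_approx (f : I * J -> C) (g : I -> C) (k0 : list J) l eps :
  (forall i, has_sum (fun j => f (i, j)) (g i)) -> (0 < eps)%R -> NoDup l ->
  exists k1, NoDup k1 /\ incl k0 k1 /\
    forall k, NoDup k -> incl k1 k ->
    (Cmod (lsum (fun i => lsum (fun j => f (i, j)) k) l - lsum g l) <= eps * INR (length l))%R.
Proof.
  intros Hg He. induction 1 as [|i l Hi Hl (k1 & Hk1 & Hi1 & H1)].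
  - exists (nodup eq_dec_cl k0). split; [apply NoDup_nodup|]. split.
    { intros j Hj; now apply nodup_In. }
    intros k _ _. simpl. replace (0 - 0) with (RtoC 0) by ring. rewrite Cmod_0. lra.
  - destruct (Hg i eps He) as (k2 & Hk2 & H2).
    destruct (union_nodup k1 k2) as (k3 & Hk3 & Hi31 & Hi32).
    exists k3. split; auto. split; [eapply incl_tran; eauto|].
    intros k Hk Hik. simpl lsum. simpl length. rewrite S_INR.
    assert (A1 := H1 k Hk (incl_tran Hi31 Hik)).
    assert (A2 := H2 k Hk (incl_tran Hi32 Hik)).
    match goal with |- (Cmod (?a + ?b - (?c + ?d)) <= _)%R =>
      replace (a + b - (c + d)) with ((a - c) + (b - d)) by ring end.
    eapply Rle_trans; [apply Cmod_triangle|]. lra.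
Qed.

(** Both quantities are compared with the sum over a rectangle [list_prod l k] that contains the
    finite set controlling the total and whose columns approximate every row of [l]. *)
Lemma has_sum_fubini (f : I * J -> C) (g : I -> C) s :
  has_sum f s -> (forall i, has_sum (fun j => f (i, j)) (g i)) -> has_sum g s.
Proof.
  intros Hf Hg eps He.
  destruct (Hf (eps / 2)%R) as (l0 & Hl0 & H0); [lra|].
  exists (nodup eq_dec_cl (map fst l0)). split; [apply NoDup_nodup|].
  intros l Hl Hi.
  assert (Hn : (0 < INR (length l) + 1)%R) by (pose proof (pos_INR (length l)); lra).
  destruct (rows_approx f g (map snd l0) l (eps / 2 / (INR (length l) + 1))%R Hg) as (k & Hk & Hi1 & Hk1); auto.
  { apply Rdiv_lt_0_compat; lra. }
  specialize (Hk1 k Hk (incl_refl k)).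
  assert (A := H0 (list_prod l k)).
  rewrite lsum_prod in A.
  assert (A' : (Cmod (lsum (fun i => lsum (fun j => f (i, j)) k) l - s) < eps / 2)%R).
  { apply A; [now apply NoDup_list_prod|]. intros [i j] Hij. apply in_prod.
    - apply Hi, nodup_In. change i with (fst (i, j)). now apply in_map.
    - apply Hi1. change j with (snd (i, j)). now apply in_map. }
  assert (B : (eps / 2 / (INR (length l) + 1) * INR (length l) <= eps / 2)%R).
  { pose proof (pos_INR (length l)). unfold Rdiv. rewrite Rmult_assoc.
    rewrite <- (Rmult_1_r (eps * / 2)) at 2. apply Rmult_le_compat_l; [lra|].
    rewrite Rmult_comm. apply Rle_div_l; lra. }
  set (X := lsum (fun i => lsum (fun j => f (i, j)) k) l) in *.
  replace (lsum g l - s) with (- (X - lsum g l) + (X - s)) by ring.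
  eapply Rle_lt_trans; [apply Cmod_triangle|]. rewrite Cmod_opp. lra.
Qed.

(** Tonelli's criterion: every finite set of pairs sits inside a rectangle. *)
Lemma summable_rows (f : I * J -> C) (m : I -> R) M :
  (forall i l, NoDup l -> (lsumR (fun j => Cmod (f (i, j))) l <= m i)%R) ->
  (forall l, NoDup l -> (lsumR m l <= M)%R) -> summable f.
Proof.
  intros Hrow Hm. exists M. intros l Hl.
  set (l1 := nodup eq_dec_cl (map fst l)). set (l2 := nodup eq_dec_cl (map snd l)).
  assert (N1 : NoDup l1) by apply NoDup_nodup.
  assert (N2 : NoDup l2) by apply NoDup_nodup.
  eapply Rle_trans; [|apply (Hm l1 N1)].
  eapply Rle_trans; [apply (lsumR_incl _ l (list_prod l1 l2)); auto|].
  - intros; apply Cmod_ge_0.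
  - now apply NoDup_list_prod.
  - intros [i j] Hij. apply in_prod; apply nodup_In.
    + change i with (fst (i, j)). now apply in_map.
    + change j with (snd (i, j)). now apply in_map.
  - rewrite lsumR_prod. apply lsumR_le. intros i _. now apply Hrow.
Qed.

Lemma summable_prod (f : I -> C) (g : J -> C) :
  summable f -> summable g -> summable (fun p : I * J => f (fst p) * g (snd p)).
Proof.
  intros (M & HM) (N & HN).
  apply (summable_rows _ (fun i => N * Cmod (f i))%R (N * M)%R).
  - intros i l Hl. simpl.
    eapply Rle_trans with (lsumR (fun j => Cmod (f i) * Cmod (g j)) l)%R.
    { apply lsumR_le; intros; rewrite Cmod_mult; lra. }
    rewrite lsumR_scal. rewrite Rmult_comm. apply Rmult_le_compat_r; [apply Cmod_ge_0|auto].
  - intros l Hl. rewrite lsumR_scal. apply Rmult_le_compat_l; auto.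
    specialize (HN [] (NoDup_nil J)). simpl in HN. lra.
Qed.

Lemma has_sum_prod (f : I -> C) (g : J -> C) s t :
  summable f -> summable g -> has_sum f s -> has_sum g t ->
  has_sum (fun p : I * J => f (fst p) * g (snd p)) (s * t).
Proof.
  intros Sf Sg Hf Hg.
  destruct (summable_has_sum _ (summable_prod f g Sf Sg)) as (S & HS).
  assert (H1 : has_sum (fun i => f i * t) S).
  { apply (has_sum_fubini _ _ _ HS). intros i. simpl. now apply has_sum_scal. }
  assert (H2 : has_sum (fun i => f i * t) (s * t)).
  { rewrite Cmult_comm. eapply has_sum_ext; [|apply (has_sum_scal t _ _ Hf)].
    intros; simpl; ring. }
  now rewrite <- (has_sum_unique _ _ _ H1 H2).
Qed.

Lemma has_sum_swap (f : I * J -> C) s :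
  has_sum f s -> has_sum (fun p : J * I => f (snd p, fst p)) s.
Proof.
  intros H. apply (has_sum_reindex (fun p : J * I => (snd p, fst p))); auto.
  - intros [a b] [c d] E; simpl in E; congruence.
  - intros [a b] _. now exists (b, a).
Qed.

End Fubini.

Lemma has_sum_single {I : Type} (f : I -> C) i0 :
  (forall i, i <> i0 -> f i = 0) -> has_sum f (f i0).
Proof.
  intros H. replace (f i0) with (lsum f [i0]) by (simpl; ring).
  apply has_sum_finite; [repeat constructor; auto|].
  intros i Hi. apply H. intros ->. apply Hi; simpl; auto.
Qed.

Lemma in_le_max (l : list nat) i : In i l -> (i <= fold_right max 0 l)%nat.
Proof.
  induction l; simpl; [tauto|]. intros [->|H]; [lia|]. specialize (IHl H). lia.
Qed.

Lemma nat_lsum_bound (a : nat -> R) M : (forall n, (0 <= a n)%R) ->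
  (forall n, (lsumR a (seq 0 n) <= M)%R) -> forall l, NoDup l -> (lsumR a l <= M)%R.
Proof.
  intros Ha HM l Hl. eapply Rle_trans; [|apply (HM (S (fold_right max 0%nat l)))].
  apply lsumR_incl; auto; [apply seq_NoDup|].
  intros i Hi. apply in_seq. pose proof (in_le_max l i Hi). lia.
Qed.

Lemma sum_n_lsum (f : nat -> C) n : sum_n f n = lsum f (seq 0 (S n)).
Proof.
  induction n.
  - rewrite sum_O. simpl. ring.
  - rewrite sum_Sn, IHn. rewrite (seq_S (S n)), lsum_app. simpl plus. unfold plus; simpl.
    ring.
Qed.

Lemma has_sum_lim (f : nat -> C) s eps : has_sum f s -> (0 < eps)%R ->
  exists N, forall n, (N <= n)%nat -> (Cmod (sum_n f n - s) < eps)%R.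
Proof.
  intros H He. destruct (H eps He) as (l0 & Hl0 & Hl).
  exists (fold_right max 0%nat l0). intros n Hn. rewrite sum_n_lsum. apply Hl.
  - apply seq_NoDup.
  - intros i Hi. apply in_seq. pose proof (in_le_max l0 i Hi). lia.
Qed.

(** [CLim_seq] has a value for every sequence; this is the bridge from genuine convergence to that
    default-valued limit. *)
Lemma CLim_seq_correct (u : nat -> C) s :
  (forall eps, (0 < eps)%R -> exists N, forall n, (N <= n)%nat -> (Cmod (u n - s) < eps)%R) ->
  CLim_seq u = s.
Proof.
  intros H. unfold CLim_seq.
  assert (H1 : is_lim_seq (fun n => Re (u n)) (Re s)).
  { apply is_lim_seq_spec. intros eps. destruct (H eps (cond_pos eps)) as (N & HN).
    exists N. intros n Hn. eapply Rle_lt_trans; [|apply (HN n Hn)].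
    replace (Re (u n) - Re s)%R with (Re (u n - s)) by reflexivity. apply Cmod_Re_Im. }
  assert (H2 : is_lim_seq (fun n => Im (u n)) (Im s)).
  { apply is_lim_seq_spec. intros eps. destruct (H eps (cond_pos eps)) as (N & HN).
    exists N. intros n Hn. eapply Rle_lt_trans; [|apply (HN n Hn)].
    replace (Im (u n) - Im s)%R with (Im (u n - s)) by reflexivity. apply Cmod_Re_Im. }
  rewrite (is_lim_seq_unique _ _ H1), (is_lim_seq_unique _ _ H2).
  now destruct s.
Qed.

Lemma CSeries_has_sum (f : nat -> C) s : has_sum f s -> CSeries f = s.
Proof.
  intros H. apply CLim_seq_correct. intros eps He. now apply has_sum_lim.
Qed.

Lemma summable_CSeries (f : nat -> C) : summable f -> has_sum f (CSeries f).
Proof.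
  intros H. destruct (summable_has_sum f H) as (s & Hs).
  now rewrite (CSeries_has_sum f s Hs).
Qed.

Lemma summable_nat (f : nat -> C) (a : nat -> R) :
  (forall n, (Cmod (f n) <= a n)%R) -> ex_series a -> summable f.
Proof.
  intros Hf Ha. exists (Series a). intros l Hl.
  assert (Hpos : forall n, (0 <= a n)%R).
  { intros n. eapply Rle_trans; [apply Cmod_ge_0|apply Hf]. }
  assert (HS : is_lim_seq (sum_n a) (Series a)).
  { apply Series_correct in Ha. exact Ha. }
  eapply Rle_trans with (lsumR a l); [apply lsumR_le; auto|].
  apply nat_lsum_bound; auto. intros n.
  apply Rle_trans with (lsumR a (seq 0 (S n))).
  { apply lsumR_incl; auto; try apply seq_NoDup. intros i Hi. apply in_seq in Hi. apply in_seq. lia. }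
  assert (E : forall m, lsumR a (seq 0 (S m)) = sum_n a m).
  { induction m.
    - rewrite sum_O. simpl. ring.
    - rewrite sum_Sn, <- IHm. rewrite (seq_S (S m)), lsumR_app. change (@plus R_AbelianMonoid) with Rplus.
      f_equal. simpl. ring. }
  rewrite E. apply (is_lim_seq_incr_compare _ _ HS).
  intros m. rewrite sum_Sn. unfold plus; simpl. specialize (Hpos (S m)). lra.
Qed.

Lemma summable_mult_bounded {I : Type} (f g : I -> C) K :
  (forall i, (Cmod (f i) <= K)%R) -> summable g -> summable (fun i => f i * g i).
Proof.
  intros Hf. apply (summable_le_scal K). intros i. rewrite Cmod_mult.
  apply Rmult_le_compat_r; [apply Cmod_ge_0|auto].
Qed.

(** * Complex derivatives and power series *)

Definition ccont (f : C -> C) (z : C) : Prop :=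
  forall eps : R, (0 < eps)%R -> exists delta : R, (0 < delta)%R /\
    forall y, (Cmod (y - z) < delta)%R -> (Cmod (f y - f z) < eps)%R.

(* Caratheodory's form: the difference quotient extends continuously *)
Definition cderiv (f : C -> C) (z l : C) : Prop :=
  exists phi : C -> C, (forall y, f y = f z + phi y * (y - z)) /\ phi z = l /\ ccont phi z.

Lemma ccont_const c z : ccont (fun _ => c) z.
Proof.
  intros eps He. exists 1%R; split; [lra|]. intros y _.
  replace (c - c) with (RtoC 0) by ring. now rewrite Cmod_0.
Qed.

Lemma ccont_id z : ccont (fun y => y) z.
Proof. intros eps He. exists eps; auto. Qed.

Lemma ccont_ext_loc (f g : C -> C) z r : (0 < r)%R ->
  (forall y, (Cmod (y - z) < r)%R -> f y = g y) -> ccont f z -> ccont g z.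
Proof.
  intros Hr H Hf eps He. destruct (Hf eps He) as (d & Hd & Hy).
  exists (Rmin d r). split; [now apply Rmin_glb_lt|]. intros y Hyz.
  rewrite <- !H; [apply Hy| |].
  - eapply Rlt_le_trans; [apply Hyz|apply Rmin_l].
  - replace (z - z) with (RtoC 0) by ring. now rewrite Cmod_0.
  - eapply Rlt_le_trans; [apply Hyz|apply Rmin_r].
Qed.

Lemma ccont_plus f g z : ccont f z -> ccont g z -> ccont (fun y => f y + g y) z.
Proof.
  intros Hf Hg eps He.
  destruct (Hf (eps/2)%R) as (d & Hd & H1); [lra|].
  destruct (Hg (eps/2)%R) as (d' & Hd' & H2); [lra|].
  exists (Rmin d d'). split; [now apply Rmin_glb_lt|]. intros y Hy.
  assert (A := H1 y (Rlt_le_trans _ _ _ Hy (Rmin_l _ _))).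
  assert (B := H2 y (Rlt_le_trans _ _ _ Hy (Rmin_r _ _))).
  replace (f y + g y - (f z + g z)) with ((f y - f z) + (g y - g z)) by ring.
  eapply Rle_lt_trans; [apply Cmod_triangle|]. lra.
Qed.

Lemma ccont_mult f g z : ccont f z -> ccont g z -> ccont (fun y => f y * g y) z.
Proof.
  intros Hf Hg eps He.
  set (K := (Cmod (f z) + Cmod (g z) + 1)%R).
  assert (HK : (0 < K)%R) by (unfold K; pose proof (Cmod_ge_0 (f z)); pose proof (Cmod_ge_0 (g z)); lra).
  set (e := Rmin 1 (eps / (2 * K))%R).
  assert (He' : (0 < e)%R).
  { unfold e. apply Rmin_glb_lt; [lra|]. apply Rdiv_lt_0_compat; lra. }
  assert (HeK : (e * K <= eps / 2)%R).
  { apply Rle_trans with (eps / (2 * K) * K)%R.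
    - apply Rmult_le_compat_r; [lra|apply Rmin_r].
    - right. field. lra. }
  assert (He1 : (e <= 1)%R) by apply Rmin_l.
  destruct (Hf e He') as (d & Hd & H1). destruct (Hg e He') as (d' & Hd' & H2).
  exists (Rmin d d'). split; [now apply Rmin_glb_lt|]. intros y Hy.
  assert (A := H1 y (Rlt_le_trans _ _ _ Hy (Rmin_l _ _))).
  assert (B := H2 y (Rlt_le_trans _ _ _ Hy (Rmin_r _ _))).
  replace (f y * g y - f z * g z) with
    ((f y - f z) * (g y - g z) + (f y - f z) * g z + f z * (g y - g z)) by ring.
  eapply Rle_lt_trans; [apply Cmod_triangle|].
  eapply Rle_lt_trans; [apply Rplus_le_compat_r; apply Cmod_triangle|].
  rewrite !Cmod_mult.
  pose proof (Cmod_ge_0 (f y - f z)). pose proof (Cmod_ge_0 (g y - g z)).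
  pose proof (Cmod_ge_0 (f z)). pose proof (Cmod_ge_0 (g z)).
  unfold K in HeK.
  assert ((Cmod (f y - f z) * Cmod (g y - g z) <= e * 1)%R) by (apply Rmult_le_compat; lra).
  assert ((Cmod (f y - f z) * Cmod (g z) <= e * Cmod (g z))%R) by (apply Rmult_le_compat_r; lra).
  assert ((Cmod (f z) * Cmod (g y - g z) <= Cmod (f z) * e)%R) by (apply Rmult_le_compat_l; lra).
  nra.
Qed.

Lemma ccont_comp f g z : ccont f (g z) -> ccont g z -> ccont (fun y => f (g y)) z.
Proof.
  intros Hf Hg eps He. destruct (Hf eps He) as (d & Hd & H1).
  destruct (Hg d Hd) as (d' & Hd' & H2). exists d'. split; auto.
Qed.

Lemma ccont_opp f z : ccont f z -> ccont (fun y => - f y) z.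
Proof.
  intros H. apply (ccont_ext_loc (fun y => - (1) * f y) _ z 1); [lra|intros; ring|].
  apply ccont_mult; auto. apply ccont_const.
Qed.

Lemma ccont_minus f g z : ccont f z -> ccont g z -> ccont (fun y => f y - g y) z.
Proof. intros; apply ccont_plus; auto; now apply ccont_opp. Qed.

Lemma ccont_inv f z : ccont f z -> f z <> 0 -> ccont (fun y => / f y) z.
Proof.
  intros Hf Hz eps He. pose proof (proj1 (Cmod_gt_0 _) Hz) as Hm.
  set (m := Cmod (f z)) in *.
  destruct (Hf (Rmin (m / 2) (eps * (m * m / 2)))%R) as (d & Hd & H1).
  { apply Rmin_glb_lt; [lra|]. apply Rmult_lt_0_compat; nra. }
  exists d; split; auto. intros y Hy. specialize (H1 y Hy).
  assert (A := Rlt_le_trans _ _ _ H1 (Rmin_l _ _)).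
  assert (B := Rlt_le_trans _ _ _ H1 (Rmin_r _ _)).
  assert (Hfy : (m / 2 < Cmod (f y))%R).
  { assert (m <= Cmod (f y) + Cmod (f y - f z))%R; [|lra]. unfold m.
    replace (f z) with (f y + - (f y - f z)) at 1 by ring.
    eapply Rle_trans; [apply Cmod_triangle|]. rewrite Cmod_opp. lra. }
  assert (Hy0 : f y <> 0) by (apply Cmod_gt_0; lra).
  replace (/ f y - / f z) with (- (f y - f z) / (f y * f z)) by (field; auto).
  rewrite Cmod_div, Cmod_opp, Cmod_mult by (now apply Cmult_neq_0). fold m.
  apply Rlt_div_l; [nra|]. eapply Rlt_le_trans; [apply B|].
  apply Rmult_le_compat_l; nra.
Qed.

Lemma ccont_pow f n z : ccont f z -> ccont (fun y => f y ^ n) z.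
Proof.
  intros H. induction n; simpl; [apply ccont_const|]. now apply ccont_mult.
Qed.

Lemma ccont_neq0 f z : ccont f z -> f z <> 0 ->
  exists r, (0 < r)%R /\ forall y, (Cmod (y - z) < r)%R -> f y <> 0.
Proof.
  intros Hf Hz. destruct (Hf (Cmod (f z))) as (d & Hd & H).
  { now apply Cmod_gt_0. }
  exists d; split; auto. intros y Hy E. specialize (H y Hy). rewrite E in H.
  replace (0 - f z) with (- f z) in H by ring. rewrite Cmod_opp in H. lra.
Qed.

Lemma ccont_bounded f z : ccont f z ->
  exists r M, (0 < r)%R /\ forall y, (Cmod (y - z) < r)%R -> (Cmod (f y) <= M)%R.
Proof.
  intros Hf. destruct (Hf 1%R) as (d & Hd & H); [lra|].
  exists d, (Cmod (f z) + 1)%R; split; auto. intros y Hy. specialize (H y Hy).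
  replace (f y) with (f z + (f y - f z)) by ring.
  eapply Rle_trans; [apply Cmod_triangle|]. lra.
Qed.

Lemma cderiv_cont f z l : cderiv f z l -> ccont f z.
Proof.
  intros (phi & H & E & Hc).
  apply (ccont_ext_loc (fun y => f z + phi y * (y - z)) _ z 1); [lra|intros; now rewrite <- H|].
  apply ccont_plus; [apply ccont_const|]. apply ccont_mult; auto.
  apply ccont_minus; [apply ccont_id|apply ccont_const].
Qed.

Lemma cderiv_const c z : cderiv (fun _ => c) z 0.
Proof. exists (fun _ => 0). split; [intros; ring|]. split; auto. apply ccont_const. Qed.

Lemma cderiv_id z : cderiv (fun y => y) z 1.
Proof. exists (fun _ => 1). split; [intros; ring|]. split; auto. apply ccont_const. Qed.

Lemma cderiv_plus f g z a b : cderiv f z a -> cderiv g z b -> cderiv (fun y => f y + g y) z (a + b).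
Proof.
  intros (p & H & E & Hc) (p' & H' & E' & Hc'). exists (fun y => p y + p' y).
  split; [|split].
  - intros y. rewrite (H y), (H' y). ring.
  - now rewrite E, E'.
  - now apply ccont_plus.
Qed.

Lemma cderiv_mult f g z a b : cderiv f z a -> cderiv g z b ->
  cderiv (fun y => f y * g y) z (a * g z + f z * b).
Proof.
  intros Hf Hg. pose proof (cderiv_cont _ _ _ Hg) as Cg.
  destruct Hf as (p & H & E & Hc). destruct Hg as (p' & H' & E' & Hc').
  exists (fun y => p y * g y + f z * p' y).
  split; [|split].
  - intros y. rewrite (H y) at 1. rewrite (H' y) at 1.
    rewrite (H' y) at 1. ring.
  - now rewrite E, E'.
  - apply ccont_plus; apply ccont_mult; auto. apply ccont_const.
Qed.

Lemma cderiv_comp f g z a b : cderiv f (g z) a -> cderiv g z b ->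
  cderiv (fun y => f (g y)) z (a * b).
Proof.
  intros (p & H & E & Hc) Hg. pose proof (cderiv_cont _ _ _ Hg) as Cg.
  destruct Hg as (p' & H' & E' & Hc').
  exists (fun y => p (g y) * p' y). split; [|split].
  - intros y. rewrite (H (g y)) at 1. rewrite (H' y) at 2. ring.
  - now rewrite E, E'.
  - apply ccont_mult; auto. now apply ccont_comp.
Qed.

Lemma cderiv_inv f z a : cderiv f z a -> f z <> 0 -> cderiv (fun y => / f y) z (- a / f z ^ 2).
Proof.
  intros Hf Hz. pose proof (cderiv_cont _ _ _ Hf) as Cf.
  destruct (ccont_neq0 f z Cf Hz) as (r & Hr & Hy).
  destruct Hf as (p & H & E & Hc).
  (* where [f y = 0] the quotient formula is replaced by the literal difference quotient *)
  exists (fun y => if excluded_middle_informative (f y = 0)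
                   then (/ f y - / f z) / (y - z) else - p y * / (f y * f z)).
  split; [|split].
  - intros y. destruct excluded_middle_informative as [E0|E0].
    + assert (y - z <> 0).
      { apply Cminus_eq_contra. intros ->. auto. }
      generalize (/ f y) (/ f z); intros u u'. field. auto.
    + assert (Q : f y - f z = p y * (y - z)) by (rewrite (H y) at 1; ring).
      replace (/ f z + - p y * / (f y * f z) * (y - z))
        with (/ f z - p y * (y - z) / (f y * f z)) by (field; auto).
      rewrite <- Q. field; auto.
  - destruct excluded_middle_informative as [E0|E0]; [tauto|].
    rewrite E. field; auto.
  - apply (ccont_ext_loc (fun y => - p y * / (f y * f z)) _ z r Hr).
    + intros y Hyz. destruct excluded_middle_informative as [E0|E0]; auto.
      exfalso; now apply (Hy y Hyz).
    + apply ccont_mult; [now apply ccont_opp|]. apply ccont_inv; [|now apply Cmult_neq_0].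
      apply ccont_mult; auto. apply ccont_const.
Qed.

Lemma cderiv_eq f z a b : cderiv f z a -> a = b -> cderiv f z b.
Proof. now intros H <-. Qed.

Lemma cderiv_ext_loc (f g : C -> C) z l r : (0 < r)%R ->
  (forall y, (Cmod (y - z) < r)%R -> f y = g y) -> cderiv f z l -> cderiv g z l.
Proof.
  intros Hr Hfg (p & H & E & Hc).
  assert (Ez : f z = g z).
  { apply Hfg. replace (z - z) with (RtoC 0) by ring. now rewrite Cmod_0. }
  (* The slope must satisfy its equation at every [y]. Where [f] and [g] differ, which happens only
     away from [z], it is the literal difference quotient. *)
  exists (fun y => if excluded_middle_informative (f y = g y) then p y
                   else (g y - g z) / (y - z)).
  split; [|split].
  - intros y. destruct excluded_middle_informative as [E0|E0].
    + now rewrite <- E0, <- Ez.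
    + assert (y - z <> 0).
      { apply Cminus_eq_contra. intros ->. auto. }
      field. auto.
  - destruct excluded_middle_informative; tauto.
  - apply (ccont_ext_loc p _ z r Hr); auto. intros y Hy.
    destruct excluded_middle_informative as [E0|E0]; auto. elim E0; auto.
Qed.

Lemma cderiv_ext (f g : C -> C) z l : (forall y, f y = g y) -> cderiv f z l -> cderiv g z l.
Proof. intros H. apply (cderiv_ext_loc f g z l 1); [lra|auto]. Qed.

Lemma cderiv_scal c f z l : cderiv f z l -> cderiv (fun y => c * f y) z (c * l).
Proof.
  intros H. eapply cderiv_eq; [apply cderiv_mult; [apply cderiv_const|apply H]|]. cbv beta; ring.
Qed.

Lemma cderiv_opp f z l : cderiv f z l -> cderiv (fun y => - f y) z (- l).
Proof.
  intros H. apply (cderiv_ext (fun y => - (1) * f y)); [intros; ring|].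
  eapply cderiv_eq; [apply cderiv_scal, H|cbv beta; ring].
Qed.

Lemma cderiv_minus f g z a b : cderiv f z a -> cderiv g z b -> cderiv (fun y => f y - g y) z (a - b).
Proof. intros; apply cderiv_plus; auto. now apply cderiv_opp. Qed.

Lemma cderiv_div f g z a b : cderiv f z a -> cderiv g z b -> g z <> 0 ->
  cderiv (fun y => f y / g y) z ((a * g z - f z * b) / g z ^ 2).
Proof.
  intros Hf Hg Hz. eapply cderiv_eq; [apply cderiv_mult; [exact Hf|apply cderiv_inv; eauto]|].
  cbv beta; field; auto.
Qed.

Lemma cderiv_sqr f z l : cderiv f z l -> cderiv (fun y => f y ^ 2) z (2 * f z * l).
Proof.
  intros H. apply (cderiv_ext (fun y => f y * f y)); [intros; ring|].
  eapply cderiv_eq; [apply cderiv_mult; eauto|cbv beta; ring].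
Qed.

Lemma cderiv_unique f z a b : cderiv f z a -> cderiv f z b -> a = b.
Proof.
  intros (p & H & E & Hc) (p' & H' & E' & Hc').
  apply NNPP; intros Hne.
  assert (Hd : (p z - p' z) <> 0) by (rewrite E, E'; now apply Cminus_eq_contra).
  destruct (ccont_neq0 (fun y => p y - p' y) z) as (r & Hr & Hy); auto.
  { now apply ccont_minus. }
  set (y := z + RtoC (r / 2)).
  assert (Hyz : y - z = RtoC (r / 2)) by (unfold y; ring).
  apply (Hy y).
  - rewrite Hyz, Cmod_R, Rabs_right; lra.
  - assert (E1 : p y * (y - z) = p' y * (y - z)).
    { replace (p y * (y - z)) with (f y - f z) by (rewrite (H y) at 1; ring).
      rewrite (H' y) at 1. ring. }
    rewrite Hyz in E1.
    assert (N : RtoC (r / 2) <> 0) by (intros E2; apply RtoC_inj in E2; lra).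
    replace (p y) with (p y * RtoC (r / 2) / RtoC (r / 2)) by (field; auto).
    rewrite E1. field; auto.
Qed.

(** The form in which power series deliver derivatives: a quadratic remainder divided by the
    increment tends to 0. *)
Lemma cderiv_of_quadratic (f : C -> C) (z l : C) (K r : R) : (0 < r)%R ->
  (forall h, (Cmod h < r)%R -> (Cmod (f (z + h)%C - f z - l * h) <= K * (Cmod h * Cmod h))%R) ->
  cderiv f z l.
Proof.
  intros Hr H.
  exists (fun y => if excluded_middle_informative (y = z) then l else (f y - f z) / (y - z)).
  split; [|split].
  - intros y. destruct excluded_middle_informative as [E|E].
    + subst. ring.
    + field. now apply Cminus_eq_contra.
  - destruct excluded_middle_informative; tauto.
  - intros eps He. set (K' := (Rabs K + 1)%R).
    assert (HK' : (0 < K')%R) by (unfold K'; pose proof (Rabs_pos K); lra).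
    exists (Rmin r (eps / K')%R). split.
    { apply Rmin_glb_lt; auto. now apply Rdiv_lt_0_compat. }
    intros y Hy. destruct (excluded_middle_informative (z = z)) as [_|]; [|tauto].
    destruct excluded_middle_informative as [E|E].
    + replace (l - l) with (RtoC 0) by ring. now rewrite Cmod_0.
    + assert (N : y - z <> 0) by now apply Cminus_eq_contra.
      assert (A := Rlt_le_trans _ _ _ Hy (Rmin_l _ _)).
      assert (B := Rlt_le_trans _ _ _ Hy (Rmin_r _ _)).
      specialize (H (y - z) A). replace (z + (y - z)) with y in H by ring.
      replace ((f y - f z) / (y - z) - l) with ((f y - f z - l * (y - z)) / (y - z)) by (field; auto).
      rewrite Cmod_div by auto. pose proof (proj1 (Cmod_gt_0 _) N).
      apply Rlt_div_l; auto. eapply Rle_lt_trans; [apply H|].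
      assert (K <= K')%R by (unfold K'; pose proof (Rle_abs K); lra).
      apply Rlt_div_r in B; auto. nra.
Qed.

(* [dpow n z] is [n * z ^ (n - 1)], by the product rule *)
Fixpoint dpow (n : nat) (z : C) : C :=
  match n with O => 0 | S m => z * dpow m z + z ^ m end.
Fixpoint dpowR (n : nat) (r : R) : R :=
  match n with O => 0%R | S m => (r * dpowR m r + r ^ m)%R end.
(** Half the second derivative of [r ^ n], which is the natural bound for the second-order Taylor
    remainder. *)
Fixpoint ddpowR (n : nat) (r : R) : R :=
  match n with O => 0%R | S m => (dpowR m r + r * ddpowR m r)%R end.

Lemma dpow_mult n z : z * dpow n z = RtoC (INR n) * z ^ n.
Proof.
  induction n; [simpl; ring|]. rewrite S_INR, RtoC_plus.
  simpl. replace (z * (z * dpow n z + z ^ n)) with (z * (z * dpow n z) + z * z ^ n) by ring.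
  rewrite IHn. ring.
Qed.

Lemma Cmod_pow_le z r n : (Cmod z <= r)%R -> (Cmod (z ^ n) <= r ^ n)%R.
Proof.
  intros H. rewrite Cmod_pow. apply pow_incr. split; auto. apply Cmod_ge_0.
Qed.

Lemma dpowR_pos n r : (0 <= r)%R -> (0 <= dpowR n r)%R.
Proof. intros H; induction n; simpl; [lra|]. pose proof (pow_le r n H). nra. Qed.

Lemma ddpowR_pos n r : (0 <= r)%R -> (0 <= ddpowR n r)%R.
Proof. intros H; induction n; simpl; [lra|]. pose proof (dpowR_pos n r H). nra. Qed.

Lemma Cmod_dpow n z r : (Cmod z <= r)%R -> (Cmod (dpow n z) <= dpowR n r)%R.
Proof.
  intros H. assert (0 <= r)%R by (pose proof (Cmod_ge_0 z); lra).
  induction n; simpl; [rewrite Cmod_0; lra|].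
  eapply Rle_trans; [apply Cmod_triangle|]. rewrite Cmod_mult.
  apply Rplus_le_compat; [|now apply Cmod_pow_le].
  apply Rmult_le_compat; auto; apply Cmod_ge_0.
Qed.

(** By convexity the slope at [r] is at most the mean slope on [[r, rho]]. A derivative is thus paid
    for by a larger radius. *)
Lemma dpowR_le n r rho : (0 <= r)%R -> (r <= rho)%R -> ((rho - r) * dpowR n r <= rho ^ n - r ^ n)%R.
Proof.
  intros H H'. induction n; simpl; [lra|].
  assert (r ^ n <= rho ^ n)%R by (apply pow_incr; lra).
  pose proof (pow_le r n H). nra.
Qed.

Lemma ddpowR_le n r rho : (0 <= r)%R -> (r <= rho)%R ->
  ((rho - r) * ddpowR n r <= dpowR n rho - dpowR n r)%R.
Proof.
  intros H H'. induction n; simpl; [lra|].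
  assert (r ^ n <= rho ^ n)%R by (apply pow_incr; lra).
  assert (dpowR n r <= dpowR n rho)%R.
  { pose proof (ddpowR_pos n r H). nra. }
  nra.
Qed.

Lemma pow_taylor n (a b : C) r : (Cmod a <= r)%R -> (Cmod b <= r)%R ->
  (Cmod (a ^ n - b ^ n) <= Cmod (a - b) * dpowR n r)%R /\
  (Cmod (a ^ n - b ^ n - dpow n b * (a - b)) <= Cmod (a - b) * Cmod (a - b) * ddpowR n r)%R.
Proof.
  intros Ha Hb. assert (0 <= r)%R by (pose proof (Cmod_ge_0 a); lra).
  pose proof (Cmod_ge_0 (a - b)) as Hab.
  induction n as [|n [IH1 IH2]]; simpl.
  - replace (1 - 1) with (RtoC 0) by ring. replace (0 - 0 * (a - b)) with (RtoC 0) by ring.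
    rewrite Cmod_0; lra.
  - split.
    + replace (a * a ^ n - b * b ^ n) with (a * (a ^ n - b ^ n) + (a - b) * b ^ n) by ring.
      eapply Rle_trans; [apply Cmod_triangle|]. rewrite !Cmod_mult.
      assert (A := Cmod_pow_le b r n Hb).
      assert (Cmod a * Cmod (a ^ n - b ^ n) <= r * (Cmod (a - b) * dpowR n r))%R.
      { apply Rmult_le_compat; auto; apply Cmod_ge_0. }
      nra.
    + replace (a * a ^ n - b * b ^ n - (b * dpow n b + b ^ n) * (a - b)) with
        (b * (a ^ n - b ^ n - dpow n b * (a - b)) + (a - b) * (a ^ n - b ^ n)) by ring.
      eapply Rle_trans; [apply Cmod_triangle|]. rewrite !Cmod_mult.
      assert (Cmod b * Cmod (a ^ n - b ^ n - dpow n b * (a - b)) <=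
        r * (Cmod (a - b) * Cmod (a - b) * ddpowR n r))%R.
      { apply Rmult_le_compat; auto; apply Cmod_ge_0. }
      nra.
Qed.

(* Power series over an arbitrary index set, [sum_i c i * z ^ e i]; this covers
   Lambert series without collecting equal exponents. *)
Section PowerSeries.
Context {I : Type}.
Variables (c : I -> C) (e : I -> nat) (f : C -> C).
Hypothesis Hs : forall r : R, (0 <= r < 1)%R -> summable (fun i => c i * RtoC r ^ e i).

Lemma gps_summable_z z : (Cmod z < 1)%R -> summable (fun i => c i * z ^ e i).
Proof.
  intros Hz. apply (summable_le _ (fun i => c i * RtoC (Cmod z) ^ e i)).
  - intros i. rewrite !Cmod_mult, !Cmod_pow, Cmod_R, Rabs_right; [lra|].
    apply Rle_ge, Cmod_ge_0.
  - apply Hs. split; auto. apply Cmod_ge_0.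
Qed.

Lemma gps_summable_bound z r rho (g : I -> C) : (Cmod z <= r)%R -> (r < rho < 1)%R ->
  (forall i, (Cmod (g i) <= Cmod (c i) * dpowR (e i) r)%R) -> summable g.
Proof.
  intros Hz Hr Hg. pose proof (Cmod_ge_0 z).
  apply (summable_le_scal (/ (rho - r)) _ (fun i => c i * RtoC rho ^ e i)).
  - intros i. rewrite Cmod_mult, <- RtoC_pow, Cmod_R, (Rabs_right (rho ^ e i)).
    2:{ apply Rle_ge, pow_le; lra. }
    eapply Rle_trans; [apply Hg|].
    assert (A := dpowR_le (e i) r rho).
    assert (0 <= r ^ e i)%R by (apply pow_le; lra).
    replace (/ (rho - r) * (Cmod (c i) * rho ^ e i))%R with (Cmod (c i) * (rho ^ e i / (rho - r)))%R
      by (field; lra).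
    apply Rmult_le_compat_l; [apply Cmod_ge_0|]. apply Rle_div_r; [lra|].
    rewrite Rmult_comm. lra.
  - apply Hs. lra.
Qed.

Lemma gps_summable_dpow z : (Cmod z < 1)%R -> summable (fun i => c i * dpow (e i) z).
Proof.
  intros Hz. apply (gps_summable_bound z (Cmod z) ((Cmod z + 1) / 2)); [lra|lra|].
  intros i. rewrite Cmod_mult. apply Rmult_le_compat_l; [apply Cmod_ge_0|].
  apply Cmod_dpow; lra.
Qed.

Lemma gps_deriv_summable r : (0 <= r < 1)%R ->
  summable (fun i => (c i * RtoC (INR (e i))) * RtoC r ^ e i).
Proof.
  intros Hr. apply (summable_ext (fun i => RtoC r * (c i * dpow (e i) (RtoC r)))).
  - intros i. rewrite <- (Cmult_assoc (c i)), <- dpow_mult. ring.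
  - apply summable_scal, gps_summable_dpow. rewrite Cmod_R, Rabs_right; lra.
Qed.

Hypothesis Hf : forall z, (Cmod z < 1)%R -> has_sum (fun i => c i * z ^ e i) (f z).

(** The remainder of each [z ^ n] is bounded through [ddpowR]. Two enlargements of the radius,
    [r < rho < rho' < 1], turn that into a multiple of [rho' ^ n] independent of the increment, so
    the remainder of the whole series is quadratic. *)
Lemma gps_deriv z : (Cmod z < 1)%R ->
  exists l, cderiv f z l /\ has_sum (fun i => c i * dpow (e i) z) l.
Proof.
  intros Hz. destruct (summable_has_sum _ (gps_summable_dpow z Hz)) as (l & Hl).
  exists l. split; auto.
  pose proof (Cmod_ge_0 z) as Hz0.
  set (r := ((2 * Cmod z + 1) / 3)%R). set (rho := ((Cmod z + 2) / 3)%R).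
  set (rho' := ((Cmod z + 5) / 6)%R).
  assert (Hr : (Cmod z < r /\ r < rho /\ rho < rho' /\ rho' < 1)%R) by (unfold r, rho, rho'; lra).
  destruct (Hs rho') as (M & HM); [lra|].
  apply (cderiv_of_quadratic f z l (/ (rho - r) * (/ (rho' - rho) * M)) (r - Cmod z)); [lra|].
  intros h Hh.
  assert (Hzh : (Cmod (z + h) <= r)%R).
  { eapply Rle_trans; [apply Cmod_triangle|]. lra. }
  assert (HS : has_sum (fun i => c i * ((z + h) ^ e i - z ^ e i - dpow (e i) z * h))
                 (f (z + h) - f z - l * h)).
  { rewrite (Cmult_comm l h).
    eapply has_sum_ext; [|apply has_sum_minus; [apply has_sum_minus;
      [apply (Hf (z + h)); lra|apply (Hf z Hz)]|apply (has_sum_scal h _ _ Hl)]].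
    intros i; simpl; ring. }
  apply (has_sum_norm_le _ _ _ HS). intros k Hk.
  eapply Rle_trans; [|apply Rmult_le_compat_r;
    [apply Rmult_le_pos; apply Cmod_ge_0
    |apply Rmult_le_compat_l; [left; apply Rinv_0_lt_compat; lra
    |apply Rmult_le_compat_l; [left; apply Rinv_0_lt_compat; lra|apply (HM k Hk)]]]].
  rewrite (Rmult_comm _ (Cmod h * Cmod h)), <- !Rmult_assoc.
  rewrite <- lsumR_scal. apply lsumR_le. intros i _.
  rewrite !Cmod_mult, <- RtoC_pow, Cmod_R, (Rabs_right (rho' ^ e i)).
  2:{ apply Rle_ge, pow_le; lra. }
  assert (A := proj2 (pow_taylor (e i) (z + h) z r Hzh (Rlt_le _ _ (proj1 Hr)))).
  replace (z + h - z) with h in A by ring.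
  assert (B := ddpowR_le (e i) r rho ltac:(lra) ltac:(lra)).
  assert (B' := dpowR_le (e i) rho rho' ltac:(lra) ltac:(lra)).
  assert (0 <= dpowR (e i) r)%R by (apply dpowR_pos; lra).
  assert (0 <= rho ^ e i)%R by (apply pow_le; lra).
  assert (B1 : (ddpowR (e i) r <= / (rho - r) * (/ (rho' - rho) * rho' ^ e i))%R).
  { apply Rle_trans with (/ (rho - r) * dpowR (e i) rho)%R.
    - apply (Rmult_le_reg_l (rho - r)); [lra|].
      rewrite <- Rmult_assoc, Rinv_r, Rmult_1_l; lra.
    - apply Rmult_le_compat_l; [left; apply Rinv_0_lt_compat; lra|].
      apply (Rmult_le_reg_l (rho' - rho)); [lra|].
      rewrite <- Rmult_assoc, Rinv_r, Rmult_1_l; lra. }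
  pose proof (Cmod_ge_0 (c i)). pose proof (Cmod_ge_0 h).
  eapply Rle_trans; [apply Rmult_le_compat_l; [auto|apply A]|].
  eapply Rle_trans; [apply Rmult_le_compat_l; [auto|
    apply Rmult_le_compat_l; [apply Rmult_le_pos; auto|apply B1]]|].
  right; ring.
Qed.

Lemma gps_deriv_D z : (Cmod z < 1)%R ->
  exists l, cderiv f z l /\ has_sum (fun i => (c i * RtoC (INR (e i))) * z ^ e i) (z * l).
Proof.
  intros Hz. destruct (gps_deriv z Hz) as (l & Hl & Hl').
  exists l. split; auto. apply (has_sum_scal z) in Hl'.
  eapply has_sum_ext; [|exact Hl']. intros i. simpl.
  rewrite <- (Cmult_assoc (c i)), <- dpow_mult. ring.
Qed.

End PowerSeries.

(** * Linear differential equations, exponential and logarithm *)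

(** The function [h s * exp (- K * s)] is nonincreasing. *)
Lemma gronwall_real (h h' : R -> R) K :
  (forall s, (0 <= s <= 1)%R -> is_derive h s (h' s) /\ (h' s <= K * h s)%R) ->
  (h 0 <= 0)%R -> (h 1 <= 0)%R.
Proof.
  intros H H0.
  destruct (MVT_gen (fun s => h s * exp (- K * s))%R 0 1
     (fun s => (h' s - K * h s) * exp (- K * s))%R) as (c & Hc & E).
  - intros x Hx. rewrite Rmin_left in Hx by lra; rewrite Rmax_right in Hx by lra.
    destruct (H x) as [Hd _]; [lra|].
    auto_derive; [now exists (h' x)|].
    change (Derive (fun x0 : R => h x0) x) with (Derive h x). rewrite (is_derive_unique _ _ _ Hd). ring.
  - intros x Hx. rewrite Rmin_left in Hx by lra; rewrite Rmax_right in Hx by lra.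
    destruct (H x) as [Hd _]; [lra|].
    apply continuity_pt_mult.
    + apply derivable_continuous_pt. exists (h' x). now apply is_derive_Reals.
    + apply derivable_continuous_pt. apply ex_derive_Reals_0. auto_derive. auto.
  - rewrite Rmin_left in Hc by lra; rewrite Rmax_right in Hc by lra.
    destruct (H c Hc) as [_ Hle].
    rewrite Rmult_0_r, exp_0 in E.
    pose proof (exp_pos (- K * c)). pose proof (exp_pos (- K * 1)).
    assert ((h' c - K * h c) * exp (- K * c) <= 0)%R by nra.
    assert (h 1 * exp (- K * 1) <= 0)%R by lra. nra.
Qed.

(** Here [h s / s] is nonincreasing on [(0, 1]], and the second hypothesis lets it take values below
    every positive bound. *)
Lemma gronwall_singular_real (h h' : R -> R) :
  (forall s, (0 < s <= 1)%R -> is_derive h s (h' s) /\ (s * h' s <= h s)%R) ->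
  (forall eps, (0 < eps)%R -> exists s, (0 < s < 1)%R /\ (h s <= eps * s)%R) ->
  (h 1 <= 0)%R.
Proof.
  intros H H0. apply Rnot_lt_le. intros Hp.
  destruct (H0 (h 1 / 2)%R) as (s & Hs & Hhs); [lra|].
  destruct (MVT_gen (fun s => h s / s)%R s 1
     (fun s => (s * h' s - h s) / (s * s))%R) as (c & Hc & E).
  - intros x Hx. rewrite Rmin_left in Hx by lra; rewrite Rmax_right in Hx by lra.
    destruct (H x) as [Hd _]; [lra|].
    auto_derive; [split; [now exists (h' x)|lra]|].
    change (Derive (fun x0 : R => h x0) x) with (Derive h x). rewrite (is_derive_unique _ _ _ Hd). field. lra.
  - intros x Hx. rewrite Rmin_left in Hx by lra; rewrite Rmax_right in Hx by lra.
    destruct (H x) as [Hd _]; [lra|].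
    apply continuity_pt_div; [| |lra].
    + apply derivable_continuous_pt. exists (h' x). now apply is_derive_Reals.
    + apply derivable_continuous_pt, derivable_pt_id.
  - rewrite Rmin_left in Hc by lra; rewrite Rmax_right in Hc by lra.
    destruct (H c) as [_ Hle]; [lra|].
    assert (h 1 / 1 <= h s / s)%R.
    { assert ((c * h' c - h c) / (c * c) <= 0)%R.
      { unfold Rdiv. apply Rmult_le_0_r; [lra|]. left; apply Rinv_0_lt_compat; nra. }
      nra. }
    assert (h s / s <= h 1 / 2)%R by (apply Rle_div_l; lra). lra.
Qed.

Lemma path_point (z0 d : C) (s h : R) :
  z0 + RtoC (s + h) * d - (z0 + RtoC s * d) = RtoC h * d.
Proof. rewrite RtoC_plus. ring. Qed.

Lemma path_deriv (p : C -> R) (g : C -> C) z0 d (s : R) l :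
  (p = Re \/ p = Im) -> cderiv g (z0 + RtoC s * d) l ->
  is_derive (fun s : R => p (g (z0 + RtoC s * d))) s (p (l * d)).
Proof.
  intros Hp (phi & H & E & Hc). apply is_derive_Reals.
  assert (Hpm : forall z, (Rabs (p z) <= Cmod z)%R) by (intros; destruct Hp; subst; apply Cmod_Re_Im).
  assert (Hp1 : forall a b, p (a - b) = (p a - p b)%R).
  { intros; destruct Hp; subst; reflexivity. }
  intros eps He. set (z := z0 + RtoC s * d) in *.
  destruct (Hc (eps / (Cmod d + 1))%R) as (del & Hdel & Hy).
  { apply Rdiv_lt_0_compat; auto. pose proof (Cmod_ge_0 d); lra. }
  assert (Hdp : (0 < del / (Cmod d + 1))%R).
  { apply Rdiv_lt_0_compat; auto. pose proof (Cmod_ge_0 d); lra. }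
  exists (mkposreal _ Hdp). intros h Hh0 Hh. simpl in Hh.
  pose proof (Cmod_ge_0 d) as Hd0.
  set (y := z0 + RtoC (s + h) * d).
  assert (Ey : y - z = RtoC h * d) by apply path_point.
  assert (Hyz : (Cmod (y - z) < del)%R).
  { rewrite Ey, Cmod_mult, Cmod_R. apply Rlt_div_r in Hh; [|lra].
    pose proof (Rabs_pos h). nra. }
  specialize (Hy y Hyz). rewrite E in Hy.
  replace ((p (g y) - p (g z)) / h - p (l * d)%C)%R with (p ((phi y - l) * d)).
  2:{ replace (g y) with (g z + RtoC h * (phi y * d)) by (rewrite (H y), Ey; ring).
      replace ((phi y - l) * d) with (phi y * d - l * d) by ring. rewrite Hp1.
      replace (p (g z + RtoC h * (phi y * d))) with (p (g z) + h * p (phi y * d)%C)%R.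
      - field; auto.
      - destruct Hp; subst p; [now rewrite re_plus, re_scal_l|now rewrite im_plus, im_scal_l]. }
  eapply Rle_lt_trans; [apply Hpm|]. rewrite Cmod_mult.
  apply Rlt_div_r in Hy; [|lra]. pose proof (Cmod_ge_0 (phi y - l)). nra.
Qed.

(** The squared modulus remains differentiable along a path through a zero of the function, where
    the modulus need not. *)
Definition nsq (z : C) : R := (Re z * Re z + Im z * Im z)%R.

Lemma nsq_Cmod z : nsq z = (Cmod z * Cmod z)%R.
Proof. unfold nsq. pose proof (Cmod2_alt z). simpl in H. lra. Qed.

Lemma path_nsq_deriv (g : C -> C) (z0 d : C) (s : R) (l : C) : cderiv g (z0 + RtoC s * d)%C l ->
  is_derive (fun s : R => nsq (g (z0 + RtoC s * d)%C)) s
    (2 * Re (Cconj (g (z0 + RtoC s * d)%C) * (l * d)))%R.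
Proof.
  intros H.
  assert (H1 := path_deriv Re g z0 d s l (or_introl eq_refl) H).
  assert (H2 := path_deriv Im g z0 d s l (or_intror eq_refl) H).
  unfold nsq. set (r := fun s : R => Re (g (z0 + RtoC s * d)%C)) in *.
  set (i := fun s : R => Im (g (z0 + RtoC s * d)%C)) in *.
  change (is_derive (fun s => r s * r s + i s * i s)%R s
    (2 * Re (Cconj (g (z0 + RtoC s * d)%C) * (l * d)))%R).
  auto_derive; [repeat split; eexists; eauto|].
  change (Derive (fun x : R => r x) s) with (Derive r s). change (Derive (fun x : R => i x) s) with (Derive i s).
  rewrite (is_derive_unique r _ _ H1), (is_derive_unique i _ _ H2).
  unfold r, i. destruct (g (z0 + RtoC s * d)%C), (l * d). simpl. ring.
Qed.

Lemma ode_zero (g : C -> C) z0 d (c : R -> C) K :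
  (forall s, (0 <= s <= 1)%R -> cderiv g (z0 + RtoC s * d)%C (c s * g (z0 + RtoC s * d)%C) /\
     (Cmod (c s) <= K)%R) ->
  g z0 = 0 -> g (z0 + d)%C = 0.
Proof.
  intros H H0.
  set (h := fun s : R => nsq (g (z0 + RtoC s * d)%C)).
  assert (Hh : (h 1 <= 0)%R).
  { apply (gronwall_real h (fun s => 2 * Re (Cconj (g (z0 + RtoC s * d)%C) *
        ((c s * g (z0 + RtoC s * d)%C) * d)))%R (2 * K * Cmod d)).
    - intros s Hs. destruct (H s Hs) as [Hd Hc]. split; [now apply path_nsq_deriv|].
      unfold h. rewrite nsq_Cmod. set (w := g (z0 + RtoC s * d)%C).
      assert (A : (Re (Cconj w * (c s * w * d)) <= Cmod w * (K * Cmod w * Cmod d))%R).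
      { eapply Rle_trans; [apply Rle_abs|]. eapply Rle_trans; [apply Cmod_Re_Im|].
        rewrite !Cmod_mult, Cmod_conj.
        apply Rmult_le_compat_l; [apply Cmod_ge_0|]. apply Rmult_le_compat_r; [apply Cmod_ge_0|].
        apply Rmult_le_compat_r; [apply Cmod_ge_0|auto]. }
      nra.
    - unfold h. replace (z0 + 0 * d) with z0 by ring. rewrite H0. unfold nsq; simpl; lra. }
  unfold h in Hh. rewrite nsq_Cmod in Hh. replace (z0 + 1 * d) with (z0 + d) in Hh by ring.
  apply Cmod_eq_0. pose proof (Cmod_ge_0 (g (z0 + d)%C)). nra.
Qed.

(* the Fuchsian case [s g' = c g], where the exponent bound excludes the solution [g = s] *)
Lemma ode_zero_singular (g : C -> C) q l0 (c : R -> C) :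
  cderiv g 0 l0 -> g 0 = 0 ->
  (forall s, (0 < s <= 1)%R -> exists l, cderiv g (RtoC s * q)%C l /\
     RtoC s * q * l = c s * g (RtoC s * q)%C /\ (Cmod (c s) <= / 2)%R) ->
  g q = 0.
Proof.
  intros (phi & Hphi & _ & Hc) H0 H.
  set (h := fun s : R => nsq (g (0 + RtoC s * q)%C)).
  (* Choice turns the derivatives along the ray into a function of [s], with an arbitrary value
     outside [(0, 1]]. *)
  assert (Hx : forall s : R, exists l : C, (0 < s <= 1)%R -> cderiv g (RtoC s * q)%C l /\
     RtoC s * q * l = c s * g (RtoC s * q)%C /\ (Cmod (c s) <= / 2)%R).
  { intros s. destruct (classic (0 < s <= 1)%R) as [Hs|Hs].
    - destruct (H s Hs) as (l & Hl). now exists l.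
    - exists 0. tauto. }
  set (l := fun s => proj1_sig (constructive_indefinite_description _ (Hx s))).
  assert (Hl : forall s, (0 < s <= 1)%R -> cderiv g (RtoC s * q)%C (l s) /\
     RtoC s * q * l s = c s * g (RtoC s * q)%C /\ (Cmod (c s) <= / 2)%R).
  { intros s. unfold l. now destruct constructive_indefinite_description. }
  clearbody l.
  assert (Hh : (h 1 <= 0)%R).
  { apply (gronwall_singular_real h (fun s => 2 * Re (Cconj (g (0 + RtoC s * q)%C) * (l s * q)))%R).
    - intros s Hs. destruct (Hl s Hs) as (H1 & H2 & H3). split.
      { apply path_nsq_deriv. now rewrite Cplus_0_l. }
      unfold h. rewrite nsq_Cmod, Cplus_0_l. set (w := g (RtoC s * q)%C) in *.
      replace (s * (2 * Re (Cconj w * (l s * q))))%R with (2 * Re (Cconj w * (c s * w)))%R.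
      2:{ rewrite <- H2. replace (Cconj w * (RtoC s * q * l s)) with (RtoC s * (Cconj w * (l s * q))) by ring.
          rewrite re_scal_l. ring. }
      assert (A : (Re (Cconj w * (c s * w)) <= Cmod w * (/ 2 * Cmod w))%R).
      { eapply Rle_trans; [apply Rle_abs|]. eapply Rle_trans; [apply Cmod_Re_Im|].
        rewrite !Cmod_mult, Cmod_conj.
        apply Rmult_le_compat_l; [apply Cmod_ge_0|]. apply Rmult_le_compat_r; [apply Cmod_ge_0|auto]. }
      nra.
    - intros eps He. destruct (ccont_bounded phi 0 Hc) as (r & M & Hr & HM).
      pose proof (Cmod_ge_0 q) as Hq.
      assert (HM0 : (0 <= M)%R).
      { eapply Rle_trans; [apply (Cmod_ge_0 (phi 0))|apply HM].
        replace (0 - 0) with (RtoC 0) by ring. now rewrite Cmod_0. }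
      (* Since [g] vanishes at 0 with a bounded slope, [h s] is at most [B * s ^ 2], and
         [s <= eps / B] makes this at most [eps * s]. *)
      set (B := (M * M * (Cmod q * Cmod q) + 1)%R).
      assert (HB : (1 <= B)%R) by (unfold B; nra).
      set (s := (Rmin (/ 2) (Rmin (r / (2 * (Cmod q + 1))) (eps / B)))%R).
      assert (Hs : (0 < s)%R).
      { unfold s. repeat apply Rmin_glb_lt; try lra; apply Rdiv_lt_0_compat; lra. }
      assert (Hs2 : (s <= / 2)%R) by apply Rmin_l.
      assert (Hs3 : (s <= r / (2 * (Cmod q + 1)))%R).
      { eapply Rle_trans; [apply Rmin_r|apply Rmin_l]. }
      assert (Hs4 : (s <= eps / B)%R).
      { eapply Rle_trans; [apply Rmin_r|apply Rmin_r]. }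
      exists s. split; [lra|]. unfold h. rewrite nsq_Cmod, Cplus_0_l.
      apply Rle_div_r in Hs3; [|lra]. apply Rle_div_r in Hs4; [|lra].
      rewrite (Hphi (RtoC s * q)%C), H0, Cplus_0_l.
      replace (RtoC s * q - 0) with (RtoC s * q) by ring.
      rewrite !Cmod_mult, Cmod_R, Rabs_right by lra.
      assert (Hb : (Cmod (phi (RtoC s * q)%C) <= M)%R).
      { apply HM. replace (RtoC s * q - 0) with (RtoC s * q) by ring.
        rewrite Cmod_mult, Cmod_R, Rabs_right by lra. nra. }
      pose proof (Cmod_ge_0 (phi (RtoC s * q)%C)) as Hp.
      assert (A : (Cmod (phi (RtoC s * q)%C) * Cmod (phi (RtoC s * q)%C) * (Cmod q * Cmod q) <= B)%R).
      { unfold B. assert (Cmod (phi (RtoC s * q)%C) * Cmod (phi (RtoC s * q)%C) <= M * M)%R by nra.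
        assert (0 <= Cmod q * Cmod q)%R by nra. nra. }
      replace (Cmod (phi (RtoC s * q)%C) * (s * Cmod q) * (Cmod (phi (RtoC s * q)%C) * (s * Cmod q)))%R
        with (s * (s * (Cmod (phi (RtoC s * q)%C) * Cmod (phi (RtoC s * q)%C) * (Cmod q * Cmod q))))%R by ring.
      rewrite (Rmult_comm eps). apply Rmult_le_compat_l; [lra|].
      eapply Rle_trans; [apply Rmult_le_compat_l; [lra|apply A]|]. lra. }
  unfold h in Hh. rewrite nsq_Cmod in Hh. replace (0 + 1 * q) with q in Hh by ring.
  apply Cmod_eq_0. pose proof (Cmod_ge_0 (g q)). nra.
Qed.

Lemma segment_const (g : C -> C) z0 d :
  (forall s, (0 <= s <= 1)%R -> cderiv g (z0 + RtoC s * d)%C 0) -> g (z0 + d)%C = g z0.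
Proof.
  intros H. assert (A : g (z0 + d)%C - g z0 = 0).
  { apply (ode_zero (fun y => g y - g z0) z0 d (fun _ => 0) 0).
    - intros s Hs. split; [|rewrite Cmod_0; lra].
      eapply cderiv_eq; [apply cderiv_minus; [apply H, Hs|apply cderiv_const]|].
      cbv beta; ring.
    - cbv beta; ring. }
  now apply Ceq_minus.
Qed.

(** An equation for [z * g'] says nothing about [g'] at 0; continuity there replaces the missing
    information. *)
Lemma ray_const (g : C -> C) q :
  (forall s, (0 < s <= 1)%R -> cderiv g (RtoC s * q)%C 0) -> ccont g 0 -> g q = g 0.
Proof.
  intros H Hc. apply NNPP; intros Hne.
  assert (Hp := proj1 (Cmod_gt_0 _) (Cminus_eq_contra _ _ Hne)).
  destruct (Hc _ Hp) as (d & Hd & Hy).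
  pose proof (Cmod_ge_0 q) as Hq.
  set (s := (Rmin 1 (d / (2 * (Cmod q + 1))))%R).
  assert (Hs : (0 < s)%R).
  { unfold s. apply Rmin_glb_lt; try lra; apply Rdiv_lt_0_compat; lra. }
  assert (Hs2 : (s <= 1)%R) by apply Rmin_l.
  assert (Hs3 : (s <= d / (2 * (Cmod q + 1)))%R) by apply Rmin_r.
  apply Rle_div_r in Hs3; [|lra].
  assert (E : g q = g (RtoC s * q)%C).
  { replace q with (RtoC s * q + RtoC (1 - s) * q) at 1 by (rewrite RtoC_minus; ring).
    apply segment_const. intros x Hx.
    replace (RtoC s * q + RtoC x * (RtoC (1 - s) * q)) with (RtoC (s + x * (1 - s)) * q)
      by (rewrite RtoC_plus, RtoC_mult; ring).
    apply H. nra. }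
  specialize (Hy (RtoC s * q)). rewrite <- E in Hy.
  apply (Rlt_irrefl (Cmod (g q - g 0))), Hy.
  replace (RtoC s * q - 0) with (RtoC s * q) by ring.
  rewrite Cmod_mult, Cmod_R, Rabs_right by lra. nra.
Qed.

Lemma ray_bound (q : C) s : (Cmod q < 1)%R -> (0 < s <= 1)%R -> (Cmod (RtoC s * q) < 1)%R.
Proof.
  intros Hq Hs. rewrite Cmod_mult, Cmod_R, Rabs_right by lra. pose proof (Cmod_ge_0 q). nra.
Qed.

Lemma ray_neq0 (q : C) s : q <> 0 -> (0 < s <= 1)%R -> RtoC s * q <> 0.
Proof. intros Hq Hs. apply Cmult_neq_0; auto. intros E. apply RtoC_inj in E. lra. Qed.

Lemma Euler_const (X : C -> C) q : (Cmod q < 1)%R ->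
  (forall z, (Cmod z < 1)%R -> exists l, cderiv X z l /\ z * l = 0) -> X q = X 0.
Proof.
  intros Hq H. destruct (Ceq_dec q 0) as [->|Hq0]; auto.
  apply ray_const.
  - intros s Hs. destruct (H (RtoC s * q)) as (l & Hl & E).
    { now apply ray_bound. }
    replace l with (RtoC 0) in Hl; auto.
    pose proof (ray_neq0 q s Hq0 Hs).
    replace l with ((RtoC s * q * l) / (RtoC s * q)) by (field; split; auto;
      intros E0; apply RtoC_inj in E0; lra).
    rewrite E. unfold Cdiv. ring.
  - destruct (H 0) as (l & Hl & _); [rewrite Cmod_0; lra|]. apply (cderiv_cont _ _ _ Hl).
Qed.

(** The slope [phi] extends [X y / y] across 0 with value [a], and off 0 its derivative vanishes. *)
Lemma Euler_linear (X : C -> C) q a : (Cmod q < 1)%R -> X 0 = 0 -> cderiv X 0 a ->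
  (forall z, (Cmod z < 1)%R -> exists l, cderiv X z l /\ z * l = X z) -> X q = a * q.
Proof.
  intros Hq H0 (phi & Hphi & E & Hc) H.
  assert (Hx : forall y, X y = phi y * y) by (intros y; rewrite (Hphi y), H0; ring).
  destruct (Ceq_dec q 0) as [->|Hq0]; [rewrite H0; ring|].
  rewrite Hx, <- E. f_equal. apply ray_const; auto.
  intros s Hs. pose proof (ray_neq0 q s Hq0 Hs) as Hn. set (z := RtoC s * q) in *.
  destruct (H z) as (l & Hl & El). { now apply ray_bound. }
  destruct (ccont_neq0 (fun y => y) z (ccont_id z) Hn) as (r & Hr & Hy).
  apply (cderiv_ext_loc (fun y => X y / y) phi z 0 r Hr).
  - intros y Hyz. rewrite Hx. field. now apply Hy.
  - eapply cderiv_eq; [apply (cderiv_div _ _ _ _ _ Hl (cderiv_id z) Hn)|].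
    cbv beta. rewrite <- El. field; auto.
Qed.

(** * The complex exponential *)

Lemma Cexp_0 : Cexp 0 = 1.
Proof. unfold Cexp; simpl. rewrite exp_0, cos_0, sin_0. unfold Cmult, RtoC; simpl. f_equal; ring. Qed.

Lemma Cexp_plus a b : Cexp (a + b) = Cexp a * Cexp b.
Proof.
  unfold Cexp. rewrite re_plus, im_plus, exp_plus, cos_plus, sin_plus, RtoC_mult.
  unfold Cmult, RtoC; simpl. f_equal; ring.
Qed.

Lemma Cmod_Cexp z : Cmod (Cexp z) = exp (Re z).
Proof.
  unfold Cexp. rewrite Cmod_mult, Cmod_R, Rabs_right by (apply Rle_ge, Rlt_le, exp_pos).
  rewrite <- (Rmult_1_r (exp (Re z))) at 2. f_equal. unfold Cmod; simpl.
  pose proof (sin2_cos2 (Im z)) as H. unfold Rsqr in H.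
  replace (cos (Im z) * (cos (Im z) * 1) + sin (Im z) * (sin (Im z) * 1))%R with 1%R by lra.
  apply sqrt_1.
Qed.

Lemma Cexp_neq0 z : Cexp z <> 0.
Proof. apply Cmod_gt_0. rewrite Cmod_Cexp. apply exp_pos. Qed.

Lemma Cexp_opp z : Cexp (- z) = / Cexp z.
Proof.
  assert (E : Cexp (- z) * Cexp z = 1).
  { rewrite <- Cexp_plus. replace (- z + z) with (RtoC 0) by ring. apply Cexp_0. }
  replace (Cexp (- z)) with (Cexp (- z) * Cexp z / Cexp z) by (field; apply Cexp_neq0).
  rewrite E. field. apply Cexp_neq0.
Qed.

Lemma Cexp_minus a b : Cexp (a - b) = Cexp a / Cexp b.
Proof. unfold Cminus. now rewrite Cexp_plus, Cexp_opp. Qed.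

Lemma Cexp_pow z n : Cexp z ^ n = Cexp (RtoC (INR n) * z).
Proof.
  induction n.
  - simpl. replace (0 * z) with (RtoC 0) by ring. now rewrite Cexp_0.
  - rewrite S_INR, RtoC_plus. simpl Cpow. rewrite IHn, <- Cexp_plus. f_equal. ring.
Qed.

Lemma small_deriv (f : R -> R) l eps : derivable_pt_lim f 0 l -> (0 < eps)%R ->
  exists d, (0 < d)%R /\ forall x, (Rabs x < d)%R -> (Rabs (f x - f 0 - l * x) <= eps * Rabs x)%R.
Proof.
  intros H He. destruct (H eps He) as ([d Hd] & Hx). exists d; split; auto.
  intros x Hxd. destruct (Req_dec x 0) as [->|Hx0].
  - replace (f 0 - f 0 - l * 0)%R with 0%R by ring. rewrite Rabs_R0. lra.
  - specialize (Hx x Hx0 Hxd). rewrite Rplus_0_l in Hx.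
    replace (f x - f 0 - l * x)%R with (((f x - f 0) / x - l) * x)%R by (field; auto).
    rewrite Rabs_mult. apply Rmult_le_compat_r; [apply Rabs_pos|lra].
Qed.

Lemma Cmod_le_Re_Im (z : C) : (Cmod z <= Rabs (Re z) + Rabs (Im z))%R.
Proof.
  destruct z as [x y]. replace (x, y) with (RtoC x + Ci * RtoC y)
    by (unfold Cplus, Cmult, Ci, RtoC; simpl; f_equal; ring).
  eapply Rle_trans; [apply Cmod_triangle|]. rewrite Cmod_mult, Cmod_Ci, !Cmod_R. simpl.
  replace (x + (0 * y - 1 * 0))%R with x by ring. replace (0 + (0 * 0 + 1 * y))%R with y by ring. lra.
Qed.

Lemma Cexp_small eps : (0 < eps <= 1)%R -> exists d, (0 < d)%R /\
  forall h, (Cmod h < d)%R -> (Cmod (Cexp h - 1 - h) <= 9 * eps * Cmod h)%R.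
Proof.
  intros He.
  destruct (small_deriv exp 1 eps) as (d1 & Hd1 & H1); [rewrite <- exp_0; apply derivable_pt_lim_exp|lra|].
  destruct (small_deriv cos 0 eps) as (d2 & Hd2 & H2);
    [pose proof (derivable_pt_lim_cos 0) as Hd; now rewrite sin_0, Ropp_0 in Hd|lra|].
  destruct (small_deriv sin 1 eps) as (d3 & Hd3 & H3);
    [rewrite <- cos_0; apply derivable_pt_lim_sin|lra|].
  exists (Rmin (Rmin d1 d2) (Rmin d3 eps)). split; [repeat apply Rmin_glb_lt; lra|].
  intros h Hh. destruct (Cmod_Re_Im h) as [Hx Hy].
  assert (A1 := Rlt_le_trans _ _ _ Hh (Rmin_l _ _)). assert (A2 := Rlt_le_trans _ _ _ Hh (Rmin_r _ _)).
  assert (B1 := Rlt_le_trans _ _ _ A1 (Rmin_l _ _)). assert (B2 := Rlt_le_trans _ _ _ A1 (Rmin_r _ _)).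
  assert (B3 := Rlt_le_trans _ _ _ A2 (Rmin_l _ _)). assert (B4 := Rlt_le_trans _ _ _ A2 (Rmin_r _ _)).
  clear A1 A2 Hh.
  specialize (H1 (Re h) ltac:(lra)). specialize (H2 (Im h) ltac:(lra)). specialize (H3 (Im h) ltac:(lra)).
  rewrite exp_0 in H1. rewrite cos_0 in H2. rewrite sin_0 in H3.
  set (x := Re h) in *. set (y := Im h) in *. set (m := Cmod h) in *.
  set (E := (exp x - 1 - 1 * x)%R) in *. set (c := (cos y - 1 - 0 * y)%R) in *.
  set (s := (sin y - 0 - 1 * y)%R) in *.
  assert (HE : exp x = (1 + x + E)%R) by (unfold E; ring).
  assert (Hcc : cos y = (1 + c)%R) by (unfold c; ring).
  assert (Hss : sin y = (y + s)%R) by (unfold s; ring).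
  assert (HEm : (Rabs E <= eps * m)%R) by (eapply Rle_trans; [apply H1|]; apply Rmult_le_compat_l; lra).
  assert (Hcm : (Rabs c <= eps * m)%R) by (eapply Rle_trans; [apply H2|]; apply Rmult_le_compat_l; lra).
  assert (Hsm : (Rabs s <= eps * m)%R) by (eapply Rle_trans; [apply H3|]; apply Rmult_le_compat_l; lra).
  assert (Hm : (0 <= m)%R) by apply Cmod_ge_0.
  assert (Hexp : (Rabs (exp x) <= 3)%R).
  { rewrite HE. eapply Rle_trans; [apply Rabs_triang|].
    eapply Rle_trans; [apply Rplus_le_compat_r, Rabs_triang|]. rewrite Rabs_R1. nra. }
  eapply Rle_trans; [apply Cmod_le_Re_Im|].
  assert (R1 : (Rabs (Re (Cexp h - 1 - h)) <= 4 * (eps * m))%R).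
  { replace (Re (Cexp h - 1 - h)) with (exp x * c + E)%R.
    - eapply Rle_trans; [apply Rabs_triang|]. rewrite Rabs_mult.
      assert (Rabs (exp x) * Rabs c <= 3 * (eps * m))%R by (apply Rmult_le_compat; auto; apply Rabs_pos).
      lra.
    - unfold Cexp. fold x y. simpl. change (fst h) with x.
      unfold E. replace c with (cos y - 1)%R by (unfold c; ring). ring. }
  assert (R2 : (Rabs (Im (Cexp h - 1 - h)) <= 5 * (eps * m))%R).
  { replace (Im (Cexp h - 1 - h)) with (exp x * s + (x + E) * y)%R.
    - eapply Rle_trans; [apply Rabs_triang|]. rewrite !Rabs_mult.
      assert (Rabs (exp x) * Rabs s <= 3 * (eps * m))%R by (apply Rmult_le_compat; auto; apply Rabs_pos).
      assert (Rabs (x + E) * Rabs y <= (2 * eps) * m)%R.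
      { apply Rmult_le_compat; auto; try apply Rabs_pos.
        eapply Rle_trans; [apply Rabs_triang|]. nra. }
      lra.
    - unfold Cexp. fold x y. simpl. change (snd h) with y. rewrite Hss, HE. ring. }
  lra.
Qed.

Lemma cderiv_Cexp z : cderiv Cexp z (Cexp z).
Proof.
  exists (fun y => if excluded_middle_informative (y = z) then Cexp z else (Cexp y - Cexp z) / (y - z)).
  split; [|split].
  - intros y. destruct excluded_middle_informative as [E|E].
    + subst. ring.
    + field. now apply Cminus_eq_contra.
  - destruct excluded_middle_informative; tauto.
  - intros eps He. pose proof (Cmod_ge_0 (Cexp z)) as Hz.
    set (e := Rmin 1 (eps / (10 * (Cmod (Cexp z) + 1)))%R).
    assert (He0 : (0 < e <= 1)%R).
    { split; [|apply Rmin_l]. apply Rmin_glb_lt; [lra|]. apply Rdiv_lt_0_compat; lra. }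
    assert (He1 : (e * (10 * (Cmod (Cexp z) + 1)) <= eps)%R).
    { apply Rle_div_r; [lra|apply Rmin_r]. }
    destruct (Cexp_small e He0) as (d & Hd & Hh).
    exists d; split; auto. intros y Hy.
    destruct (excluded_middle_informative (z = z)) as [_|]; [|tauto].
    destruct excluded_middle_informative as [E|E].
    + replace (Cexp z - Cexp z) with (RtoC 0) by ring. now rewrite Cmod_0.
    + assert (N : y - z <> 0) by now apply Cminus_eq_contra.
      specialize (Hh (y - z) Hy).
      replace (Cexp y) with (Cexp z * Cexp (y - z)) by (rewrite <- Cexp_plus; f_equal; ring).
      replace ((Cexp z * Cexp (y - z) - Cexp z) / (y - z) - Cexp z)
        with (Cexp z * ((Cexp (y - z) - 1 - (y - z)) / (y - z))) by (field; auto).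
      rewrite Cmod_mult, Cmod_div by auto. pose proof (proj1 (Cmod_gt_0 _) N) as Np.
      assert (A : (Cmod (Cexp (y - z) - 1 - (y - z)) / Cmod (y - z) <= 9 * e)%R)
        by (apply Rle_div_l; auto).
      assert (Cmod (Cexp z) * (Cmod (Cexp (y - z) - 1 - (y - z)) / Cmod (y - z)) <= Cmod (Cexp z) * (9 * e))%R
        by (apply Rmult_le_compat_l; auto).
      nra.
Qed.

Lemma cderiv_Cexp_comp f z l : cderiv f z l -> cderiv (fun y => Cexp (f y)) z (Cexp (f z) * l).
Proof. intros H. apply (cderiv_comp Cexp f); auto. apply cderiv_Cexp. Qed.

(** * Geometric and logarithmic series *)

Lemma ex_series_poly_geom k r : (0 <= r < 1)%R -> ex_series (fun n => INR (S n) ^ k * r ^ n)%R.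
Proof.
  intros Hr. set (rho := ((1 + r) / 2)%R).
  assert (Hrho : (0 < rho < 1 /\ r <= rho)%R) by (unfold rho; lra).
  apply (@ex_series_le R_AbsRing R_CompleteNormedModule _ (fun n => Rabs (INR (S n) ^ k * rho ^ n))%R).
  - intros n. unfold norm; simpl. unfold abs; simpl.
    rewrite !Rabs_mult. apply Rmult_le_compat_l; [apply Rabs_pos|].
    rewrite !Rabs_right; [|apply Rle_ge, pow_le; lra|apply Rle_ge, pow_le; lra].
    apply pow_incr; lra.
  - apply (ex_series_DAlembert _ rho).
    + lra.
    + intros n. apply Rmult_integral_contrapositive. split; apply pow_nonzero; [|lra].
      apply not_0_INR; lia.
    + apply (is_lim_seq_ext (fun n => rho * (1 + / INR (S n)) ^ k)%R).
      { intros n. rewrite Rabs_right.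
        - assert (INR (S n) <> 0)%R by (apply not_0_INR; lia).
          replace (1 + / INR (S n))%R with (INR (S (S n)) / INR (S n))%R.
          + unfold Rdiv. rewrite Rpow_mult_distr, pow_inv. simpl pow.
            field. split; apply pow_nonzero; auto. lra.
          + rewrite (S_INR (S n)). field. auto.
        - apply Rle_ge. apply Rmult_le_pos.
          + apply Rmult_le_pos; apply pow_le; [apply pos_INR|lra].
          + left. apply Rinv_0_lt_compat. apply Rmult_lt_0_compat; apply pow_lt; [|lra].
            apply lt_0_INR; lia. }
      replace rho with (rho * (1 + 0) ^ k)%R at 1 by (rewrite Rplus_0_r, pow1; ring).
      assert (Hinv : is_lim_seq (fun n => / INR (S n))%R 0).
      { apply is_lim_seq_incr_1 with (u := fun n => (/ INR n)%R).
        replace (Finite 0) with (Rbar_inv p_infty) by reflexivity.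
        apply is_lim_seq_inv; [apply is_lim_seq_INR|easy]. }
      assert (H1 : is_lim_seq (fun n => 1 + / INR (S n))%R (1 + 0)%R).
      { apply is_lim_seq_plus'; auto. apply is_lim_seq_const. }
      assert (H2 : forall j, is_lim_seq (fun n => (1 + / INR (S n)) ^ j)%R ((1 + 0) ^ j)%R).
      { induction j; simpl; [apply is_lim_seq_const|]. apply is_lim_seq_mult'; auto. }
      apply is_lim_seq_mult'; [apply is_lim_seq_const|apply H2].
Qed.

Lemma summable_poly_geom (f : nat -> C) k K r : (0 <= r < 1)%R ->
  (forall n, (Cmod (f n) <= K * (INR (S n) ^ k * r ^ n))%R) -> summable f.
Proof.
  intros Hr H. apply (summable_nat _ _ H).
  apply (ex_series_scal (V := R_NormedModule) K). now apply ex_series_poly_geom.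
Qed.

Lemma summable_geom z : (Cmod z < 1)%R -> summable (fun n => z ^ n).
Proof.
  intros Hz. apply (summable_poly_geom _ 0 1 (Cmod z)).
  - split; auto. apply Cmod_ge_0.
  - intros n. rewrite Cmod_pow. simpl. lra.
Qed.

Lemma one_minus_neq0 z : (Cmod z < 1)%R -> 1 - z <> 0.
Proof.
  intros Hz E. replace z with (RtoC 1) in Hz.
  - rewrite Cmod_1 in Hz. lra.
  - replace (RtoC 1) with (z + (1 - z)) by ring. rewrite E. ring.
Qed.

Lemma has_sum_geom z : (Cmod z < 1)%R -> has_sum (fun n => z ^ n) (/ (1 - z)).
Proof.
  intros Hz. destruct (summable_has_sum _ (summable_geom z Hz)) as (s & Hs).
  replace (/ (1 - z)) with s; auto.
  assert (H1 : has_sum (fun n : nat => match n with O => RtoC 0 | S m => z ^ n end) (z * s)).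
  { apply (has_sum_reindex S).
    - intros; lia.
    - intros [|i] Hi; [tauto|eauto].
    - simpl. now apply has_sum_scal. }
  assert (H2 := has_sum_minus _ _ _ _ Hs H1).
  assert (H3 : has_sum (fun i : nat => z ^ i - match i with O => RtoC 0 | S m => z ^ i end) 1).
  { assert (H3 := has_sum_single (fun i : nat => z ^ i - match i with O => RtoC 0 | S m => z ^ i end) O).
    cbv beta iota in H3. replace (z ^ 0 - 0) with (RtoC 1) in H3 by (simpl; ring).
    apply H3. intros [|i] Hi; [tauto|simpl; ring]. }
  pose proof (has_sum_unique _ _ _ H2 H3) as E.
  apply (f_equal (fun x => x / (1 - z))) in E.
  pose proof (one_minus_neq0 z Hz).
  replace s with ((s - z * s) / (1 - z)) by (field; auto). rewrite E. field; auto.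
Qed.

(** The series of [- log (1 - z)]. *)
Definition logser (z : C) : C := CSeries (fun n => / RtoC (INR (S n)) * z ^ S n).

Lemma INR_S_neq0 n : RtoC (INR (S n)) <> 0.
Proof. intros E. apply RtoC_inj in E. pose proof (pos_INR n). rewrite S_INR in E. lra. Qed.

Lemma Cmod_INR n : Cmod (RtoC (INR n)) = INR n.
Proof. rewrite Cmod_R, Rabs_right; auto. apply Rle_ge, pos_INR. Qed.

Lemma logser_summable z : (Cmod z < 1)%R -> summable (fun n => / RtoC (INR (S n)) * z ^ S n).
Proof.
  intros Hz. apply (summable_le _ (fun n => z ^ n)); [|now apply summable_geom].
  intros n. simpl Cpow. rewrite !Cmod_mult, Cmod_inv, Cmod_INR by apply INR_S_neq0.
  assert (0 < / INR (S n) <= 1)%R.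
  { rewrite S_INR. pose proof (pos_INR n). split; [apply Rinv_0_lt_compat; lra|].
    rewrite <- Rinv_1. apply Rinv_le_contravar; lra. }
  pose proof (Cmod_ge_0 z). pose proof (Cmod_ge_0 (z ^ n)).
  assert (0 <= Cmod z * Cmod (z ^ n) <= Cmod (z ^ n))%R by nra. nra.
Qed.

Lemma logser_deriv z : (Cmod z < 1)%R -> cderiv logser z (/ (1 - z)).
Proof.
  intros Hz.
  destruct (gps_deriv (fun n => / RtoC (INR (S n))) S logser) with (z := z) as (l & Hl & Hl'); auto.
  - intros r Hr. apply logser_summable. rewrite Cmod_R, Rabs_right; lra.
  - intros y Hy. apply summable_CSeries. now apply logser_summable.
  - eapply cderiv_eq; [apply Hl|].
    apply (has_sum_unique _ _ _ Hl').
    eapply has_sum_ext; [|apply (has_sum_geom z Hz)].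
    intros n. cbv beta.
    assert (E : forall m, dpow (S m) z = RtoC (INR (S m)) * z ^ m).
    { induction m; [simpl; ring|]. change (dpow (S (S m)) z) with (z * dpow (S m) z + z ^ S m).
      rewrite IHm, (S_INR (S m)), RtoC_plus. simpl Cpow. ring. }
    rewrite E. pose proof (INR_S_neq0 n). field; auto.
Qed.

Lemma logser_0 : logser 0 = 0.
Proof.
  apply CSeries_has_sum. eapply has_sum_ext; [|apply has_sum_0]. intros n; simpl; ring.
Qed.

(** The product [Cexp (logser z) * (1 - z)] has derivative 0 on the disc, so no branch of the
    logarithm has to be discussed. *)
Lemma Cexp_logser z : (Cmod z < 1)%R -> Cexp (- logser z) = 1 - z.
Proof.
  intros Hz.
  assert (E : Cexp (logser z) * (1 - z) = Cexp (logser 0) * (1 - 0)).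
  { apply (Euler_const (fun y => Cexp (logser y) * (1 - y)) z Hz). intros y Hy.
    pose proof (one_minus_neq0 y Hy).
    eexists. split.
    - apply cderiv_mult; [apply cderiv_Cexp_comp, logser_deriv, Hy|].
      apply cderiv_minus; [apply cderiv_const|apply cderiv_id].
    - cbv beta. field; auto. }
  rewrite logser_0, Cexp_0 in E.
  rewrite Cexp_opp. pose proof (Cexp_neq0 (logser z)).
  replace (1 - z) with (Cexp (logser z) * (1 - z) / Cexp (logser z)) by (field; auto).
  rewrite E. field; auto.
Qed.

(** * Convolution of Lambert series *)

(** Attached to the Lambert index [n + 1]; this shift by one runs through all the sums that
    follow. *)
Definition lam (q : C) (n : nat) : C := q ^ S n / (1 - q ^ S n).

Lemma Cmod_pow_lt1 q n : (Cmod q < 1)%R -> (Cmod (q ^ S n) < 1)%R.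
Proof.
  intros H. rewrite Cmod_pow. pose proof (Cmod_ge_0 q).
  apply Rle_lt_trans with (Cmod q ^ 1)%R; [|simpl; lra].
  simpl. assert (Cmod q ^ n <= 1)%R by (rewrite <- (pow1 n); apply pow_incr; lra).
  nra.
Qed.

Lemma lam_den q n : (Cmod q < 1)%R -> 1 - q ^ S n <> 0.
Proof. intros. now apply one_minus_neq0, Cmod_pow_lt1. Qed.

Lemma Cmod_one_minus z : (1 - Cmod z <= Cmod (1 - z))%R.
Proof.
  assert (Cmod 1 <= Cmod (1 - z) + Cmod z)%R.
  { replace (RtoC 1) with ((1 - z) + z) at 1 by ring. apply Cmod_triangle. }
  rewrite Cmod_1 in H. lra.
Qed.

Lemma lam_bound q n : (Cmod q < 1)%R -> (Cmod (lam q n) <= / (1 - Cmod q) * Cmod q ^ n)%R.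
Proof.
  intros H. unfold lam. pose proof (Cmod_ge_0 q) as Hq.
  rewrite Cmod_div by now apply lam_den.
  assert (A : (Cmod (q ^ S n) <= Cmod q ^ n)%R).
  { rewrite Cmod_pow. simpl. pose proof (pow_le (Cmod q) n Hq). nra. }
  assert (B : (Cmod (q ^ S n) <= Cmod q)%R).
  { rewrite Cmod_pow. simpl. assert (Cmod q ^ n <= 1)%R by (rewrite <- (pow1 n); apply pow_incr; lra). nra. }
  pose proof (Cmod_one_minus (q ^ S n)). pose proof (Cmod_ge_0 (q ^ S n)).
  rewrite Rmult_comm. apply Rmult_le_compat; auto.
  - left; apply Rinv_0_lt_compat. lra.
  - apply Rinv_le_contravar; lra.
Qed.

(** The addition formula for [x / (1 - x)] with [x = q^a], [y = q^b], [a = i + 1], [b = j + 1]; the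
    index [S (i + j)] belongs to [a + b]. This is the only arithmetic input of the convolution
    identity. *)
Lemma lam_mult q i j : (Cmod q < 1)%R ->
  lam q i * lam q j = lam q (S (i + j)) * (1 + lam q i + lam q j).
Proof.
  intros H. pose proof (lam_den q i H) as Hi. pose proof (lam_den q j H) as Hj.
  pose proof (lam_den q (S (i + j)) H) as Hij. unfold lam.
  replace (q ^ S (S (i + j))) with (q ^ S i * q ^ S j) in *
    by (rewrite <- Cpow_add_r; f_equal; lia).
  generalize dependent (q ^ S i). generalize dependent (q ^ S j). intros x Hx y Hy Hxy.
  field. auto.
Qed.

Section Weighted.
Variables (q : C) (F : nat -> C) (K : R) (k : nat).
Hypothesis Hq : (Cmod q < 1)%R.
Hypothesis HF : forall n, (Cmod (F n) <= K * INR (S n) ^ k)%R.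

Lemma K_nonneg : (0 <= K)%R.
Proof.
  specialize (HF 0%nat). rewrite pow1 in HF. pose proof (Cmod_ge_0 (F 0%nat)). lra.
Qed.

Lemma summable_weighted : summable (fun n => F n * lam q n).
Proof.
  apply (summable_poly_geom _ k (K * / (1 - Cmod q)) (Cmod q)).
  { split; auto. apply Cmod_ge_0. }
  intros n. rewrite Cmod_mult.
  replace (K * / (1 - Cmod q) * (INR (S n) ^ k * Cmod q ^ n))%R with
    ((K * INR (S n) ^ k) * (/ (1 - Cmod q) * Cmod q ^ n))%R by ring.
  apply Rmult_le_compat; try apply Cmod_ge_0; auto. now apply lam_bound.
Qed.

Lemma Cmod_lam_le n : (Cmod (lam q n) <= / (1 - Cmod q))%R.
Proof.
  eapply Rle_trans; [now apply lam_bound|]. pose proof (Cmod_ge_0 q).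
  rewrite <- (Rmult_1_r (/ (1 - Cmod q))) at 2.
  apply Rmult_le_compat_l; [left; apply Rinv_0_lt_compat; lra|].
  rewrite <- (pow1 n). apply pow_incr; lra.
Qed.

Lemma summable_weighted_sqr : summable (fun n => F n * (lam q n * lam q n)).
Proof.
  apply (summable_ext (fun n => lam q n * (F n * lam q n))); [intros; ring|].
  apply (summable_mult_bounded _ _ (/ (1 - Cmod q))); [apply Cmod_lam_le|apply summable_weighted].
Qed.

End Weighted.

Lemma lsum_seq_S (f : nat -> C) n : lsum f (seq 0 (S n)) = lsum f (seq 0 n) + f n.
Proof. rewrite seq_S, lsum_app. simpl. ring. Qed.

Lemma lsum_rev (f : nat -> C) n : lsum (fun i => f (n - 1 - i)%nat) (seq 0 n) = lsum f (seq 0 n).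
Proof.
  rewrite <- (lsum_map (fun i => (n - 1 - i)%nat) f). apply lsum_perm, NoDup_Permutation.
  - clear. assert (H : NoDup (seq 0 n)) by apply seq_NoDup.
    apply NoDup_map_NoDup_ForallPairs; auto.
    intros a b Ha Hb. apply in_seq in Ha, Hb. lia.
  - apply seq_NoDup.
  - intros x. rewrite in_map_iff, in_seq. split.
    + intros (y & <- & Hy). apply in_seq in Hy. lia.
    + intros H. exists (n - 1 - x)%nat. split; [lia|]. apply in_seq. lia.
Qed.

(** The substitution [n = i + j + 1] is a bijection from all pairs onto those with [i < n]. *)
Lemma has_sum_triangle (f : nat -> nat -> C) s :
  has_sum (fun p : nat * nat => f (S (fst p + snd p)) (fst p)) s ->
  has_sum (fun n => lsum (f n) (seq 0 n)) s.
Proof.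
  intros H.
  assert (H1 : has_sum (fun p : nat * nat => if lt_dec (snd p) (fst p) then f (fst p) (snd p) else 0) s).
  { apply (has_sum_reindex (fun p : nat * nat => (S (fst p + snd p), fst p))).
    - intros [a b] [c d] E; simpl in E. inversion E. f_equal; lia.
    - intros [n i]. simpl. destruct (lt_dec i n); [|tauto]. intros _.
      exists (i, (n - 1 - i)%nat). simpl. f_equal. lia.
    - eapply has_sum_ext; [|exact H]. intros [i j]. simpl.
      destruct (lt_dec i (S (i + j))); [auto|lia]. }
  apply (has_sum_fubini _ _ _ H1). intros n. simpl.
  replace (lsum (f n) (seq 0 n)) with (lsum (fun j => if lt_dec j n then f n j else 0) (seq 0 n)).
  - apply has_sum_finite; [apply seq_NoDup|]. intros i Hi. destruct (lt_dec i n); auto.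
    elim Hi. apply in_seq. lia.
  - apply lsum_ext. intros i Hi. apply in_seq in Hi. destruct (lt_dec i n); [auto|lia].
Qed.

Lemma summable_triangle (F : nat -> C) K k q : (Cmod q < 1)%R ->
  (forall n, (Cmod (F n) <= K * INR (S n) ^ k)%R) ->
  summable (fun p : nat * nat => F (fst p) * lam q (S (fst p + snd p))).
Proof.
  intros Hq HF. pose proof (Cmod_ge_0 q) as Hq0.
  assert (S1 : summable (fun n => F n * q ^ n)).
  { apply (summable_poly_geom _ k K (Cmod q)); [lra|]. intros n.
    rewrite Cmod_mult, Cmod_pow, <- Rmult_assoc.
    apply Rmult_le_compat_r; [now apply pow_le|auto]. }
  apply (summable_le_scal (/ (1 - Cmod q)) _ (fun p => (F (fst p) * q ^ fst p) * (q ^ snd p))).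
  - intros [m j]. simpl fst; simpl snd. rewrite !Cmod_mult.
    rewrite Rmult_comm.
    apply Rle_trans with (/ (1 - Cmod q) * (Cmod q ^ m * Cmod q ^ j) * Cmod (F m))%R.
    + apply Rmult_le_compat_r; [apply Cmod_ge_0|].
      eapply Rle_trans; [apply lam_bound; auto|].
      apply Rmult_le_compat_l; [left; apply Rinv_0_lt_compat; lra|].
      rewrite <- pow_add. simpl. pose proof (pow_le (Cmod q) (m + j) Hq0). nra.
    + rewrite !Cmod_pow. right; ring.
  - apply (summable_prod (fun n => F n * q ^ n) (fun n => q ^ n)); auto. now apply summable_geom.
Qed.

Section Convolution.
Variables (q : C) (F : nat -> C) (K : R) (k : nat).
Hypothesis Hq : (Cmod q < 1)%R.
Hypothesis HF : forall n, (Cmod (F n) <= K * INR (S n) ^ k)%R.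
Hypothesis F0 : F 0%nat = 0.

Let u := lam q.
Let U n := lsum u (seq 0 n).

(** The two truncated differences add up to [|i - j|]. As [|i - j| + 1] is at most
    [(i + 1) (j + 1)], the weight is dominated by a product. *)
Lemma summable_conv_diff :
  summable (fun p : nat * nat => F (fst p - snd p + (snd p - fst p)) * (u (fst p) * u (snd p))).
Proof.
  apply (summable_le_scal 1 _ (fun p : nat * nat =>
    (RtoC (K * INR (S (fst p)) ^ k) * u (fst p)) * (RtoC (INR (S (snd p)) ^ k) * u (snd p)))).
  - intros [i j]. cbn [fst snd]. rewrite Rmult_1_l, !Cmod_mult, !Cmod_R.
    pose proof (K_nonneg F K k HF) as HK.
    rewrite !Rabs_right; try (apply Rle_ge; try apply Rmult_le_pos; auto; apply pow_le, pos_INR).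
    apply Rle_trans with ((K * INR (S i) ^ k * INR (S j) ^ k) * (Cmod (u i) * Cmod (u j)))%R; [|right; ring].
    apply Rmult_le_compat_r; [apply Rmult_le_pos; apply Cmod_ge_0|].
    eapply Rle_trans; [apply HF|]. rewrite Rmult_assoc. apply Rmult_le_compat_l; auto.
    rewrite <- Rpow_mult_distr. apply pow_incr. split; [apply pos_INR|].
    rewrite <- mult_INR. apply le_INR. nia.
  - apply (summable_prod (fun n => RtoC (K * INR (S n) ^ k) * u n) (fun n => RtoC (INR (S n) ^ k) * u n)).
    + apply (summable_weighted q _ K k Hq). intros n. rewrite Cmod_R, Rabs_right; [lra|].
      apply Rle_ge, Rmult_le_pos; [apply (K_nonneg F K k HF)|apply pow_le, pos_INR].
    + apply (summable_weighted q _ 1 k Hq). intros n. rewrite Cmod_R, Rabs_right; [lra|].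
      apply Rle_ge, pow_le, pos_INR.
Qed.

Lemma summable_conv_sum :
  summable (fun p : nat * nat => F (S (S (fst p + snd p))) * (u (fst p) * u (snd p))).
Proof.
  apply (summable_le_scal 1 _ (fun p : nat * nat =>
    (RtoC (K * (3 ^ k * INR (S (fst p)) ^ k)) * u (fst p)) * (RtoC (INR (S (snd p)) ^ k) * u (snd p)))).
  - intros [i j]. cbn [fst snd]. rewrite Rmult_1_l, !Cmod_mult, !Cmod_R.
    pose proof (K_nonneg F K k HF) as HK.
    assert (P3 : (0 <= 3 ^ k)%R) by (apply pow_le; lra).
    rewrite !Rabs_right; try (apply Rle_ge; repeat apply Rmult_le_pos; auto; apply pow_le, pos_INR).
    apply Rle_trans with ((K * (3 ^ k * INR (S i) ^ k) * INR (S j) ^ k) * (Cmod (u i) * Cmod (u j)))%R; [|right; ring].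
    apply Rmult_le_compat_r; [apply Rmult_le_pos; apply Cmod_ge_0|].
    eapply Rle_trans; [apply HF|]. rewrite Rmult_assoc. apply Rmult_le_compat_l; auto.
    rewrite <- !Rpow_mult_distr. apply pow_incr. split; [apply pos_INR|].
    replace 3%R with (INR 3) by (simpl; lra).
    rewrite <- !mult_INR. apply le_INR. nia.
  - apply (summable_prod (fun n => RtoC (K * (3 ^ k * INR (S n) ^ k)) * u n) (fun n => RtoC (INR (S n) ^ k) * u n)).
    + apply (summable_weighted q _ (K * 3 ^ k) k Hq). intros n. rewrite Cmod_R, Rabs_right; [lra|].
      apply Rle_ge, Rmult_le_pos; [apply (K_nonneg F K k HF)|apply Rmult_le_pos; apply pow_le; [lra|apply pos_INR]].
    + apply (summable_weighted q _ 1 k Hq). intros n. rewrite Cmod_R, Rabs_right; [lra|].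
      apply Rle_ge, pow_le, pos_INR.
Qed.

(** By [lam_mult] the pairs with [i + j + 1 = n] carry the common factor [u n]; there are [n] of
    them, and the terms [1 + u i + u j] add up to [n + 2 * U n]. *)
Lemma conv_sum_value s :
  has_sum (fun p : nat * nat => F (S (S (fst p + snd p))) * (u (fst p) * u (snd p))) s ->
  has_sum (fun n => F (S n) * u n * (RtoC (INR n) + 2 * U n)) s.
Proof.
  intros H.
  eapply has_sum_ext; [|apply (has_sum_triangle (fun n i => F (S n) * u n * (1 + u i + u (n - 1 - i)%nat)))].
  - intros n. cbv beta. rewrite lsum_scal. f_equal.
    rewrite (lsum_plus (fun i => 1 + u i)), (lsum_plus (fun _ => 1)), lsum_rev.
    assert (E : lsum (fun _ : nat => RtoC 1) (seq 0 n) = RtoC (INR n)).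
    { clear. induction n; [reflexivity|]. rewrite lsum_seq_S, IHn, S_INR, RtoC_plus. ring. }
    rewrite E. unfold U. ring.
  - eapply has_sum_ext; [|exact H]. intros [i j]. simpl fst; simpl snd.
    replace (S (i + j) - 1 - i)%nat with j by lia. unfold u. rewrite lam_mult by auto. ring.
Qed.

Lemma lam_tail_summable m : summable (fun j => u (S (m + j))).
Proof.
  apply (summable_inj (fun j => S (m + j)) u); [intros; lia|].
  apply (summable_ext (fun n => 1 * lam q n)); [intros; unfold u; ring|].
  apply (summable_weighted q (fun _ => 1) 1 0 Hq). intros; rewrite Cmod_1; simpl; lra.
Qed.

(** Subtracting from a convergent series its shift by [m + 1] leaves the first [m + 1] terms. *)
Lemma lam_telescope m R : has_sum (fun j => u (S (m + j))) R ->
  has_sum (fun j => u j - u (S (m + j))) (U (S m)).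
Proof.
  intros HR.
  assert (S0 : summable u).
  { apply (summable_ext (fun n => 1 * lam q n)); [intros; unfold u; ring|].
    apply (summable_weighted q (fun _ => 1) 1 0 Hq). intros; rewrite Cmod_1; simpl; lra. }
  destruct (summable_has_sum _ S0) as (s & Hs).
  assert (H1 : has_sum (fun i => if le_dec (S m) i then u i else 0) R).
  { apply (has_sum_reindex (fun j => S (m + j))).
    - intros; lia.
    - intros i. destruct (le_dec (S m) i); [|tauto]. exists (i - S m)%nat. lia.
    - eapply has_sum_ext; [|exact HR]. intros j. cbv beta. destruct (le_dec (S m) (S (m + j))); [auto|lia]. }
  assert (H2 := has_sum_minus _ _ _ _ Hs H1).
  assert (H3 : has_sum (fun i => if le_dec (S m) i then 0 else u i) (U (S m))).
  { replace (U (S m)) with (lsum (fun i => if le_dec (S m) i then 0 else u i) (seq 0 (S m))).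
    - apply has_sum_finite; [apply seq_NoDup|]. intros i Hi. destruct (le_dec (S m) i); auto.
      elim Hi. apply in_seq. lia.
    - apply lsum_ext. intros i Hi. apply in_seq in Hi. destruct (le_dec (S m) i); [lia|auto]. }
  assert (E : s - R = U (S m)).
  { apply (has_sum_unique _ _ _ H2). eapply has_sum_ext; [|exact H3].
    intros i; cbv beta. destruct (le_dec (S m) i); ring. }
  rewrite <- E. now apply has_sum_minus.
Qed.

(** The diagonal drops out because [F 0 = 0], and the halves above and below it agree. In each half
    [lam_mult] rewrites [u_(m+j+1) u_j] as [u_m (u_j - u_(m+j+1)) - u_(m+j+1)]: the first part
    telescopes in [j], and the second, summed the other way round, is the [H] on the right. *)
Lemma conv_diff_value s H :
  has_sum (fun p : nat * nat => F (fst p - snd p + (snd p - fst p)) * (u (fst p) * u (snd p))) s ->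
  has_sum (fun n => u n * lsum (fun m => F (S m)) (seq 0 n)) H ->
  has_sum (fun m => 2 * (F (S m) * u m * U (S m))) (s + 2 * H).
Proof.
  intros Hs HH.
  set (f := fun p : nat * nat => F (fst p - snd p + (snd p - fst p)) * (u (fst p) * u (snd p))) in *.
  set (g := fun p : nat * nat => F (S (fst p)) * (u (S (fst p + snd p)) * u (snd p))).
  assert (Inj1 : forall x y : nat * nat, (S (fst x + snd x), snd x) = (S (fst y + snd y), snd y) -> x = y).
  { intros [a b] [c d] E; simpl in E. inversion E. f_equal; lia. }
  assert (Inj2 : forall x y : nat * nat, (snd x, S (fst x + snd x)) = (snd y, S (fst y + snd y)) -> x = y).
  { intros [a b] [c d] E; simpl in E. inversion E. f_equal; lia. }
  assert (Sg : summable g).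
  { apply (summable_ext (fun p => f (S (fst p + snd p), snd p))).
    - intros [m j]. unfold f, g. cbn [fst snd].
      replace (S (m + j) - j + (j - S (m + j)))%nat with (S m) by lia. auto.
    - apply (summable_inj (fun p : nat * nat => (S (fst p + snd p), snd p)) f); auto.
      apply summable_conv_diff. }
  destruct (summable_has_sum g Sg) as (G & HG).
  assert (HG1 : has_sum (fun p : nat * nat => if lt_dec (snd p) (fst p) then f p else 0) G).
  { apply (has_sum_reindex (fun p : nat * nat => (S (fst p + snd p), snd p))); auto.
    - intros [i j]. simpl. destruct (lt_dec j i); [|tauto]. intros _.
      exists (i - S j, j)%nat. simpl. f_equal. lia.
    - eapply has_sum_ext; [|exact HG]. intros [m j]. unfold f, g. cbn [fst snd].
      destruct (lt_dec j (S (m + j))); [|lia].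
      replace (S (m + j) - j + (j - S (m + j)))%nat with (S m) by lia. auto. }
  assert (HG2 : has_sum (fun p : nat * nat => if lt_dec (fst p) (snd p) then f p else 0) G).
  { apply (has_sum_reindex (fun p : nat * nat => (snd p, S (fst p + snd p)))); auto.
    - intros [i j]. simpl. destruct (lt_dec i j); [|tauto]. intros _.
      exists (j - S i, i)%nat. simpl. f_equal. lia.
    - eapply has_sum_ext; [|exact HG]. intros [m j]. unfold f, g. cbn [fst snd].
      destruct (lt_dec j (S (m + j))); [|lia].
      replace (j - S (m + j) + (S (m + j) - j))%nat with (S m) by lia. ring. }
  assert (E : s = G + G).
  { apply (has_sum_unique _ _ _ Hs). eapply has_sum_ext; [|apply (has_sum_plus _ _ _ _ HG1 HG2)].
    intros [i j]. cbn [fst snd]. destruct (lt_dec j i), (lt_dec i j); try lia; try ring.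
    unfold f. cbn [fst snd]. replace (i - j + (j - i))%nat with 0%nat by lia. rewrite F0. ring. }
  set (Rm := fun m => CSeries (fun j => u (S (m + j)))).
  assert (HR : forall m, has_sum (fun j => u (S (m + j))) (Rm m)).
  { intros m. apply summable_CSeries, lam_tail_summable. }
  assert (HG3 : has_sum (fun m => F (S m) * (u m * U (S m) - Rm m)) G).
  { apply (has_sum_fubini _ _ _ HG). intros m. unfold g. cbn [fst snd].
    apply has_sum_scal.
    eapply has_sum_ext; [|apply has_sum_minus; [apply (has_sum_scal (u m) _ _ (lam_telescope m (Rm m) (HR m)))|apply HR]].
    intros j. cbv beta. pose proof (lam_mult q m j Hq) as L. fold u in L.
    transitivity (u m * u j - u (S (m + j)) * (1 + u m + u j) + u (S (m + j)) * u j); [ring|].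
    rewrite <- L. ring. }
  assert (HF' : forall n, (Cmod (F (S n)) <= (K * 2 ^ k) * INR (S n) ^ k)%R).
  { intros n. eapply Rle_trans; [apply HF|]. rewrite Rmult_assoc.
    apply Rmult_le_compat_l; [apply (K_nonneg F K k HF)|].
    rewrite <- Rpow_mult_distr. apply pow_incr. split; [apply pos_INR|].
    replace 2%R with (INR 2) by (simpl; lra).
    rewrite <- mult_INR. apply le_INR. lia. }
  destruct (summable_has_sum _ (summable_triangle (fun n => F (S n)) _ k q Hq HF')) as (H' & HH').
  assert (E' : H' = H).
  { apply (has_sum_unique (fun n => u n * lsum (fun m => F (S m)) (seq 0 n))); auto.
    eapply has_sum_ext; [|apply (has_sum_triangle (fun n m => u n * F (S m)))].
    - intros n. cbv beta. now rewrite lsum_scal.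
    - eapply has_sum_ext; [|exact HH']. intros [m j]. cbn [fst snd]. unfold u. ring. }
  subst H'.
  assert (HH2 : has_sum (fun m => F (S m) * Rm m) H).
  { apply (has_sum_fubini _ _ _ HH'). intros m. cbn [fst snd]. apply has_sum_scal, HR. }
  rewrite E. replace (G + G + 2 * H) with (2 * (G + H)) by ring.
  eapply has_sum_ext; [|apply has_sum_scal, (has_sum_plus _ _ _ _ HG3 HH2)].
  intros m. cbv beta. ring.
Qed.

(* From u_a u_b = u_{a+b} (1 + u_a + u_b): the Lambert form of Liouville's convolution identity. *)
Lemma convolution_identity X B H :
  has_sum (fun p : nat * nat =>
    (F (fst p - snd p + (snd p - fst p)) - F (S (S (fst p + snd p)))) * (u (fst p) * u (snd p))) X ->
  has_sum (fun m => F (S m) * (2 * (u m * u m) - RtoC (INR m) * u m)) B ->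
  has_sum (fun n => u n * lsum (fun m => F (S m)) (seq 0 n)) H ->
  X = B - 2 * H.
Proof.
  intros HX HB HH.
  destruct (summable_has_sum _ summable_conv_diff) as (s1 & H1).
  destruct (summable_has_sum _ summable_conv_sum) as (s2 & H2).
  assert (E : X = s1 - s2).
  { apply (has_sum_unique _ _ _ HX). eapply has_sum_ext; [|apply (has_sum_minus _ _ _ _ H1 H2)].
    intros p. cbv beta. ring. }
  assert (A1 := conv_diff_value _ _ H1 HH). assert (A2 := conv_sum_value _ H2).
  assert (E2 : B = s1 + 2 * H - s2).
  { apply (has_sum_unique _ _ _ HB). eapply has_sum_ext; [|apply (has_sum_minus _ _ _ _ A1 A2)].
    intros m. cbv beta. unfold U. rewrite lsum_seq_S. ring. }
  rewrite E, E2. ring.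
Qed.

End Convolution.

(** * Weighted Lambert series and their quadratic relations *)

Definition cidx (n : nat) : C := RtoC (INR (S n)).

(** The sign [e] is 1 for the series of level 1 and -1 for the twist that leads to level 2. *)
Definition wlam (e : C) (k : nat) (q : C) : C :=
  CSeries (fun n => e ^ S n * (cidx n ^ k * lam q n)).
(** With [x = q^n], the bracket is [x / (1 - x)^2], the sum of [j x^j]. Hence for [e = 1] this is
    the Euler derivative of the series of weight one lower. *)
Definition wlam2 (e : C) (k : nat) (q : C) : C :=
  CSeries (fun n => e ^ S n * (cidx n ^ k * (lam q n + lam q n * lam q n))).

Lemma Cmod_cidx_pow n k : Cmod (cidx n ^ k) = (INR (S n) ^ k)%R.
Proof. unfold cidx. now rewrite Cmod_pow, Cmod_INR. Qed.

Lemma Cmod_pow_1 e n : Cmod e = 1%R -> Cmod (e ^ n) = 1%R.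
Proof. intros H. now rewrite Cmod_pow, H, pow1. Qed.

Lemma wlam_bound e k n : Cmod e = 1%R -> (Cmod (e ^ S n * cidx n ^ k) <= 1 * INR (S n) ^ k)%R.
Proof. intros H. rewrite Cmod_mult, Cmod_cidx_pow, Cmod_pow_1; auto; lra. Qed.

Lemma wlam_summable e k q : Cmod e = 1%R -> (Cmod q < 1)%R ->
  summable (fun n => e ^ S n * (cidx n ^ k * lam q n)).
Proof.
  intros He Hq. apply (summable_ext (fun n => (e ^ S n * cidx n ^ k) * lam q n)); [intros; ring|].
  apply (summable_weighted q _ 1 k Hq). intros n. now apply wlam_bound.
Qed.

Lemma wlam_sum e k q : Cmod e = 1%R -> (Cmod q < 1)%R ->
  has_sum (fun n => e ^ S n * (cidx n ^ k * lam q n)) (wlam e k q).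
Proof. intros. apply summable_CSeries. now apply wlam_summable. Qed.

Lemma wlam2_sum e k q : Cmod e = 1%R -> (Cmod q < 1)%R ->
  has_sum (fun n => e ^ S n * (cidx n ^ k * (lam q n + lam q n * lam q n))) (wlam2 e k q).
Proof.
  intros He Hq. apply summable_CSeries.
  apply (summable_ext (fun n => (e ^ S n * cidx n ^ k) * lam q n + (e ^ S n * cidx n ^ k) * (lam q n * lam q n)));
    [intros; ring|].
  apply summable_plus.
  - apply (summable_weighted q _ 1 k Hq). intros n. now apply wlam_bound.
  - apply (summable_weighted_sqr q _ 1 k Hq). intros n. now apply wlam_bound.
Qed.

Lemma lambert_wlam k q : (Cmod q < 1)%R -> lambert k q = wlam 1 k q.
Proof.
  intros Hq. apply CSeries_has_sum. eapply has_sum_ext; [|apply (wlam_sum 1 k q); auto; apply Cmod_1].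
  intros n. cbv beta. rewrite Cpow_1_l. unfold cidx, lam. ring.
Qed.

Lemma Cmod_minus1 : Cmod (- (1)) = 1%R.
Proof. rewrite Cmod_opp. apply Cmod_1. Qed.

(** The sign is positive exactly for odd [n], that is, for even Lambert index [n + 1]; twice that
    part minus the whole is the alternating sum. *)
Lemma alternating_split (g : nat -> C) s t : has_sum g s -> has_sum (fun j => g (2 * j + 1)%nat) t ->
  has_sum (fun n => (- (1)) ^ S n * g n) (2 * t - s).
Proof.
  intros Hs Ht.
  assert (H1 : has_sum (fun n => if Nat.odd n then g n else 0) t).
  { apply (has_sum_reindex (fun j => (2 * j + 1)%nat)).
    - intros; lia.
    - intros i. destruct (Nat.odd i) eqn:E; [|tauto]. intros _.
      apply Nat.odd_spec in E. destruct E as (m & ->). eauto.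
    - eapply has_sum_ext; [|exact Ht]. intros j. cbv beta.
      replace (Nat.odd (2 * j + 1)) with true; auto. symmetry. apply Nat.odd_spec. now exists j. }
  eapply has_sum_ext; [|apply (has_sum_minus _ _ _ _ (has_sum_scal 2 _ _ H1) Hs)].
  intros n. cbv beta.
  assert (E : forall m, (- (1)) ^ S m = if Nat.odd m then 1 else - (1)).
  { induction m; [simpl; ring|]. rewrite Cpow_S, IHm, Nat.odd_succ, <- Nat.negb_odd.
    destruct (Nat.odd m); simpl; ring. }
  rewrite E. destruct (Nat.odd n); ring.
Qed.

Lemma Cmod_sqr_lt1 q : (Cmod q < 1)%R -> (Cmod (q ^ 2) < 1)%R.
Proof. apply (Cmod_pow_lt1 q 1). Qed.

Lemma lam_double q j : lam q (2 * j + 1) = lam (q ^ 2) j.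
Proof.
  unfold lam. rewrite <- Cpow_mult_r. replace (2 * S j)%nat with (S (2 * j + 1)) by lia. auto.
Qed.

Lemma cidx_double j : cidx (2 * j + 1) = 2 * cidx j.
Proof. unfold cidx. rewrite <- RtoC_mult. f_equal. rewrite !S_INR, plus_INR, mult_INR. simpl. ring. Qed.

Lemma wlam_alt k q : (Cmod q < 1)%R ->
  wlam (- (1)) k q = 2 * (2 ^ k * wlam 1 k (q ^ 2)) - wlam 1 k q.
Proof.
  intros Hq. apply CSeries_has_sum. apply alternating_split.
  - eapply has_sum_ext; [|apply (wlam_sum 1 k q); auto; apply Cmod_1].
    intros n. cbv beta. rewrite Cpow_1_l. ring.
  - eapply has_sum_ext; [|apply (has_sum_scal (2 ^ k)), (wlam_sum 1 k (q ^ 2)); [apply Cmod_1|now apply Cmod_sqr_lt1]].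
    intros n. cbv beta. rewrite Cpow_1_l, lam_double, cidx_double, Cpow_mult_l. ring.
Qed.

Lemma wlam2_alt k q : (Cmod q < 1)%R ->
  wlam2 (- (1)) k q = 2 * (2 ^ k * wlam2 1 k (q ^ 2)) - wlam2 1 k q.
Proof.
  intros Hq. apply CSeries_has_sum. apply alternating_split.
  - eapply has_sum_ext; [|apply (wlam2_sum 1 k q); auto; apply Cmod_1].
    intros n. cbv beta. rewrite Cpow_1_l. ring.
  - eapply has_sum_ext; [|apply (has_sum_scal (2 ^ k)), (wlam2_sum 1 k (q ^ 2)); [apply Cmod_1|now apply Cmod_sqr_lt1]].
    intros n. cbv beta. rewrite Cpow_1_l, lam_double, cidx_double, Cpow_mult_l. ring.
Qed.

Section Identities.
Variable e : C.
Hypothesis He : e * e = 1.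

Lemma sign_Cmod : Cmod e = 1%R.
Proof.
  assert (H : (Cmod e * Cmod e = 1)%R) by (rewrite <- Cmod_mult, He; apply Cmod_1).
  pose proof (Cmod_ge_0 e). nra.
Qed.

(** A difference and a sum of two integers have the same parity, so the sign factors over the two
    indices. *)
Lemma sign_absdiff i j : e ^ (i - j + (j - i)) = e ^ S i * e ^ S j.
Proof.
  assert (H : forall n, e ^ (n + n) = 1).
  { intros n. rewrite Cpow_add_r, <- Cpow_mult_l, He. apply Cpow_1_l. }
  rewrite <- Cpow_add_r. destruct (le_lt_dec i j).
  - replace (S i + S j)%nat with ((i - j + (j - i)) + (S i + S i))%nat by lia.
    rewrite (Cpow_add_r e _ (S i + S i)), H. ring.
  - replace (S i + S j)%nat with ((i - j + (j - i)) + (S j + S j))%nat by lia.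
    rewrite (Cpow_add_r e _ (S j + S j)), H. ring.
Qed.

Lemma absdiff_sqr i j : RtoC (INR (i - j + (j - i))) ^ 2 = (cidx i - cidx j) ^ 2.
Proof.
  unfold cidx. destruct (le_lt_dec i j).
  - replace (i - j + (j - i))%nat with (j - i)%nat by lia.
    rewrite minus_INR by auto. rewrite !S_INR, RtoC_minus, !RtoC_plus. ring.
  - replace (i - j + (j - i))%nat with (i - j)%nat by lia.
    rewrite minus_INR by lia. rewrite !S_INR, RtoC_minus, !RtoC_plus. ring.
Qed.

Lemma sum_index i j : RtoC (INR (S (S (i + j)))) = cidx i + cidx j.
Proof. unfold cidx. rewrite <- RtoC_plus, <- plus_INR. do 2 f_equal. lia. Qed.

Lemma sign_monomial_bound k n : (Cmod (e ^ n * RtoC (INR n) ^ k) <= 1 * INR (S n) ^ k)%R.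
Proof.
  rewrite Cmod_mult, (Cmod_pow_1 e n sign_Cmod), Cmod_pow, Cmod_INR, !Rmult_1_l.
  apply pow_incr. split; [apply pos_INR|]. apply le_INR. lia.
Qed.

Variable q : C.
Hypothesis Hq : (Cmod q < 1)%R.

(** Take [F n = e^n n^2]: since [(a - b)^2 - (a + b)^2 = -4 a b], the double sum is a multiple of a
    square. *)
Lemma conv_sqr H :
  has_sum (fun n => lam q n * lsum (fun m => e ^ S m * cidx m ^ 2) (seq 0 n)) H ->
  -4 * (wlam e 1 q * wlam e 1 q) = 2 * wlam2 e 2 q - wlam e 3 q - wlam e 2 q - 2 * H.
Proof.
  intros HH.
  apply (convolution_identity q (fun n => e ^ n * RtoC (INR n) ^ 2) 1 2 Hq).
  - intros n. apply sign_monomial_bound.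
  - simpl; ring.
  - eapply has_sum_ext; [|apply has_sum_scal, (has_sum_prod _ _ _ _
      (wlam_summable e 1 q sign_Cmod Hq) (wlam_summable e 1 q sign_Cmod Hq)
      (wlam_sum e 1 q sign_Cmod Hq) (wlam_sum e 1 q sign_Cmod Hq))].
    intros [i j]. cbn [fst snd]. rewrite sign_absdiff, absdiff_sqr, sum_index.
    replace (S (S (i + j))) with (S i + S j)%nat by lia. rewrite Cpow_add_r. ring.
  - eapply has_sum_ext; [|apply (has_sum_minus _ _ _ _ (has_sum_minus _ _ _ _ (has_sum_scal 2 _ _ (wlam2_sum e 2 q sign_Cmod Hq))
      (wlam_sum e 3 q sign_Cmod Hq)) (wlam_sum e 2 q sign_Cmod Hq))].
    intros n. cbv beta. unfold cidx. rewrite S_INR, RtoC_plus. ring.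
  - exact HH.
Qed.

(** Take [F n = e^n n^4]: now [(a - b)^4 - (a + b)^4 = -8 (a^3 b + a b^3)]. *)
Lemma conv_quartic H :
  has_sum (fun n => lam q n * lsum (fun m => e ^ S m * cidx m ^ 4) (seq 0 n)) H ->
  -16 * (wlam e 1 q * wlam e 3 q) = 2 * wlam2 e 4 q - wlam e 5 q - wlam e 4 q - 2 * H.
Proof.
  intros HH.
  apply (convolution_identity q (fun n => e ^ n * RtoC (INR n) ^ 4) 1 4 Hq).
  - intros n. apply sign_monomial_bound.
  - simpl; ring.
  - replace (-16 * (wlam e 1 q * wlam e 3 q)) with
      (-8 * (wlam e 1 q * wlam e 3 q) + -8 * (wlam e 3 q * wlam e 1 q)) by ring.
    eapply has_sum_ext; [|apply has_sum_plus; apply has_sum_scal; [apply (has_sum_prod _ _ _ _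
      (wlam_summable e 1 q sign_Cmod Hq) (wlam_summable e 3 q sign_Cmod Hq)
      (wlam_sum e 1 q sign_Cmod Hq) (wlam_sum e 3 q sign_Cmod Hq))|
      apply (has_sum_prod _ _ _ _
      (wlam_summable e 3 q sign_Cmod Hq) (wlam_summable e 1 q sign_Cmod Hq)
      (wlam_sum e 3 q sign_Cmod Hq) (wlam_sum e 1 q sign_Cmod Hq))]].
    intros [i j]. cbn [fst snd]. rewrite sign_absdiff, sum_index.
    replace (RtoC (INR (i - j + (j - i))) ^ 4) with ((RtoC (INR (i - j + (j - i))) ^ 2) ^ 2) by ring.
    rewrite absdiff_sqr.
    replace (S (S (i + j))) with (S i + S j)%nat by lia. rewrite Cpow_add_r. ring.
  - eapply has_sum_ext; [|apply (has_sum_minus _ _ _ _ (has_sum_minus _ _ _ _ (has_sum_scal 2 _ _ (wlam2_sum e 4 q sign_Cmod Hq))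
      (wlam_sum e 5 q sign_Cmod Hq)) (wlam_sum e 4 q sign_Cmod Hq))].
    intros n. cbv beta. unfold cidx. rewrite S_INR, RtoC_plus. ring.
  - exact HH.
Qed.

End Identities.

(** Faulhaber's formula for [1^2 + ... + n^2], written in terms of [n + 1] because the sum
    multiplies [lam q n]. *)
Lemma power_sum_2 n :
  6 * lsum (fun m => 1 ^ S m * cidx m ^ 2) (seq 0 n) = 2 * cidx n ^ 3 - 3 * cidx n ^ 2 + cidx n.
Proof.
  induction n.
  - unfold cidx. simpl. ring.
  - rewrite lsum_seq_S, Cmult_plus_distr_l, IHn, Cpow_1_l. unfold cidx.
    rewrite (S_INR (S n)), RtoC_plus. ring.
Qed.

Lemma power_sum_4 n :
  30 * lsum (fun m => 1 ^ S m * cidx m ^ 4) (seq 0 n) =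
  6 * cidx n ^ 5 - 15 * cidx n ^ 4 + 10 * cidx n ^ 3 - cidx n.
Proof.
  induction n.
  - unfold cidx. simpl. ring.
  - rewrite lsum_seq_S, Cmult_plus_distr_l, IHn, Cpow_1_l. unfold cidx.
    rewrite (S_INR (S n)), RtoC_plus. ring.
Qed.

Lemma alternating_power_sum_2 n :
  2 * lsum (fun m => (- (1)) ^ S m * cidx m ^ 2) (seq 0 n) = - ((- (1)) ^ S n * (cidx n ^ 2 - cidx n)).
Proof.
  induction n.
  - unfold cidx. simpl. ring.
  - rewrite lsum_seq_S, Cmult_plus_distr_l, IHn. unfold cidx.
    rewrite (S_INR (S n)), RtoC_plus. rewrite (Cpow_S _ (S n)). ring.
Qed.

Lemma alternating_power_sum_4 n :
  2 * lsum (fun m => (- (1)) ^ S m * cidx m ^ 4) (seq 0 n) =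
  - ((- (1)) ^ S n * (cidx n ^ 4 - 2 * cidx n ^ 3 + cidx n)).
Proof.
  induction n.
  - unfold cidx. simpl. ring.
  - rewrite lsum_seq_S, Cmult_plus_distr_l, IHn. unfold cidx.
    rewrite (S_INR (S n)), RtoC_plus. rewrite (Cpow_S _ (S n)). ring.
Qed.

Lemma RtoC_IZR_neq0 z : (z <> 0)%Z -> RtoC (IZR z) <> 0.
Proof. intros H E. apply RtoC_inj in E. now apply eq_IZR in E. Qed.

Section Relations.
Variable q : C.
Hypothesis Hq : (Cmod q < 1)%R.

Let H1 k := wlam_sum 1 k q Cmod_1 Hq.
Let Hm k := wlam_sum (- (1)) k q Cmod_minus1 Hq.

(** The series [wlam 1 2] cancels against the middle term of the power sum, leaving only those that
    occur in E2 and E4. Since [wlam2 1 2] is the Euler derivative of [wlam 1 1], this is Ramanujan's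
    formula for [D E2]. *)
Lemma conv_relation_1 :
  -12 * wlam 1 1 q ^ 2 = 6 * wlam2 1 2 q - 5 * wlam 1 3 q - wlam 1 1 q.
Proof.
  assert (E : has_sum (fun n => lam q n * lsum (fun m => 1 ^ S m * cidx m ^ 2) (seq 0 n))
    (/ 6 * (2 * wlam 1 3 q - 3 * wlam 1 2 q + wlam 1 1 q))).
  { eapply has_sum_ext; [|apply has_sum_scal, (has_sum_plus _ _ _ _ (has_sum_minus _ _ _ _
      (has_sum_scal 2 _ _ (H1 3)) (has_sum_scal 3 _ _ (H1 2))) (H1 1))].
    intros n. cbv beta. rewrite Cpow_1_l.
    transitivity (lam q n * (/ 6 * (2 * cidx n ^ 3 - 3 * cidx n ^ 2 + cidx n))); [ring|].
    rewrite <- power_sum_2. field. }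
  assert (A := conv_sqr 1 ltac:(ring) q Hq _ E).
  transitivity (3 * (-4 * (wlam 1 1 q * wlam 1 1 q))); [ring|]. rewrite A. field.
Qed.

(** Likewise [wlam 1 4] cancels, and the result is Ramanujan's formula for [D E4]. *)
Lemma conv_relation_2 :
  -240 * (wlam 1 1 q * wlam 1 3 q) =
  30 * wlam2 1 4 q - 21 * wlam 1 5 q - 10 * wlam 1 3 q + wlam 1 1 q.
Proof.
  assert (E : has_sum (fun n => lam q n * lsum (fun m => 1 ^ S m * cidx m ^ 4) (seq 0 n))
    (/ 30 * (6 * wlam 1 5 q - 15 * wlam 1 4 q + 10 * wlam 1 3 q - wlam 1 1 q))).
  { eapply has_sum_ext; [|apply has_sum_scal, (has_sum_minus _ _ _ _ (has_sum_plus _ _ _ _ (has_sum_minus _ _ _ _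
      (has_sum_scal 6 _ _ (H1 5)) (has_sum_scal 15 _ _ (H1 4))) (has_sum_scal 10 _ _ (H1 3))) (H1 1))].
    intros n. cbv beta. rewrite Cpow_1_l.
    transitivity (lam q n * (/ 30 * (6 * cidx n ^ 5 - 15 * cidx n ^ 4 + 10 * cidx n ^ 3 - cidx n))); [ring|].
    rewrite <- power_sum_4. field. }
  assert (A := conv_quartic 1 ltac:(ring) q Hq _ E).
  transitivity (15 * (-16 * (wlam 1 1 q * wlam 1 3 q))); [ring|]. rewrite A. field.
Qed.

(** The twisted analogue, from the alternating power sum. Through [wlam_alt] it ties values at [q]
    to values at [q ^ 2]. *)
Lemma conv_relation_3 : let e := - (1) in
  -4 * wlam e 1 q ^ 2 = 2 * wlam2 e 2 q - wlam e 3 q - wlam e 1 q.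
Proof.
  intros e.
  assert (E : has_sum (fun n => lam q n * lsum (fun m => e ^ S m * cidx m ^ 2) (seq 0 n))
    (/ 2 * (wlam e 1 q - wlam e 2 q))).
  { eapply has_sum_ext; [|apply has_sum_scal, (has_sum_minus _ _ _ _ (Hm 1) (Hm 2))].
    intros n. cbv beta.
    transitivity (lam q n * (/ 2 * - ((- (1)) ^ S n * (cidx n ^ 2 - cidx n)))); [ring|].
    rewrite <- alternating_power_sum_2. unfold e. field. }
  assert (A := conv_sqr e ltac:(unfold e; ring) q Hq _ E).
  transitivity (-4 * (wlam e 1 q * wlam e 1 q)); [ring|]. rewrite A. field.
Qed.

Lemma conv_relation_4 : let e := - (1) in
  -16 * (wlam e 1 q * wlam e 3 q) = 2 * wlam2 e 4 q - wlam e 5 q - 2 * wlam e 3 q + wlam e 1 q.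
Proof.
  intros e.
  assert (E : has_sum (fun n => lam q n * lsum (fun m => e ^ S m * cidx m ^ 4) (seq 0 n))
    (/ 2 * (2 * wlam e 3 q - wlam e 4 q - wlam e 1 q))).
  { eapply has_sum_ext; [|apply has_sum_scal, (has_sum_minus _ _ _ _
      (has_sum_minus _ _ _ _ (has_sum_scal 2 _ _ (Hm 3)) (Hm 4)) (Hm 1))].
    intros n. cbv beta.
    transitivity (lam q n * (/ 2 * - ((- (1)) ^ S n * (cidx n ^ 4 - 2 * cidx n ^ 3 + cidx n)))); [ring|].
    rewrite <- alternating_power_sum_4. unfold e. field. }
  assert (A := conv_quartic e ltac:(unfold e; ring) q Hq _ E). rewrite A. field.
Qed.

End Relations.

(** * Lambert series as power series in [q] *)

Lemma has_sum_nat_shift (f : nat -> C) s : f 0%nat = 0 -> has_sum f s -> has_sum (fun n => f (S n)) s.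
Proof.
  intros H0 H. apply (has_sum_reindex S f); auto.
  intros [|i] Hi; [tauto|eauto].
Qed.

Lemma has_sum_lam q n : (Cmod q < 1)%R -> has_sum (fun j => q ^ (S n * S j)) (lam q n).
Proof.
  intros Hq. unfold lam, Cdiv.
  eapply has_sum_ext; [|apply has_sum_scal, has_sum_geom, (Cmod_pow_lt1 q n Hq)].
  intros j. cbv beta. now rewrite <- Cpow_S, Cpow_mult_r.
Qed.

(** The sum of [j x^j], which is [x / (1 - x)^2], is expressed through [x / (1 - x)] to match the
    bracket in [wlam2]. *)
Lemma has_sum_arith_geom x : (Cmod x < 1)%R ->
  has_sum (fun j => cidx j * x ^ S j) (x / (1 - x) + x / (1 - x) * (x / (1 - x))).
Proof.
  intros Hx.
  destruct (gps_deriv_D (fun _ : nat => RtoC 1) (fun n => n) (fun z => / (1 - z))) with (z := x) as (l & Hl & Hs); auto.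
  - intros r Hr. apply (summable_ext (fun n => RtoC r ^ n)); [intros; ring|].
    apply summable_geom. rewrite Cmod_R, Rabs_right; lra.
  - intros z Hz. eapply has_sum_ext; [|apply has_sum_geom, Hz]. intros; cbv beta; ring.
  - pose proof (one_minus_neq0 x Hx) as Hn.
    assert (E : l = 1 / (1 - x) ^ 2).
    { apply (cderiv_unique _ _ _ _ Hl). eapply cderiv_eq.
      - apply cderiv_inv; auto. apply cderiv_minus; [apply cderiv_const|apply cderiv_id].
      - cbv beta. field; auto. }
    apply has_sum_nat_shift in Hs; [|simpl; ring].
    replace (x / (1 - x) + x / (1 - x) * (x / (1 - x))) with (x * l) by (rewrite E; field; auto).
    eapply has_sum_ext; [|exact Hs]. intros j. unfold cidx. ring.
Qed.

(** As [(n + 1) (j + 1)] is at least [n + j], one geometric factor is available for each index. *)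
Lemma summable_double (c : nat -> C) k (d : nat -> C) r : (0 <= r < 1)%R ->
  (forall n, (Cmod (c n) <= INR (S n) ^ k)%R) -> (forall n, (Cmod (d n) <= 1)%R) ->
  summable (fun p : nat * nat => (c (fst p) * d (snd p)) * RtoC r ^ (S (fst p) * S (snd p))).
Proof.
  intros Hr Hc Hd.
  apply (summable_le _ (fun p : nat * nat => (RtoC (INR (S (fst p)) ^ k * r ^ (fst p))) * (RtoC r) ^ (snd p))).
  - intros [n j]. cbn [fst snd]. rewrite !Cmod_mult, !Cmod_pow, !Cmod_R.
    rewrite (Rabs_right r) by lra. rewrite (Rabs_right (_ * _)%R).
    2:{ apply Rle_ge, Rmult_le_pos; apply pow_le; [apply pos_INR|lra]. }
    rewrite (Rmult_assoc (INR (S n) ^ k)), <- pow_add.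
    assert (A : (r ^ (S n * S j) <= r ^ (n + j))%R).
    { replace (S n * S j)%nat with ((n + j) + (n * j + 1))%nat by lia. rewrite pow_add.
      pose proof (pow_le r (n + j) (proj1 Hr)).
      assert (r ^ (n * j + 1) <= 1)%R by (rewrite <- (pow1 (n * j + 1)); apply pow_incr; lra).
      assert (0 <= r ^ (n * j + 1))%R by (apply pow_le; lra). nra. }
    apply Rmult_le_compat; auto.
    + apply Rmult_le_pos; apply Cmod_ge_0.
    + apply pow_le; lra.
    + rewrite <- (Rmult_1_r (INR (S n) ^ k)). apply Rmult_le_compat; auto; apply Cmod_ge_0.
  - apply (summable_prod (fun n => RtoC (INR (S n) ^ k * r ^ n)) (fun n => RtoC r ^ n)).
    + apply (summable_poly_geom _ k 1 r Hr). intros n. rewrite Cmod_R, Rabs_right; [lra|].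
      apply Rle_ge, Rmult_le_pos; apply pow_le; [apply pos_INR|lra].
    + apply summable_geom. rewrite Cmod_R, Rabs_right; lra.
Qed.

Lemma wlam_gps_summable k r : (0 <= r < 1)%R ->
  summable (fun p : nat * nat => (cidx (fst p) ^ k * 1) * RtoC r ^ (S (fst p) * S (snd p))).
Proof.
  intros Hr. apply (summable_double (fun n => cidx n ^ k) k (fun _ => 1) r Hr).
  - intros n. rewrite Cmod_cidx_pow. lra.
  - intros n. rewrite Cmod_1. lra.
Qed.

Lemma wlam_gps k z : (Cmod z < 1)%R ->
  has_sum (fun p : nat * nat => (cidx (fst p) ^ k * 1) * z ^ (S (fst p) * S (snd p))) (wlam 1 k z).
Proof.
  intros Hz.
  destruct (summable_has_sum _ (gps_summable_z _ _ (wlam_gps_summable k) z Hz)) as (s & HS).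
  replace (wlam 1 k z) with s; auto.
  apply (has_sum_unique (fun n => cidx n ^ k * lam z n)).
  - apply (has_sum_fubini _ _ _ HS). intros n. cbn [fst snd].
    eapply has_sum_ext; [|apply has_sum_scal, (has_sum_lam z n Hz)]. intros; cbv beta; ring.
  - eapply has_sum_ext; [|apply (wlam_sum 1 k z Cmod_1 Hz)].
    intros; cbv beta. rewrite Cpow_1_l. ring.
Qed.

(** In the double series of [n^k q^(nj)] the Euler operator multiplies a term by [n j]; summing over
    [j] first gives the bracket of [wlam2]. *)
Lemma wlam_deriv k q : (Cmod q < 1)%R -> exists l, cderiv (wlam 1 k) q l /\ q * l = wlam2 1 (S k) q.
Proof.
  intros Hq.
  destruct (gps_deriv_D _ _ _ (wlam_gps_summable k) (wlam_gps k) q Hq) as (l & Hl & HS).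
  exists l. split; auto.
  apply (has_sum_unique (fun n => cidx n ^ S k * (lam q n + lam q n * lam q n))).
  - apply (has_sum_fubini _ _ _ HS). intros n. cbn [fst snd].
    eapply has_sum_ext; [|apply has_sum_scal, (has_sum_arith_geom (q ^ S n)), Cmod_pow_lt1, Hq].
    intros j. cbv beta. rewrite mult_INR, RtoC_mult, (Cpow_mult_r q (S n) (S j)).
    unfold cidx. rewrite (Cpow_S _ k). ring.
  - eapply has_sum_ext; [|apply (wlam2_sum 1 (S k) q Cmod_1 Hq)].
    intros; cbv beta. rewrite Cpow_1_l. ring.
Qed.

Lemma dpow_at_0 n : dpow (S n) 0 = 0 ^ n.
Proof. change (dpow (S n) 0) with (0 * dpow n 0 + 0 ^ n). ring. Qed.

(** Among the exponents [n j] with [n, j >= 1], only [n = j = 1] gives the exponent 1. *)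
Lemma wlam_deriv_0 k : cderiv (wlam 1 k) 0 1.
Proof.
  destruct (gps_deriv _ _ _ (wlam_gps_summable k) (wlam_gps k) 0) as (l & Hl & HS).
  { rewrite Cmod_0; lra. }
  eapply cderiv_eq; [apply Hl|]. apply (has_sum_unique _ _ _ HS).
  assert (H := has_sum_single (fun p : nat * nat => cidx (fst p) ^ k * 1 * dpow (S (fst p) * S (snd p)) 0) (0%nat, 0%nat)).
  cbn [fst snd] in H. change (1 * 1)%nat with 1%nat in H. rewrite dpow_at_0 in H. replace (cidx 0) with (RtoC 1) in H by (unfold cidx; simpl; auto).
  rewrite Cpow_1_l in H. replace (1 * 1 * 0 ^ 0) with (RtoC 1) in H by (simpl; ring).
  apply H. intros [n j] Hne. cbn [fst snd].
  replace (S n * S j)%nat with (S (n * j + n + j)) by lia. rewrite dpow_at_0.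
  destruct (n * j + n + j)%nat eqn:E.
  - elim Hne. f_equal; nia.
  - simpl; ring.
Qed.

(* [exp (- elog q)] is the infinite product of the factors [1 - q ^ n]. *)
Definition elog (q : C) : C := CSeries (fun n => logser (q ^ S n)).

Lemma elog_summable2 r : (0 <= r < 1)%R ->
  summable (fun p : nat * nat => (1 * / cidx (snd p)) * RtoC r ^ (S (fst p) * S (snd p))).
Proof.
  intros Hr. apply (summable_double (fun _ => 1) 0 (fun n => / cidx n) r Hr).
  - intros n. rewrite Cmod_1. simpl; lra.
  - intros n. unfold cidx. rewrite Cmod_inv, Cmod_INR by apply INR_S_neq0.
    rewrite <- Rinv_1. apply Rinv_le_contravar; [lra|]. rewrite S_INR. pose proof (pos_INR n); lra.
Qed.

Lemma elog_sum2 q : (Cmod q < 1)%R ->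
  has_sum (fun p : nat * nat => (1 * / cidx (snd p)) * q ^ (S (fst p) * S (snd p))) (elog q) /\
  has_sum (fun n => logser (q ^ S n)) (elog q).
Proof.
  intros Hq.
  destruct (summable_has_sum _ (gps_summable_z _ _ elog_summable2 q Hq)) as (s & HS).
  assert (H : has_sum (fun n => logser (q ^ S n)) s).
  { apply (has_sum_fubini _ _ _ HS). intros n. cbn [fst snd].
    eapply has_sum_ext; [|apply summable_CSeries, logser_summable, (Cmod_pow_lt1 q n Hq)].
    intros j. cbv beta. rewrite (Cpow_mult_r q (S n) (S j)). unfold cidx. ring. }
  replace (elog q) with s; [tauto|]. symmetry. now apply CSeries_has_sum.
Qed.

Lemma elog_deriv q : (Cmod q < 1)%R -> exists l, cderiv elog q l /\ q * l = wlam 1 1 q.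
Proof.
  intros Hq.
  destruct (gps_deriv_D (fun p : nat * nat => 1 * / cidx (snd p))
     (fun p => (S (fst p) * S (snd p))%nat) elog elog_summable2) with (z := q) as (l & Hl & HS); auto.
  - intros z Hz. now apply elog_sum2.
  - exists l. split; auto.
    apply (has_sum_unique (fun n => cidx n * lam q n)).
    + apply (has_sum_fubini _ _ _ HS). intros n. cbn [fst snd].
      eapply has_sum_ext; [|apply has_sum_scal, (has_sum_lam q n Hq)].
      intros j. cbv beta. rewrite mult_INR, RtoC_mult. unfold cidx.
      pose proof (INR_S_neq0 j). field; auto.
    + eapply has_sum_ext; [|apply (wlam_sum 1 1 q Cmod_1 Hq)].
      intros; cbv beta. rewrite Cpow_1_l. ring.
Qed.

Lemma logser_pow0 n : logser (0 ^ S n) = 0.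
Proof. replace (0 ^ S n) with (RtoC 0) by (simpl; ring). apply logser_0. Qed.

Lemma elog_0 : elog 0 = 0.
Proof.
  apply CSeries_has_sum. eapply has_sum_ext; [|apply has_sum_0]. intros n. now rewrite logser_pow0.
Qed.

Lemma wlam_0 k : wlam 1 k 0 = 0.
Proof.
  apply CSeries_has_sum. eapply has_sum_ext; [|apply has_sum_0]. intros n. unfold lam. simpl.
  unfold Cdiv. ring.
Qed.

(** * Eisenstein series of levels 1 and 2 *)

(** The Euler operator [q d/dq]. At [q = 0] it forces [l = 0] but still records that [f] is
    differentiable there. *)
Definition eulerD (f : C -> C) (q l : C) : Prop := exists d, cderiv f q d /\ q * d = l.

Lemma eulerD_eq f q a b : eulerD f q a -> a = b -> eulerD f q b.
Proof. now intros H <-. Qed.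

Lemma eulerD_cont f q l : eulerD f q l -> ccont f q.
Proof. intros (d & H & _). apply (cderiv_cont _ _ _ H). Qed.

Lemma eulerD_ext (f g : C -> C) q l : (forall y, f y = g y) -> eulerD f q l -> eulerD g q l.
Proof. intros H (d & Hd & E). exists d; split; auto. now apply (cderiv_ext f). Qed.

Lemma eulerD_ext_loc (f g : C -> C) q l r : (0 < r)%R ->
  (forall y, (Cmod (y - q) < r)%R -> f y = g y) -> eulerD f q l -> eulerD g q l.
Proof. intros Hr H (d & Hd & E). exists d; split; auto. now apply (cderiv_ext_loc f g q d r). Qed.

Lemma eulerD_const c q : eulerD (fun _ => c) q 0.
Proof. exists 0. split; [apply cderiv_const|ring]. Qed.

Lemma eulerD_id q : eulerD (fun y => y) q q.
Proof. exists 1. split; [apply cderiv_id|ring]. Qed.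

Lemma eulerD_plus f g q a b : eulerD f q a -> eulerD g q b -> eulerD (fun y => f y + g y) q (a + b).
Proof.
  intros (d & H & <-) (d' & H' & <-). exists (d + d'). split; [now apply cderiv_plus|ring].
Qed.

Lemma eulerD_minus f g q a b : eulerD f q a -> eulerD g q b -> eulerD (fun y => f y - g y) q (a - b).
Proof.
  intros (d & H & <-) (d' & H' & <-). exists (d - d'). split; [now apply cderiv_minus|ring].
Qed.

Lemma eulerD_mult f g q a b : eulerD f q a -> eulerD g q b ->
  eulerD (fun y => f y * g y) q (a * g q + f q * b).
Proof.
  intros (d & H & <-) (d' & H' & <-). eexists. split; [now apply cderiv_mult; eauto|ring].
Qed.

Lemma eulerD_scal c f q a : eulerD f q a -> eulerD (fun y => c * f y) q (c * a).
Proof.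
  intros (d & H & <-). exists (c * d). split; [now apply cderiv_scal|ring].
Qed.

Lemma eulerD_sqr f q a : eulerD f q a -> eulerD (fun y => f y ^ 2) q (2 * f q * a).
Proof.
  intros (d & H & <-). eexists. split; [now apply cderiv_sqr; eauto|ring].
Qed.

Lemma eulerD_div f g q a b : eulerD f q a -> eulerD g q b -> g q <> 0 ->
  eulerD (fun y => f y / g y) q ((a * g q - f q * b) / g q ^ 2).
Proof.
  intros (d & H & <-) (d' & H' & <-) Hg. eexists. split; [now apply cderiv_div; eauto|field; auto].
Qed.

Lemma eulerD_Cexp f q a : eulerD f q a -> eulerD (fun y => Cexp (f y)) q (Cexp (f q) * a).
Proof.
  intros (d & H & <-). eexists. split; [now apply cderiv_Cexp_comp; eauto|ring].
Qed.

Lemma eulerD_double f q a : eulerD f (q ^ 2) a -> eulerD (fun y => f (y ^ 2)) q (2 * a).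
Proof.
  intros (d & H & <-). eexists. split.
  - apply (cderiv_comp f (fun y => y ^ 2)); [apply H|apply cderiv_sqr, cderiv_id].
  - cbv beta. ring.
Qed.

Lemma eulerD_unique f q a b : eulerD f q a -> eulerD f q b -> a = b.
Proof.
  intros (d & H & <-) (d' & H' & <-). f_equal. apply (cderiv_unique _ _ _ _ H H').
Qed.

(** Deduces one equation from another by naming the multiplier [k], which leaves an identity for
    [field]. The explicit constants passed to it are these multipliers. *)
Lemma Clin (a b c d k : C) : a = b -> c - d = k * (a - b) -> c = d.
Proof.
  intros -> H. apply Ceq_minus. rewrite H. ring.
Qed.

(* With q = nome tau these are E2, E4, E6, then P = 2 E2(2 tau) - E2(tau) and T = 1/t. *)
Definition qE2 (q : C) : C := 1 - 24 * wlam 1 1 q.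
Definition qE4 (q : C) : C := 1 + 240 * wlam 1 3 q.
Definition qE6 (q : C) : C := 1 - 504 * wlam 1 5 q.
Definition eisP (q : C) : C := 2 * qE2 (q ^ 2) - qE2 q.
Definition hT (q : C) : C := -64 * (q * Cexp (24 * (elog q - elog (q ^ 2)))).

Section Disc.
Variable q : C.
Hypothesis Hq : (Cmod q < 1)%R.

Lemma eulerD_qE2 : eulerD qE2 q ((qE2 q ^ 2 - qE4 q) / 12).
Proof.
  destruct (wlam_deriv 1 q Hq) as (l & Hl & E).
  eapply eulerD_eq.
  - unfold qE2. apply eulerD_minus; [apply eulerD_const|]. apply eulerD_scal. exists l. split; [exact Hl|exact E].
  - pose proof (conv_relation_1 q Hq) as R. unfold qE2, qE4.
    apply (Clin _ _ _ _ 4 R). field.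
Qed.

Lemma eulerD_qE4 : eulerD qE4 q ((qE2 q * qE4 q - qE6 q) / 3).
Proof.
  destruct (wlam_deriv 3 q Hq) as (l & Hl & E).
  eapply eulerD_eq.
  - unfold qE4. apply eulerD_plus; [apply eulerD_const|]. apply eulerD_scal. exists l. split; [exact Hl|exact E].
  - pose proof (conv_relation_2 q Hq) as R. unfold qE2, qE4, qE6.
    apply (Clin _ _ _ _ (-8) R). field.
Qed.
End Disc.

(** The relations for [q], for [q ^ 2] and for the twist are three equations, linear in the two
    derivatives of E2; eliminating both derivatives leaves an algebraic relation. *)
Lemma eisP_sqr q : (Cmod q < 1)%R -> 5 * eisP q ^ 2 = qE4 q + 4 * qE4 (q ^ 2).
Proof.
  intros Hq. pose proof (Cmod_sqr_lt1 q Hq) as Hq2.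
  pose proof (conv_relation_1 q Hq) as R1. pose proof (conv_relation_1 _ Hq2) as R2.
  pose proof (conv_relation_3 q Hq) as R3. cbv zeta in R3.
  rewrite !wlam_alt, wlam2_alt in R3 by auto.
  unfold eisP, qE2, qE4.
  set (n := wlam2 1 2 q) in *. set (m := wlam2 1 2 (q ^ 2)) in *.
  assert (En : n = (-12 * wlam 1 1 q ^ 2 + 5 * wlam 1 3 q + wlam 1 1 q) / 6) by (rewrite R1; field).
  assert (Em : m = (-12 * wlam 1 1 (q ^ 2) ^ 2 + 5 * wlam 1 3 (q ^ 2) + wlam 1 1 (q ^ 2)) / 6) by (rewrite R2; field).
  rewrite En, Em in R3. apply (Clin _ _ _ _ (-360) R3). field.
Qed.

Lemma eulerD_eisP q : (Cmod q < 1)%R -> eulerD eisP q ((eisP q * qE2 q - 2 * eisP q ^ 2 + qE4 q) / 6).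
Proof.
  intros Hq. pose proof (Cmod_sqr_lt1 q Hq) as Hq2.
  eapply eulerD_eq.
  - unfold eisP. apply eulerD_minus; [apply eulerD_scal, eulerD_double, eulerD_qE2, Hq2|apply eulerD_qE2, Hq].
  - pose proof (eisP_sqr q Hq) as R. unfold eisP in *.
    apply (Clin _ _ _ _ (/ 12) R). field.
Qed.

(** Applying [D] to [eisP_sqr] gives one linear relation between E6 at [q] and at [q ^ 2]; the
    twisted quartic convolution gives another, and solving the pair yields E6. *)
Lemma qE6_eisP q : (Cmod q < 1)%R -> qE6 q = 4 * eisP q ^ 3 - 3 * (eisP q * qE4 q).
Proof.
  intros Hq. pose proof (Cmod_sqr_lt1 q Hq) as Hq2.
  assert (I : 10 * (eisP q * ((eisP q * qE2 q - 2 * eisP q ^ 2 + qE4 q) / 6)) =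
     (qE2 q * qE4 q - qE6 q) / 3 + 8 * ((qE2 (q ^ 2) * qE4 (q ^ 2) - qE6 (q ^ 2)) / 3)).
  { apply (eulerD_unique (fun y => 5 * eisP y ^ 2) q).
    - eapply eulerD_eq; [apply eulerD_scal, eulerD_sqr, eulerD_eisP, Hq|ring].
    - apply (eulerD_ext_loc (fun y => qE4 y + 4 * qE4 (y ^ 2)) _ q _ (1 - Cmod q)); [lra| |].
      + intros y Hy. symmetry. apply eisP_sqr.
        replace y with (q + (y - q)) by ring. eapply Rle_lt_trans; [apply Cmod_triangle|]. lra.
      + eapply eulerD_eq; [apply eulerD_plus; [apply eulerD_qE4, Hq|apply eulerD_scal, eulerD_double, eulerD_qE4, Hq2]|ring]. }
  assert (E2 : qE2 (q ^ 2) = (eisP q + qE2 q) / 2) by (unfold eisP; field).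
  assert (E4 : qE4 (q ^ 2) = (5 * eisP q ^ 2 - qE4 q) / 4) by (rewrite (eisP_sqr q Hq); field).
  assert (E6 : qE6 (q ^ 2) = (15 * eisP q ^ 3 - 6 * (eisP q * qE4 q) - qE6 q) / 8).
  { rewrite E2, E4 in I. apply (Clin _ _ _ _ (3 / 8) I). field. }
  pose proof (conv_relation_2 q Hq) as R1. pose proof (conv_relation_2 _ Hq2) as R2.
  pose proof (conv_relation_4 q Hq) as R4. cbv zeta in R4.
  rewrite !wlam_alt, wlam2_alt in R4 by auto.
  set (n := wlam2 1 4 q) in *. set (m := wlam2 1 4 (q ^ 2)) in *.
  assert (A1 : forall z, wlam 1 1 z = (1 - qE2 z) / 24) by (intros; unfold qE2; field).
  assert (A3 : forall z, wlam 1 3 z = (qE4 z - 1) / 240) by (intros; unfold qE4; field).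
  assert (A5 : forall z, wlam 1 5 z = (1 - qE6 z) / 504) by (intros; unfold qE6; field).
  rewrite A1, A3, A5 in R1, R2. rewrite !A1, !A3, !A5 in R4.
  assert (En : n = (qE2 q * qE4 q - qE6 q) / 720) by (apply (Clin _ _ _ _ (- / 30) R1); field).
  assert (Em : m = (qE2 (q ^ 2) * qE4 (q ^ 2) - qE6 (q ^ 2)) / 720) by (apply (Clin _ _ _ _ (- / 30) R2); field).
  rewrite En, Em, E6, E4, E2 in R4.
  apply (Clin _ _ _ _ 252 R4). field.
Qed.

Lemma eulerD_elog q : (Cmod q < 1)%R -> eulerD elog q ((1 - qE2 q) / 24).
Proof.
  intros Hq. destruct (elog_deriv q Hq) as (l & Hl & E). exists l. split; auto.
  rewrite E. unfold qE2. field.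
Qed.

Lemma eulerD_elog2 q : (Cmod q < 1)%R -> eulerD (fun y => elog (y ^ 2)) q ((2 - eisP q - qE2 q) / 24).
Proof.
  intros Hq. eapply eulerD_eq; [apply eulerD_double, eulerD_elog, Cmod_sqr_lt1, Hq|].
  unfold eisP. field.
Qed.

Lemma eulerD_hT q : (Cmod q < 1)%R -> eulerD hT q (hT q * eisP q).
Proof.
  intros Hq. eapply eulerD_eq.
  - unfold hT. apply eulerD_scal, eulerD_mult; [apply eulerD_id|].
    apply eulerD_Cexp, eulerD_scal, eulerD_minus; [now apply eulerD_elog|now apply eulerD_elog2].
  - cbv beta. unfold hT. field.
Qed.

Lemma sq0 : 0 ^ 2 = 0 :> C.
Proof. ring. Qed.

Lemma qE2_0 : qE2 0 = 1. Proof. unfold qE2. rewrite wlam_0. ring. Qed.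
Lemma qE4_0 : qE4 0 = 1. Proof. unfold qE4. rewrite wlam_0. ring. Qed.
Lemma eisP_0 : eisP 0 = 1. Proof. unfold eisP. rewrite sq0, qE2_0. ring. Qed.
Lemma hT_0 : hT 0 = 0. Proof. unfold hT. ring. Qed.

(** The right side is [3 eta(tau)^16 / eta(2 tau)^8]. Both sides have the same logarithmic Euler
    derivative, so their ratio is constant, and at [q = 0] the left side is 3. *)
Lemma eisP_U q : (Cmod q < 1)%R ->
  4 * eisP q ^ 2 - qE4 q = 3 * Cexp (-16 * elog q + 8 * elog (q ^ 2)).
Proof.
  intros Hq.
  set (X := fun y => (4 * eisP y ^ 2 - qE4 y) * Cexp (16 * elog y - 8 * elog (y ^ 2))).
  assert (E : X q = X 0).
  { apply Euler_const; auto. intros z Hz.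
    assert (H : eulerD X z 0).
    { unfold X. eapply eulerD_eq.
      - apply eulerD_mult.
        + apply eulerD_minus; [apply eulerD_scal, eulerD_sqr, eulerD_eisP, Hz|apply eulerD_qE4, Hz].
        + apply eulerD_Cexp, eulerD_minus; apply eulerD_scal; [apply eulerD_elog, Hz|apply eulerD_elog2, Hz].
      - cbv beta. rewrite (qE6_eisP z Hz). field. }
    exact H. }
  unfold X in E. rewrite sq0, elog_0, eisP_0, qE4_0 in E.
  replace (16 * 0 - 8 * 0) with (RtoC 0) in E by ring. rewrite Cexp_0 in E.
  replace (-16 * elog q + 8 * elog (q ^ 2)) with (- (16 * elog q - 8 * elog (q ^ 2))) by ring.
  rewrite Cexp_opp. pose proof (Cexp_neq0 (16 * elog q - 8 * elog (q ^ 2))) as Hn.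
  set (x := Cexp (16 * elog q - 8 * elog (q ^ 2))) in *.
  replace (4 * eisP q ^ 2 - qE4 q) with ((4 * eisP q ^ 2 - qE4 q) * x / x) by (field; auto).
  rewrite E. field; auto.
Qed.

Lemma qE2_deriv_0 : cderiv qE2 0 (-24).
Proof.
  eapply cderiv_eq; [unfold qE2; apply cderiv_minus; [apply cderiv_const|apply cderiv_scal, wlam_deriv_0]|ring].
Qed.

Lemma eisP_deriv_0 : cderiv eisP 0 24.
Proof.
  eapply cderiv_eq.
  - unfold eisP. apply cderiv_minus; [|apply qE2_deriv_0].
    apply cderiv_scal. apply (cderiv_comp qE2 (fun y => y ^ 2)); [|apply cderiv_sqr, cderiv_id].
    rewrite sq0. apply qE2_deriv_0.
  - cbv beta. ring.
Qed.

(** The right side is [-192 eta(2 tau)^16 / eta(tau)^8]. It vanishes to first order at the cusp, so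
    after division by the nonvanishing factor the equation is [D X = X]; the slope at 0 is
    [2 * 24 - 240 = -192]. *)
Lemma eisP_V q : (Cmod q < 1)%R ->
  eisP q ^ 2 - qE4 q = -192 * (q * Cexp (8 * elog q - 16 * elog (q ^ 2))).
Proof.
  intros Hq.
  set (X := fun y => (eisP y ^ 2 - qE4 y) * Cexp (-8 * elog y + 16 * elog (y ^ 2))).
  assert (E : X q = -192 * q).
  { apply Euler_linear; auto.
    - unfold X. rewrite eisP_0, qE4_0. ring.
    - destruct (eulerD_elog 0) as (l & Hl & _); [rewrite Cmod_0; lra|].
      destruct (eulerD_elog2 0) as (l' & Hl' & _); [rewrite Cmod_0; lra|].
      eapply cderiv_eq.
      + unfold X. apply cderiv_mult.
        * apply cderiv_minus; [apply cderiv_sqr, eisP_deriv_0|].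
          unfold qE4. apply cderiv_plus; [apply cderiv_const|apply cderiv_scal, wlam_deriv_0].
        * apply cderiv_Cexp_comp, cderiv_plus; apply cderiv_scal; eauto.
      + cbv beta. rewrite sq0, elog_0, eisP_0, qE4_0.
        replace (-8 * 0 + 16 * 0) with (RtoC 0) by ring. rewrite Cexp_0. ring.
    - intros z Hz.
      assert (H : eulerD X z (X z)).
      { unfold X. eapply eulerD_eq.
        - apply eulerD_mult.
          + apply eulerD_minus; [apply eulerD_sqr, eulerD_eisP, Hz|apply eulerD_qE4, Hz].
          + apply eulerD_Cexp, eulerD_plus; apply eulerD_scal; [apply eulerD_elog, Hz|apply eulerD_elog2, Hz].
        - cbv beta. rewrite (qE6_eisP z Hz). field. }
      exact H. }
  unfold X in E.
  replace (8 * elog q - 16 * elog (q ^ 2)) with (- (-8 * elog q + 16 * elog (q ^ 2))) by ring.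
  rewrite Cexp_opp. pose proof (Cexp_neq0 (-8 * elog q + 16 * elog (q ^ 2))) as Hn.
  set (x := Cexp (-8 * elog q + 16 * elog (q ^ 2))) in *.
  replace (eisP q ^ 2 - qE4 q) with ((eisP q ^ 2 - qE4 q) * x / x) by (field; auto).
  rewrite E. field; auto.
Qed.

(** The quotient of the two eta products is [hT], which makes [E4 / P ^ 2] a rational function of
    it. *)
Lemma eisP_qE4_hT q : (Cmod q < 1)%R -> eisP q ^ 2 - qE4 q = hT q * (4 * eisP q ^ 2 - qE4 q).
Proof.
  intros Hq. rewrite eisP_V, eisP_U by auto. unfold hT.
  replace (8 * elog q - 16 * elog (q ^ 2)) with
    (24 * (elog q - elog (q ^ 2)) + (-16 * elog q + 8 * elog (q ^ 2))) by ring.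
  rewrite Cexp_plus. ring.
Qed.

Lemma eisP_U_neq0 q : (Cmod q < 1)%R -> 4 * eisP q ^ 2 - qE4 q <> 0.
Proof.
  intros Hq. rewrite eisP_U by auto. apply Cmult_neq_0; [|apply Cexp_neq0].
  apply (RtoC_IZR_neq0 3). lia.
Qed.

(** A zero of [P] reduces [eisP_qE4_hT] to [E4 = hT q * E4], where E4 cannot vanish as well by
    [eisP_U_neq0]. *)
Lemma eisP_neq0 q : (Cmod q < 1)%R -> hT q <> 1 -> eisP q <> 0.
Proof.
  intros Hq Ht Hp. pose proof (eisP_qE4_hT q Hq) as E. pose proof (eisP_U_neq0 q Hq) as HU.
  rewrite Hp in E, HU. apply Ht.
  assert (He : qE4 q <> 0) by (intros H; apply HU; rewrite H; ring).
  replace (hT q) with (hT q * (4 * 0 ^ 2 - qE4 q) / (- qE4 q)) by (field; auto).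
  rewrite <- E. field; auto.
Qed.

Lemma hT_neq0 (q : C) : q <> 0 -> hT q <> 0.
Proof.
  intros Hq. unfold hT. apply Cmult_neq_0; [apply (RtoC_IZR_neq0 (-64)); lia|].
  apply Cmult_neq_0; auto. apply Cexp_neq0.
Qed.

(** * The hypergeometric equation *)

Definition hcoef (n : nat) : R :=
  (pochhammer (1 / 8) n * pochhammer (3 / 8) n / (pochhammer 1 n * INR (fact n)))%R.

Lemma pochhammer_1 n : pochhammer 1 n = INR (fact n).
Proof.
  induction n; [simpl; auto|]. change (fact (S n)) with (S n * fact n)%nat.
  rewrite mult_INR, S_INR. simpl pochhammer. rewrite IHn. ring.
Qed.

Lemma INR_fact_pos n : (0 < INR (fact n))%R.
Proof. apply lt_0_INR, lt_O_fact. Qed.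

Lemma hcoef_S n : (hcoef (S n) * (INR (S n) * INR (S n)) = hcoef n * ((1 / 8 + INR n) * (3 / 8 + INR n)))%R.
Proof.
  unfold hcoef. rewrite !pochhammer_1. change (fact (S n)) with (S n * fact n)%nat.
  rewrite mult_INR. simpl pochhammer.
  pose proof (INR_fact_pos n). assert (0 < INR (S n))%R by (rewrite S_INR; pose proof (pos_INR n); lra).
  field. lra.
Qed.

Lemma hcoef_bound n : (0 <= hcoef n <= 1)%R.
Proof.
  induction n.
  - unfold hcoef. simpl. lra.
  - pose proof (hcoef_S n) as H. rewrite S_INR in H. pose proof (pos_INR n) as Hn.
    set (x := INR n) in *. set (c := hcoef n) in *. set (d := hcoef (S n)) in *.
    assert (P : (0 < (x + 1) * (x + 1))%R) by nra.
    split; apply (Rmult_le_reg_r ((x + 1) * (x + 1))); auto; rewrite H.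
    + rewrite Rmult_0_l. apply Rmult_le_pos; [|apply Rmult_le_pos]; lra.
    + apply Rle_trans with (1 * ((1 / 8 + x) * (3 / 8 + x)))%R; [apply Rmult_le_compat_r; [apply Rmult_le_pos; lra|lra]|nra].
Qed.

Definition hyp (w : C) : C := hyp2F1 (1 / 8) (3 / 8) 1 w.

Section Hyp.
Let c0 (n : nat) : C := RtoC (hcoef n).
Let c1 (n : nat) : C := c0 n * RtoC (INR n).

Lemma hyp_summable r : (0 <= r < 1)%R -> summable (fun n => RtoC (hcoef n) * RtoC r ^ n).
Proof.
  intros Hr. apply (summable_mult_bounded _ _ 1).
  - intros n. rewrite Cmod_R. destruct (hcoef_bound n). rewrite Rabs_right; lra.
  - apply summable_geom. rewrite Cmod_R, Rabs_right; lra.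
Qed.

Lemma hyp_sum w : (Cmod w < 1)%R -> has_sum (fun n => RtoC (hcoef n) * w ^ n) (hyp w).
Proof.
  intros Hw. apply summable_CSeries.
  apply (gps_summable_z (fun n => RtoC (hcoef n)) (fun n => n)); auto. apply hyp_summable.
Qed.

Definition hyp1 (w : C) : C := CSeries (fun n => RtoC (hcoef n) * RtoC (INR n) * w ^ n).
Definition hyp2 (w : C) : C := CSeries (fun n => RtoC (hcoef n) * RtoC (INR n) * RtoC (INR n) * w ^ n).

Lemma hyp1_summable r : (0 <= r < 1)%R -> summable (fun n => RtoC (hcoef n) * RtoC (INR n) * RtoC r ^ n).
Proof. apply (gps_deriv_summable (fun n => RtoC (hcoef n)) (fun n => n) hyp_summable). Qed.

Lemma hyp1_sum w : (Cmod w < 1)%R -> has_sum (fun n => RtoC (hcoef n) * RtoC (INR n) * w ^ n) (hyp1 w).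
Proof.
  intros Hw. apply summable_CSeries.
  apply (gps_summable_z (fun n => RtoC (hcoef n) * RtoC (INR n)) (fun n => n)); auto. apply hyp1_summable.
Qed.

Lemma hyp2_sum w : (Cmod w < 1)%R ->
  has_sum (fun n => RtoC (hcoef n) * RtoC (INR n) * RtoC (INR n) * w ^ n) (hyp2 w).
Proof.
  intros Hw. apply summable_CSeries.
  apply (gps_summable_z (fun n => RtoC (hcoef n) * RtoC (INR n) * RtoC (INR n)) (fun n => n)); auto.
  apply (gps_deriv_summable (fun n => RtoC (hcoef n) * RtoC (INR n)) (fun n => n) hyp1_summable).
Qed.

Lemma eulerD_hyp w : (Cmod w < 1)%R -> eulerD hyp w (hyp1 w).
Proof.
  intros Hw. destruct (gps_deriv_D _ (fun n => n) _ hyp_summable hyp_sum w Hw) as (l & Hl & HS).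
  exists l. split; auto. apply (has_sum_unique _ _ _ HS). now apply hyp1_sum.
Qed.

Lemma eulerD_hyp1 w : (Cmod w < 1)%R -> eulerD hyp1 w (hyp2 w).
Proof.
  intros Hw. destruct (gps_deriv_D _ (fun n => n) _ hyp1_summable hyp1_sum w Hw) as (l & Hl & HS).
  exists l. split; auto. apply (has_sum_unique _ _ _ HS). now apply hyp2_sum.
Qed.

(** The coefficient recurrence reads [D^2 f = w (D + 1/8) (D + 3/8) f]; the constants are
    [1/8 + 3/8 = 1/2] and [1/8 * 3/8 = 3/64]. *)
Lemma hyp_ode w : (Cmod w < 1)%R -> (1 - w) * hyp2 w = w * (hyp1 w / 2 + 3 / 64 * hyp w).
Proof.
  intros Hw.
  assert (H2 : has_sum (fun n => RtoC (hcoef (S n)) * RtoC (INR (S n)) * RtoC (INR (S n)) * w ^ S n) (hyp2 w)).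
  { apply (has_sum_nat_shift (fun n => RtoC (hcoef n) * RtoC (INR n) * RtoC (INR n) * w ^ n)); [simpl; ring|now apply hyp2_sum]. }
  assert (E : hyp2 w = w * (hyp2 w + / 2 * hyp1 w + 3 / 64 * hyp w)).
  { apply (has_sum_unique _ _ _ H2).
    eapply has_sum_ext; [|apply has_sum_scal, has_sum_plus; [apply has_sum_plus;
      [apply (hyp2_sum w Hw)|apply has_sum_scal, (hyp1_sum w Hw)]|apply has_sum_scal, (hyp_sum w Hw)]].
    intros n. cbv beta.
    assert (A : RtoC (hcoef (S n)) * RtoC (INR (S n)) * RtoC (INR (S n)) =
       RtoC (hcoef n) * ((1 / 8 + RtoC (INR n)) * (3 / 8 + RtoC (INR n)))).
    { rewrite <- Cmult_assoc, <- !RtoC_mult, hcoef_S, !RtoC_mult, !RtoC_plus.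
      rewrite !RtoC_div by lra. ring. }
    rewrite A, Cpow_S. field. }
  transitivity (hyp2 w - w * hyp2 w); [ring|]. rewrite E at 1. field.
Qed.

Lemma hyp_0 : hyp 0 = 1.
Proof.
  apply (has_sum_unique _ _ _ (hyp_sum 0 ltac:(rewrite Cmod_0; lra))).
  assert (H := has_sum_single (fun n => RtoC (hcoef n) * 0 ^ n) 0%nat).
  cbv beta in H. replace (RtoC (hcoef 0) * 0 ^ 0) with (RtoC 1) in H.
  - apply H. intros [|n] Hn; [tauto|simpl; ring].
  - replace (hcoef 0) with 1%R by (unfold hcoef; simpl; field). simpl; ring.
Qed.

Lemma hyp1_0 : hyp1 0 = 0.
Proof.
  apply CSeries_has_sum. eapply has_sum_ext; [|apply has_sum_0].
  intros [|n]; simpl; ring.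
Qed.

End Hyp.

(* 1/v *)
Definition hW (q : C) : C := -4 * hT q / (1 - hT q) ^ 2.

(** The value 1 of [hT] is a zero of [v], where [1/v] is infinite although [hW] takes the default
    value 0. *)
Definition goodq (q : C) : Prop := (Cmod q < 1)%R /\ hT q <> 1 /\ (Cmod (hW q) < 1)%R.

(* D P / P *)
Definition dlogP (q : C) : C := (qE2 q - eisP q * (1 + 2 * hT q) / (1 - hT q)) / 6.

Lemma qE4_hT q : (Cmod q < 1)%R -> hT q <> 1 -> qE4 q = eisP q ^ 2 * (1 - 4 * hT q) / (1 - hT q).
Proof.
  intros Hq Ht. pose proof (eisP_qE4_hT q Hq) as E.
  assert (Hn : 1 - hT q <> 0) by (apply Cminus_eq_contra; auto).
  apply (Clin _ _ _ _ (- / (1 - hT q)) E). field; auto.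
Qed.

Lemma eulerD_eisP' q : (Cmod q < 1)%R -> hT q <> 1 -> eulerD eisP q (eisP q * dlogP q).
Proof.
  intros Hq Ht. eapply eulerD_eq; [now apply eulerD_eisP|].
  assert (Hn : 1 - hT q <> 0) by (apply Cminus_eq_contra; auto).
  rewrite (qE4_hT q Hq Ht). unfold dlogP. field; auto.
Qed.

(** A Riccati equation: for a square root [y] of [P] it says [D^2 y / y = dlogP^2 / 2 + 3/64 P^2 w],
    the equation that the pullback of [hyp] should satisfy. This is where [3/64] meets [3/32]. *)
Lemma eulerD_dlogP q : (Cmod q < 1)%R -> hT q <> 1 ->
  eulerD dlogP q (dlogP q ^ 2 / 2 + 3 / 32 * (eisP q ^ 2 * hW q)).
Proof.
  intros Hq Ht. assert (Hn : 1 - hT q <> 0) by (apply Cminus_eq_contra; auto).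
  apply (eulerD_ext (fun y => / 6 * (qE2 y - eisP y * (1 + 2 * hT y) / (1 - hT y)))).
  { intros y. unfold dlogP. unfold Cdiv at 2. ring. }
  eapply eulerD_eq.
  - apply eulerD_scal, eulerD_minus; [apply eulerD_qE2, Hq|].
    apply eulerD_div; auto.
    + apply eulerD_mult; [apply eulerD_eisP', Ht; auto|].
      apply eulerD_plus; [apply eulerD_const|apply eulerD_scal, eulerD_hT, Hq].
    + apply eulerD_minus; [apply eulerD_const|apply eulerD_hT, Hq].
  - cbv beta. rewrite (qE4_hT q Hq Ht). unfold dlogP, hW. field; auto.
Qed.

Lemma eulerD_comp f g q b r : eulerD f (g q) b -> eulerD g q (g q * r) ->
  eulerD (fun y => f (g y)) q (b * r).
Proof.
  intros (d & H & <-) (d' & H' & E). exists (d * d'). split; [now apply cderiv_comp|].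
  transitivity (d * (q * d')); [ring|]. rewrite E. ring.
Qed.

(** A square root of [1 - 1/v] that is rational in [T]; it is also the factor in
    [D hW = hW P hS]. *)
Definition hS (q : C) : C := (1 + hT q) / (1 - hT q).

Lemma eulerD_hW q : (Cmod q < 1)%R -> hT q <> 1 -> eulerD hW q (hW q * (eisP q * hS q)).
Proof.
  intros Hq Ht. assert (Hn : 1 - hT q <> 0) by (apply Cminus_eq_contra; auto).
  unfold hW at 1. eapply eulerD_eq.
  - apply eulerD_div.
    + apply eulerD_scal, eulerD_hT, Hq.
    + apply eulerD_sqr, eulerD_minus; [apply eulerD_const|apply eulerD_hT, Hq].
    + now apply Cpow_nz.
  - cbv beta. unfold hW, hS. field; auto.
Qed.

Lemma eulerD_hS q : (Cmod q < 1)%R -> hT q <> 1 -> eulerD hS q (- (hW q * eisP q) / 2).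
Proof.
  intros Hq Ht. assert (Hn : 1 - hT q <> 0) by (apply Cminus_eq_contra; auto).
  unfold hS at 1. eapply eulerD_eq.
  - apply eulerD_div; auto.
    + apply eulerD_plus; [apply eulerD_const|apply eulerD_hT, Hq].
    + apply eulerD_minus; [apply eulerD_const|apply eulerD_hT, Hq].
  - cbv beta. unfold hW. field; auto.
Qed.

Lemma hS_sqr q : hT q <> 1 -> hS q ^ 2 = 1 - hW q.
Proof.
  intros Ht. assert (Hn : 1 - hT q <> 0) by (apply Cminus_eq_contra; auto).
  unfold hS, hW. field; auto.
Qed.

(* With f = hyp (1/v): D (1/v) = (1/v) P hS, so defY = (f D P - 2 P D f) / P, and defN = f^2 - P. *)
Definition defY (q : C) : C := hyp (hW q) * dlogP q - 2 * (eisP q * (hS q * hyp1 (hW q))).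
Definition defN (q : C) : C := hyp (hW q) ^ 2 - eisP q.

(** The second derivative of [hyp] enters with the factor [hS ^ 2 = 1 - hW], exactly the leading
    coefficient of the hypergeometric equation. *)
Lemma eulerD_defY q : goodq q -> eulerD defY q (dlogP q / 2 * defY q).
Proof.
  intros (Hq & Ht & Hw). pose proof (eulerD_hW q Hq Ht) as Hww.
  unfold defY at 1. eapply eulerD_eq.
  - apply eulerD_minus.
    + apply eulerD_mult; [apply (eulerD_comp hyp hW); eauto; apply eulerD_hyp, Hw|apply eulerD_dlogP; auto].
    + apply eulerD_scal, eulerD_mult; [apply eulerD_eisP'; auto|].
      apply eulerD_mult; [apply eulerD_hS; auto|].
      apply (eulerD_comp hyp1 hW); eauto. apply eulerD_hyp1, Hw.
  - cbv beta. pose proof (hyp_ode (hW q) Hw) as O. rewrite <- (hS_sqr q Ht) in O.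
    unfold defY.
    apply (Clin _ _ _ _ (-2 * eisP q ^ 2) O). field.
Qed.

(** The system is triangular: once [defY] vanishes, [defN] solves a homogeneous equation by
    itself. *)
Lemma eulerD_defN q : goodq q -> eulerD defN q (dlogP q * defN q - hyp (hW q) * defY q).
Proof.
  intros (Hq & Ht & Hw). pose proof (eulerD_hW q Hq Ht) as Hww.
  unfold defN at 1. eapply eulerD_eq.
  - apply eulerD_minus; [|apply eulerD_eisP'; auto].
    apply eulerD_sqr, (eulerD_comp hyp hW); eauto. apply eulerD_hyp, Hw.
  - cbv beta. unfold defN, defY. ring.
Qed.

Lemma ccont_lt f z M : ccont f z -> (Cmod (f z) < M)%R ->
  exists r, (0 < r)%R /\ forall y, (Cmod (y - z) < r)%R -> (Cmod (f y) < M)%R.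
Proof.
  intros Hf HM. destruct (Hf (M - Cmod (f z))%R) as (r & Hr & H); [lra|].
  exists r; split; auto. intros y Hy. specialize (H y Hy).
  replace (f y) with (f z + (f y - f z)) by ring.
  eapply Rle_lt_trans; [apply Cmod_triangle|]. lra.
Qed.

Lemma goodq_open q : goodq q -> exists r, (0 < r)%R /\ forall y, (Cmod (y - q) < r)%R -> goodq y.
Proof.
  intros (Hq & Ht & Hw).
  destruct (ccont_lt (fun y => y) q 1 (ccont_id q) Hq) as (r1 & Hr1 & H1).
  destruct (ccont_neq0 (fun y => hT y - 1) q) as (r2 & Hr2 & H2).
  { apply ccont_minus; [apply (eulerD_cont _ _ _ (eulerD_hT q Hq))|apply ccont_const]. }
  { now apply Cminus_eq_contra. }
  destruct (ccont_lt hW q 1 (eulerD_cont _ _ _ (eulerD_hW q Hq Ht)) Hw) as (r3 & Hr3 & H3).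
  exists (Rmin r1 (Rmin r2 r3)). split; [repeat apply Rmin_glb_lt; auto|].
  intros y Hy.
  assert (A := Rlt_le_trans _ _ _ Hy (Rmin_l _ _)). assert (B := Rlt_le_trans _ _ _ Hy (Rmin_r _ _)).
  split; [|split].
  - apply (H1 y A).
  - intros E. apply (H2 y (Rlt_le_trans _ _ _ B (Rmin_l _ _))). rewrite E. ring.
  - apply (H3 y (Rlt_le_trans _ _ _ B (Rmin_r _ _))).
Qed.

Lemma goodq_0 : goodq 0.
Proof.
  split; [rewrite Cmod_0; lra|]. split.
  - rewrite hT_0. intros E. apply RtoC_inj in E. lra.
  - unfold hW. rewrite hT_0. replace (-4 * 0 / (1 - 0) ^ 2) with (RtoC 0) by (unfold Cdiv; ring).
    rewrite Cmod_0. lra.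
Qed.

Lemma hW_0 : hW 0 = 0.
Proof. unfold hW. rewrite hT_0. unfold Cdiv; ring. Qed.

Lemma dlogP_0 : dlogP 0 = 0.
Proof. unfold dlogP. rewrite qE2_0, eisP_0, hT_0. field. Qed.

Lemma defY_0 : defY 0 = 0.
Proof. unfold defY. rewrite dlogP_0, hW_0, hyp1_0. ring. Qed.

Lemma defN_0 : defN 0 = 0.
Proof. unfold defN. rewrite hW_0, hyp_0, eisP_0. ring. Qed.

Lemma ray_bound' (q : C) s r : (Cmod q < r)%R -> (0 < s <= 1)%R -> (Cmod (RtoC s * q - 0) < r)%R.
Proof.
  intros Hq Hs. replace (RtoC s * q - 0) with (RtoC s * q) by ring.
  rewrite Cmod_mult, Cmod_R, Rabs_right by lra. pose proof (Cmod_ge_0 q). nra.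
Qed.

(** Because [dlogP] vanishes at 0, both coefficients stay below the threshold [1/2] of
    [ode_zero_singular] on a small disc. *)
Lemma defY_defN_near_0 : exists r, (0 < r)%R /\ forall q, (Cmod q < r)%R -> defY q = 0 /\ defN q = 0.
Proof.
  destruct (goodq_open 0 goodq_0) as (r1 & Hr1 & H1).
  assert (Cm : ccont dlogP 0).
  { destruct goodq_0 as (A & B & _). apply (eulerD_cont _ _ _ (eulerD_dlogP 0 A B)). }
  destruct (ccont_lt dlogP 0 (/ 2) Cm) as (r2 & Hr2 & H2).
  { rewrite dlogP_0, Cmod_0. lra. }
  set (r := Rmin r1 r2).
  assert (Hr : (0 < r)%R) by now apply Rmin_glb_lt.
  assert (HY : forall q, (Cmod q < r)%R -> defY q = 0).
  { intros q Hq. destruct (eulerD_defY 0 goodq_0) as (l0 & Hl0 & _).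
    apply (ode_zero_singular defY q l0 (fun s => dlogP (RtoC s * q) / 2) Hl0 defY_0).
    intros s Hs. pose proof (ray_bound' q s r Hq Hs) as B.
    destruct (eulerD_defY (RtoC s * q)) as (l & Hl & E).
    { apply H1. eapply Rlt_le_trans; [apply B|apply Rmin_l]. }
    exists l. split; [exact Hl|]. split; [exact E|].
    specialize (H2 _ (Rlt_le_trans _ _ _ B (Rmin_r _ _))).
    rewrite Cmod_div by (apply (RtoC_IZR_neq0 2); lia).
    rewrite Cmod_R, Rabs_right by lra. pose proof (Cmod_ge_0 (dlogP (RtoC s * q))). lra. }
  exists r. split; [exact Hr|]. intros q Hq. split; [exact (HY q Hq)|].
  destruct (eulerD_defN 0 goodq_0) as (l0 & Hl0 & _).
  apply (ode_zero_singular defN q l0 (fun s => dlogP (RtoC s * q)) Hl0 defN_0).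
  intros s Hs. pose proof (ray_bound' q s r Hq Hs) as B.
  destruct (eulerD_defN (RtoC s * q)) as (l & Hl & E).
  { apply H1. eapply Rlt_le_trans; [apply B|apply Rmin_l]. }
  exists l. split; [exact Hl|]. split.
  - rewrite E, (HY (RtoC s * q)). { ring. }
    now replace (RtoC s * q) with (RtoC s * q - 0) by ring.
  - specialize (H2 _ (Rlt_le_trans _ _ _ B (Rmin_r _ _))). lra.
Qed.

(** * Transfer from the disc to the upper half-plane *)

Lemma nome_deriv z : cderiv nome z (2 * PI * Ci * nome z).
Proof.
  eapply cderiv_eq; [unfold nome; apply cderiv_Cexp_comp, cderiv_scal, cderiv_id|].
  unfold nome. ring.
Qed.

Lemma Re_2piI z : Re (2 * PI * Ci * z) = (- (2 * PI * Im z))%R.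
Proof. destruct z. simpl. ring. Qed.

Lemma Cmod_nome z : Cmod (nome z) = exp (- (2 * PI * Im z)).
Proof. unfold nome. now rewrite Cmod_Cexp, Re_2piI. Qed.

Lemma nome_neq0 z : nome z <> 0.
Proof. apply Cexp_neq0. Qed.

Lemma Cmod_nome_lt1 z : (0 < Im z)%R -> (Cmod (nome z) < 1)%R.
Proof.
  intros Hz. rewrite Cmod_nome, <- exp_0. apply exp_increasing.
  pose proof PI_RGT_0. nra.
Qed.

Lemma eulerD_nome f z l : eulerD f (nome z) l -> cderiv (fun z => f (nome z)) z (2 * PI * Ci * l).
Proof.
  intros (d & H & <-). eapply cderiv_eq; [apply (cderiv_comp f nome); [apply H|apply nome_deriv]|]. ring.
Qed.

Lemma nome_cont z : ccont nome z.
Proof. apply (cderiv_cont _ _ _ (nome_deriv z)). Qed.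

Lemma goodq_nome_open z : goodq (nome z) ->
  exists r, (0 < r)%R /\ forall y, (Cmod (y - z) < r)%R -> goodq (nome y).
Proof.
  intros H. destruct (goodq_open _ H) as (r & Hr & H1).
  destruct (nome_cont z r Hr) as (d & Hd & H2). exists d; split; [exact Hd|].
  intros y Hy. exact (H1 _ (H2 y Hy)).
Qed.

Lemma segment_bound (z0 d : C) s : (0 <= s <= 1)%R -> (Cmod (z0 + RtoC s * d - z0) <= Cmod d)%R.
Proof.
  intros Hs. replace (z0 + RtoC s * d - z0) with (RtoC s * d) by ring.
  rewrite Cmod_mult, Cmod_R, Rabs_right by lra. pose proof (Cmod_ge_0 d). nra.
Qed.

(** In the variable [z] the system has no singular point, so the regular Gronwall estimate on
    segments makes the common zero set open. *)
Lemma defY_defN_local z0 : goodq (nome z0) -> defY (nome z0) = 0 -> defN (nome z0) = 0 ->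
  exists r, (0 < r)%R /\ forall z, (Cmod (z - z0) < r)%R -> defY (nome z) = 0 /\ defN (nome z) = 0.
Proof.
  intros Hg Hy Hn. destruct (goodq_nome_open z0 Hg) as (r1 & Hr1 & H1).
  assert (Cm : ccont (fun z => dlogP (nome z)) z0).
  { destruct Hg as (A & B & _). apply (ccont_comp dlogP nome); [|apply nome_cont].
    apply (eulerD_cont _ _ _ (eulerD_dlogP _ A B)). }
  destruct (ccont_bounded _ _ Cm) as (r2 & M & Hr2 & HM).
  set (r := Rmin r1 r2).
  assert (Hr : (0 < r)%R) by now apply Rmin_glb_lt.
  set (K := (Cmod (2 * PI * Ci) * M)%R).
  assert (HY : forall z, (Cmod (z - z0) < r)%R -> defY (nome z) = 0).
  { intros z Hz. replace z with (z0 + (z - z0)) by ring.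
    apply (ode_zero (fun z => defY (nome z)) z0 (z - z0)
      (fun s => 2 * PI * Ci * (dlogP (nome (z0 + RtoC s * (z - z0))) / 2)) K); [|exact Hy].
    intros s Hs. pose proof (Rle_lt_trans _ _ _ (segment_bound z0 (z - z0) s Hs) Hz) as B.
    split.
    - eapply cderiv_eq; [apply eulerD_nome, eulerD_defY, H1; eapply Rlt_le_trans; [apply B|apply Rmin_l]|].
      cbv beta; ring.
    - unfold K. rewrite Cmod_mult. apply Rmult_le_compat_l; [apply Cmod_ge_0|].
      specialize (HM _ (Rlt_le_trans _ _ _ B (Rmin_r _ _))).
      rewrite Cmod_div by (apply (RtoC_IZR_neq0 2); lia).
      rewrite Cmod_R, Rabs_right by lra.
      pose proof (Cmod_ge_0 (dlogP (nome (z0 + RtoC s * (z - z0))))). lra. }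
  exists r. split; [exact Hr|]. intros z Hz. split; [exact (HY z Hz)|].
  replace z with (z0 + (z - z0)) by ring.
  apply (ode_zero (fun z => defN (nome z)) z0 (z - z0)
    (fun s => 2 * PI * Ci * dlogP (nome (z0 + RtoC s * (z - z0)))) K); [|exact Hn].
  intros s Hs. pose proof (Rle_lt_trans _ _ _ (segment_bound z0 (z - z0) s Hs) Hz) as B.
  split.
  - eapply cderiv_eq; [apply eulerD_nome, eulerD_defN, H1; eapply Rlt_le_trans; [apply B|apply Rmin_l]|].
    cbv beta. rewrite (HY _ B). ring.
  - unfold K. rewrite Cmod_mult. apply Rmult_le_compat_l; [apply Cmod_ge_0|].
    apply (HM _ (Rlt_le_trans _ _ _ B (Rmin_r _ _))).
Qed.

(** * Theta series *)

Lemma has_sum_Z (f : Z -> C) s t : has_sum (fun n => f (Z.of_nat n)) s ->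
  has_sum (fun n => f (- Z.of_nat (S n))%Z) t -> has_sum f (s + t).
Proof.
  intros Hs Ht.
  assert (H1 : has_sum (fun n => if (0 <=? n)%Z then f n else 0) s).
  { apply (has_sum_reindex Z.of_nat); [intros; lia| |].
    - intros i. destruct (Z.leb_spec 0 i); [|tauto]. intros _. exists (Z.to_nat i). lia.
    - eapply has_sum_ext; [|exact Hs]. intros n. cbv beta. destruct (Z.leb_spec 0 (Z.of_nat n)); [auto|lia]. }
  assert (H2 : has_sum (fun n => if (0 <=? n)%Z then 0 else f n) t).
  { apply (has_sum_reindex (fun n => (- Z.of_nat (S n))%Z)); [intros; lia| |].
    - intros i. destruct (Z.leb_spec 0 i); [tauto|]. intros _. exists (Z.to_nat (- i - 1)). lia.
    - eapply has_sum_ext; [|exact Ht]. intros n. cbv beta. destruct (Z.leb_spec 0 (- Z.of_nat (S n))); [lia|auto]. }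
  eapply has_sum_ext; [|apply (has_sum_plus _ _ _ _ H1 H2)].
  intros n. cbv beta. destruct (0 <=? n)%Z; ring.
Qed.

Lemma summable_Z (f : Z -> C) : summable (fun n => f (Z.of_nat n)) ->
  summable (fun n => f (- Z.of_nat (S n))%Z) -> summable f.
Proof.
  intros Hs Ht.
  assert (H1 : summable (fun n => if (0 <=? n)%Z then f n else 0)).
  { apply (summable_reindex Z.of_nat); [intros; lia| |].
    - intros i. destruct (Z.leb_spec 0 i); [|tauto]. intros _. exists (Z.to_nat i). lia.
    - eapply summable_ext; [|exact Hs]. intros n. cbv beta. destruct (Z.leb_spec 0 (Z.of_nat n)); [auto|lia]. }
  assert (H2 : summable (fun n => if (0 <=? n)%Z then 0 else f n)).
  { apply (summable_reindex (fun n => (- Z.of_nat (S n))%Z)); [intros; lia| |].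
    - intros i. destruct (Z.leb_spec 0 i); [tauto|]. intros _. exists (Z.to_nat (- i - 1)). lia.
    - eapply summable_ext; [|exact Ht]. intros n. cbv beta. destruct (Z.leb_spec 0 (- Z.of_nat (S n))); [lia|auto]. }
  eapply summable_ext; [|apply (summable_plus _ _ H1 H2)].
  intros n. cbv beta. destruct (0 <=? n)%Z; ring.
Qed.

Lemma summable_CSeriesZ (f : Z -> C) : summable f -> has_sum f (CSeriesZ f).
Proof.
  intros H. apply has_sum_Z; apply summable_CSeries.
  - apply (summable_inj Z.of_nat); auto. intros; lia.
  - apply (summable_inj (fun n => (- Z.of_nat (S n))%Z)); auto. intros; lia.
Qed.

Lemma CSeriesZ_has_sum (f : Z -> C) s : has_sum f s -> summable f -> CSeriesZ f = s.
Proof. intros H Hs. apply (has_sum_unique f); auto. now apply summable_CSeriesZ. Qed.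

(** The exponents in use are nonnegative quadratic expressions in integers; a negative exponent
    would be truncated to 0. *)
Definition zpow (x : C) (k : Z) : C := x ^ Z.to_nat k.

Lemma zpow_add x a b : (0 <= a)%Z -> (0 <= b)%Z -> zpow x (a + b) = zpow x a * zpow x b.
Proof. intros. unfold zpow. rewrite Z2Nat.inj_add by auto. apply Cpow_add_r. Qed.

Lemma zpow_mul x (k : nat) a : (0 <= a)%Z -> zpow x (Z.of_nat k * a) = zpow (x ^ k) a.
Proof.
  intros. unfold zpow. rewrite Z2Nat.inj_mul, Nat2Z.id by lia. apply Cpow_mult_r.
Qed.

Lemma zpow_mult_l x y a : zpow (x * y) a = zpow x a * zpow y a.
Proof. apply Cpow_mult_l. Qed.

Definition tri (n : Z) : Z := (n * (n + 1) / 2)%Z.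

Lemma tri_double n : (2 * tri n = n * (n + 1))%Z.
Proof.
  unfold tri. assert (H : (n * (n + 1) mod 2 = 0)%Z).
  { rewrite Zmult_mod, Zplus_mod.
    destruct (Z.mod_pos_bound n 2); [lia|].
    assert (n mod 2 = 0 \/ n mod 2 = 1)%Z as [-> | ->] by lia; reflexivity. }
  rewrite (Z.div_mod (n * (n + 1)) 2) at 2 by lia. lia.
Qed.

Lemma tri_nonneg n : (0 <= tri n)%Z.
Proof. pose proof (tri_double n). nia. Qed.

Lemma summable_pow_exponent (x : C) (e : Z -> Z) : (Cmod x < 1)%R ->
  (forall n : nat, (Z.of_nat n <= e (Z.of_nat n) /\ Z.of_nat n <= e (- Z.of_nat (S n)))%Z) ->
  summable (fun n => zpow x (e n)).
Proof.
  intros Hx He. pose proof (Cmod_ge_0 x).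
  assert (A : forall n k, (n <= k)%nat -> (Cmod (x ^ k) <= Cmod (x ^ n))%R).
  { intros n k Hk. rewrite !Cmod_pow. replace k with (n + (k - n))%nat by lia.
    rewrite pow_add. pose proof (pow_le (Cmod x) n H).
    assert (Cmod x ^ (k - n) <= 1)%R by (rewrite <- (pow1 (k - n)); apply pow_incr; lra).
    nra. }
  apply summable_Z; apply (summable_le _ (fun n => x ^ n)); try (now apply summable_geom);
    intros n; apply A; destruct (He n); lia.
Qed.

Lemma summable_phi x : (Cmod x < 1)%R -> summable (fun n => zpow x (n * n)).
Proof. intros Hx. apply summable_pow_exponent; auto. intros n; nia. Qed.

Lemma summable_psi x : (Cmod x < 1)%R -> summable (fun n => zpow x (tri n)).
Proof.
  intros Hx. apply summable_pow_exponent; auto. intros n.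
  pose proof (tri_double (Z.of_nat n)). pose proof (tri_double (- Z.of_nat (S n))). nia.
Qed.

Definition phi (x : C) : C := CSeriesZ (fun n => zpow x (n * n)).
(** Twice Ramanujan's function psi, since [n] and [-n-1] have the same triangular number. Summing
    over all integers makes the 45 degree rotation possible. *)
Definition psi2 (x : C) : C := CSeriesZ (fun n => zpow x (tri n)).

Lemma phi_sum x : (Cmod x < 1)%R -> has_sum (fun n => zpow x (n * n)) (phi x).
Proof. intros. now apply summable_CSeriesZ, summable_phi. Qed.

Lemma psi2_sum x : (Cmod x < 1)%R -> has_sum (fun n => zpow x (tri n)) (psi2 x).
Proof. intros. now apply summable_CSeriesZ, summable_psi. Qed.

(* Split Z^2 by the parity of m + n and rotate each class by 45 degrees. *)
Lemma parity_split (F : Z * Z -> C) s0 s1 :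
  has_sum (fun p : Z * Z => F (fst p + snd p, fst p - snd p)%Z) s0 ->
  has_sum (fun p : Z * Z => F (fst p + snd p + 1, fst p - snd p)%Z) s1 ->
  has_sum F (s0 + s1).
Proof.
  intros H0 H1.
  assert (A0 : has_sum (fun p : Z * Z => if Z.even (fst p + snd p) then F p else 0) s0).
  { apply (has_sum_reindex (fun p : Z * Z => (fst p + snd p, fst p - snd p)%Z)).
    - intros [a b] [c d] E. simpl in E. inversion E. f_equal; lia.
    - intros [m n]. simpl. destruct (Z.even (m + n)) eqn:E; [|tauto]. intros _.
      apply Z.even_spec in E. destruct E as (k & E). exists (k, m - k)%Z. simpl. f_equal; lia.
    - eapply has_sum_ext; [|exact H0]. intros [u v]. cbn [fst snd].
      replace (u + v + (u - v))%Z with (2 * u)%Z by lia. now rewrite Z.even_mul. }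
  assert (A1 : has_sum (fun p : Z * Z => if Z.even (fst p + snd p) then 0 else F p) s1).
  { apply (has_sum_reindex (fun p : Z * Z => (fst p + snd p + 1, fst p - snd p)%Z)).
    - intros [a b] [c d] E. simpl in E. inversion E. f_equal; lia.
    - intros [m n]. simpl. destruct (Z.even (m + n)) eqn:E; [tauto|]. intros _.
      rewrite <- Z.negb_odd in E. apply Bool.negb_false_iff, Z.odd_spec in E.
      destruct E as (k & E). exists (k, m - k - 1)%Z. simpl. f_equal; lia.
    - eapply has_sum_ext; [|exact H1]. intros [u v]. cbn [fst snd].
      replace (u + v + 1 + (u - v))%Z with (2 * u + 1)%Z by lia. now rewrite Z.even_add, Z.even_mul. }
  eapply has_sum_ext; [|apply (has_sum_plus _ _ _ _ A0 A1)].
  intros p. cbv beta. destruct (Z.even (fst p + snd p)); ring.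
Qed.

Lemma Cmod_opp_lt1 x : (Cmod x < 1)%R -> (Cmod (- x) < 1)%R.
Proof. now rewrite Cmod_opp. Qed.

Lemma zpow_1 x : zpow x 1 = x.
Proof. unfold zpow. simpl. ring. Qed.

Ltac znonneg := repeat first [apply Z.square_nonneg | apply tri_nonneg | apply Z.add_nonneg_nonneg
  | apply Z.mul_nonneg_nonneg | lia].

Lemma Csq (y : C) : y ^ 2 = y * y.
Proof. ring. Qed.

(** Under the rotation [m^2 + n^2] becomes [2 u^2 + 2 v^2] on the even class and
    [4 tri u + 4 tri v + 1] on the odd one. *)
Lemma phi_sqr x : (Cmod x < 1)%R -> phi x ^ 2 = phi (x ^ 2) ^ 2 + x * psi2 (x ^ 4) ^ 2.
Proof.
  intros Hx. pose proof (Cmod_pow_lt1 x 1 Hx) as Hx2. pose proof (Cmod_pow_lt1 x 3 Hx) as Hx4.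
  rewrite (Csq (phi x)), (Csq (phi (x ^ 2))), (Csq (psi2 _)).
  apply (has_sum_unique (fun p : Z * Z => zpow x (fst p * fst p) * zpow x (snd p * snd p))).
  - apply (has_sum_prod (fun n => zpow x (n * n)) (fun n => zpow x (n * n))); try (now apply summable_phi); now apply phi_sum.
  - apply parity_split.
    + eapply has_sum_ext; [|apply (has_sum_prod _ _ _ _ (summable_phi _ Hx2) (summable_phi _ Hx2) (phi_sum _ Hx2) (phi_sum _ Hx2))].
      intros [u v]. cbn [fst snd]. rewrite <- !zpow_mul by znonneg; rewrite <- !zpow_add by znonneg. f_equal. nia.
    + eapply has_sum_ext; [|apply has_sum_scal, (has_sum_prod _ _ _ _ (summable_psi _ Hx4) (summable_psi _ Hx4) (psi2_sum _ Hx4) (psi2_sum _ Hx4))].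
      intros [u v]. cbn [fst snd]. pose proof (tri_nonneg u). pose proof (tri_nonneg v).
      rewrite <- !zpow_mul by auto.
      transitivity (zpow x 1 * (zpow x (Z.of_nat 4 * tri u) * zpow x (Z.of_nat 4 * tri v)));
        [rewrite zpow_1; ring|].
      rewrite <- !zpow_add by znonneg. f_equal. pose proof (tri_double u). pose proof (tri_double v). lia.
Qed.

Lemma zpow_minus1_parity a b : (0 <= a)%Z -> (0 <= b)%Z -> Z.even a = Z.even b ->
  zpow (- (1)) a = zpow (- (1)) b.
Proof.
  assert (H : forall n, (- (1)) ^ n = if Nat.even n then 1 else - (1)).
  { induction n; [simpl; ring|]. rewrite Cpow_S, IHn, Nat.even_succ, <- Nat.negb_even.
    destruct (Nat.even n); simpl; ring. }
  intros Ha Hb E. unfold zpow. rewrite !H.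
  replace (Nat.even (Z.to_nat a)) with (Z.even a).
  - replace (Nat.even (Z.to_nat b)) with (Z.even b); [now rewrite E|].
    rewrite <- (Z2Nat.id b) at 1 by auto. generalize (Z.to_nat b). induction n; auto.
    rewrite Nat2Z.inj_succ, Z.even_succ, <- Z.negb_even, IHn, Nat.even_succ, <- Nat.negb_even. auto.
  - rewrite <- (Z2Nat.id a) at 1 by auto. generalize (Z.to_nat a). induction n; auto.
    rewrite Nat2Z.inj_succ, Z.even_succ, <- Z.negb_even, IHn, Nat.even_succ, <- Nat.negb_even. auto.
Qed.

Lemma zpow_opp x a : zpow (- x) a = zpow (- (1)) a * zpow x a.
Proof. rewrite <- zpow_mult_l. f_equal. ring. Qed.

(** The same rotation with signs. On the odd class each factor changes sign under [u -> -u-1], so it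
    sums to its own negative and the class contributes nothing. *)
Lemma phi_mult_neg x : (Cmod x < 1)%R -> phi x * phi (- x) = phi (- x ^ 2) ^ 2.
Proof.
  intros Hx. pose proof (Cmod_pow_lt1 x 1 Hx) as Hx2. pose proof (Cmod_pow_lt1 x 3 Hx) as Hx4.
  pose proof (Cmod_opp_lt1 _ Hx) as Hnx. pose proof (Cmod_opp_lt1 _ Hx2) as Hnx2.
  rewrite (Csq (phi (- x ^ 2))).
  set (f := fun u => zpow (- (1)) (u * u) * zpow (x ^ 4) (tri u)).
  assert (Sf : summable f).
  { apply (summable_le _ (fun u => zpow (x ^ 4) (tri u))); [|now apply summable_psi].
    intros u. unfold f. rewrite Cmod_mult. unfold zpow at 1. rewrite Cmod_pow_1; [lra|apply Cmod_minus1]. }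
  destruct (summable_has_sum _ Sf) as (s & Hs).
  assert (Es : s = 0).
  { assert (H : has_sum (fun u => f (- u - 1)%Z) s).
    { apply (has_sum_reindex (fun u => (- u - 1)%Z)); auto.
      - intros; lia.
      - intros i _. exists (- i - 1)%Z. lia. }
    assert (E : s = - s).
    { apply (has_sum_unique _ _ _ H). eapply has_sum_ext; [|apply (has_sum_opp _ _ Hs)].
      intros u. unfold f.
      replace (tri (- u - 1)) with (tri u) by (unfold tri; f_equal; lia).
      replace (zpow (- (1)) ((- u - 1) * (- u - 1))) with (- zpow (- (1)) (u * u)); [ring|].
      transitivity (zpow (- (1)) (u * u + 1)).
      - rewrite zpow_add by nia. unfold zpow. simpl. ring.
      - apply zpow_minus1_parity; [znonneg|znonneg|].
        replace ((- u - 1) * (- u - 1))%Z with (u * u + 1 + 2 * u)%Z by ring.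
        rewrite (Z.even_add _ (2 * u)), (Z.even_mul 2). now destruct (Z.even (u * u + 1)). }
    assert (E' : s = (s - - s) / 2) by field. rewrite E', <- E. field. }
  apply (has_sum_unique (fun p : Z * Z => zpow x (fst p * fst p) * zpow (- x) (snd p * snd p))).
  - apply (has_sum_prod (fun n => zpow x (n * n)) (fun n => zpow (- x) (n * n))); try (now apply summable_phi); now apply phi_sum.
  - replace (phi (- x ^ 2) * phi (- x ^ 2)) with (phi (- x ^ 2) * phi (- x ^ 2) + x * (s * s)) by (rewrite Es; ring).
    apply parity_split.
    + eapply has_sum_ext; [|apply (has_sum_prod _ _ _ _ (summable_phi _ Hnx2) (summable_phi _ Hnx2) (phi_sum _ Hnx2) (phi_sum _ Hnx2))].
      intros [u v]. cbn [fst snd].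
      rewrite (zpow_opp x), (zpow_opp (x ^ 2)), (zpow_opp (x ^ 2) (v * v)).
      rewrite <- !zpow_mul by znonneg.
      transitivity ((zpow (- (1)) (u * u) * zpow (- (1)) (v * v)) * (zpow x (Z.of_nat 2 * (u * u)) * zpow x (Z.of_nat 2 * (v * v)))); [ring|].
      rewrite <- !zpow_add by znonneg.
      rewrite (zpow_minus1_parity (u * u + v * v) ((u - v) * (u - v))); [|znonneg|znonneg|].
      * transitivity (zpow (- (1)) ((u - v) * (u - v)) * (zpow x ((u + v) * (u + v)) * zpow x ((u - v) * (u - v)))); [|ring].
        rewrite <- zpow_add by znonneg. f_equal. f_equal. lia.
      * replace (u * u + v * v)%Z with ((u - v) * (u - v) + 2 * (u * v))%Z by ring.
        rewrite (Z.even_add _ (2 * (u * v))), (Z.even_mul 2). now destruct (Z.even ((u - v) * (u - v))).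
    + eapply has_sum_ext; [|apply has_sum_scal, (has_sum_prod _ _ _ _ Sf Sf Hs Hs)].
      intros [u v]. unfold f. cbn [fst snd]. pose proof (tri_nonneg u). pose proof (tri_nonneg v).
      rewrite (zpow_opp x), <- !zpow_mul by auto.
      transitivity ((zpow (- (1)) (u * u) * zpow (- (1)) (v * v)) * (zpow x 1 * (zpow x (Z.of_nat 4 * tri u) * zpow x (Z.of_nat 4 * tri v))));
        [rewrite zpow_1; ring|].
      rewrite <- !zpow_add by znonneg.
      rewrite (zpow_minus1_parity (u * u + v * v) ((u - v) * (u - v))); [|znonneg|znonneg|].
      * transitivity (zpow (- (1)) ((u - v) * (u - v)) * (zpow x ((u + v + 1) * (u + v + 1)) * zpow x ((u - v) * (u - v)))); [|ring].
        rewrite <- zpow_add by znonneg. f_equal. f_equal.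
        pose proof (tri_double u). pose proof (tri_double v). lia.
      * replace (u * u + v * v)%Z with ((u - v) * (u - v) + 2 * (u * v))%Z by ring.
        rewrite (Z.even_add _ (2 * (u * v))), (Z.even_mul 2). now destruct (Z.even ((u - v) * (u - v))).
Qed.

(** The rotated exponent is [2 tri u + v^2] on the even class and [(u + 1)^2 + 2 tri v] on the odd
    class; both give the same product. *)
Lemma psi2_sqr x : (Cmod x < 1)%R -> psi2 x ^ 2 = 2 * (phi x * psi2 (x ^ 2)).
Proof.
  intros Hx. pose proof (Cmod_pow_lt1 x 1 Hx) as Hx2.
  rewrite (Csq (psi2 x)).
  assert (Sh : has_sum (fun n => zpow x ((n + 1) * (n + 1))) (phi x)).
  { apply (has_sum_reindex (fun n => (n + 1)%Z) (fun n => zpow x (n * n))).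
    - intros; lia.
    - intros i _. exists (i - 1)%Z. lia.
    - now apply phi_sum. }
  assert (SSh : summable (fun n => zpow x ((n + 1) * (n + 1)))).
  { apply (summable_inj (fun n => (n + 1)%Z) (fun n => zpow x (n * n))); [intros; lia|now apply summable_phi]. }
  apply (has_sum_unique (fun p : Z * Z => zpow x (tri (fst p)) * zpow x (tri (snd p)))).
  - apply (has_sum_prod (fun n => zpow x (tri n)) (fun n => zpow x (tri n))); try (now apply summable_psi); now apply psi2_sum.
  - replace (2 * (phi x * psi2 (x ^ 2))) with (psi2 (x ^ 2) * phi x + phi x * psi2 (x ^ 2)) by ring.
    apply parity_split.
    + eapply has_sum_ext; [|apply (has_sum_prod _ _ _ _ (summable_psi _ Hx2) (summable_phi _ Hx) (psi2_sum _ Hx2) (phi_sum _ Hx))].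
      intros [u v]. cbn [fst snd]. pose proof (tri_nonneg u). pose proof (tri_nonneg (u + v)). pose proof (tri_nonneg (u - v)).
      rewrite <- !zpow_mul by znonneg; rewrite <- !zpow_add by znonneg. f_equal.
      pose proof (tri_double u). pose proof (tri_double (u + v)). pose proof (tri_double (u - v)). lia.
    + eapply has_sum_ext; [|apply (has_sum_prod _ _ _ _ SSh (summable_psi _ Hx2) Sh (psi2_sum _ Hx2))].
      intros [u v]. cbn [fst snd]. pose proof (tri_nonneg v). pose proof (tri_nonneg (u + v + 1)). pose proof (tri_nonneg (u - v)).
      rewrite <- !zpow_mul by znonneg; rewrite <- !zpow_add by znonneg. f_equal.
      pose proof (tri_double v). pose proof (tri_double (u + v + 1)). pose proof (tri_double (u - v)). lia.
Qed.

(** * Gauss's product formulas *)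

Definition clim (u : nat -> C) (s : C) : Prop :=
  forall eps, (0 < eps)%R -> exists N, forall n, (N <= n)%nat -> (Cmod (u n - s) < eps)%R.

Lemma clim_unique u s t : clim u s -> clim u t -> s = t.
Proof.
  intros Hs Ht. apply NNPP; intros Hne.
  assert (Hd : (0 < Cmod (s - t))%R) by (now apply Cmod_gt_0, Cminus_eq_contra).
  destruct (Hs (Cmod (s - t) / 2)%R) as (N & HN); [lra|].
  destruct (Ht (Cmod (s - t) / 2)%R) as (M & HM); [lra|].
  specialize (HN (max N M) ltac:(lia)). specialize (HM (max N M) ltac:(lia)).
  set (x := u (max N M)) in *.
  assert (Cmod (s - t) <= Cmod (x - s) + Cmod (x - t))%R; [|lra].
  replace (s - t) with (- (x - s) + (x - t)) by ring.
  eapply Rle_trans; [apply Cmod_triangle|]. rewrite Cmod_opp; lra.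
Qed.

Lemma clim_ext u v s : (forall n, u n = v n) -> clim u s -> clim v s.
Proof.
  intros H Hu eps He. destruct (Hu eps He) as (N & HN). exists N. intros n Hn.
  rewrite <- H. auto.
Qed.

Lemma clim_comp f u s : ccont f s -> clim u s -> clim (fun n => f (u n)) (f s).
Proof.
  intros Hf Hu eps He. destruct (Hf eps He) as (d & Hd & H).
  destruct (Hu d Hd) as (N & HN). exists N. auto.
Qed.

Lemma clim_plus u v s t : clim u s -> clim v t -> clim (fun n => u n + v n) (s + t).
Proof.
  intros Hu Hv eps He.
  destruct (Hu (eps / 2)%R) as (N & HN); [lra|].
  destruct (Hv (eps / 2)%R) as (M & HM); [lra|].
  exists (max N M). intros n Hn. specialize (HN n ltac:(lia)). specialize (HM n ltac:(lia)).
  replace (u n + v n - (s + t)) with ((u n - s) + (v n - t)) by ring.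
  eapply Rle_lt_trans; [apply Cmod_triangle|]. lra.
Qed.

Lemma clim_scal c u s : clim u s -> clim (fun n => c * u n) (c * s).
Proof.
  intros H. apply (clim_comp (fun y => c * y)); auto.
  apply ccont_mult; [apply ccont_const|apply ccont_id].
Qed.

Lemma clim_subseq u (k : nat -> nat) s : (forall n, (n <= k n)%nat) -> clim u s -> clim (fun n => u (k n)) s.
Proof.
  intros Hk Hu eps He. destruct (Hu eps He) as (N & HN). exists N. intros n Hn.
  apply HN. specialize (Hk n). lia.
Qed.

Lemma clim_lsum (f : nat -> C) s : has_sum f s -> clim (fun n => lsum f (seq 0 n)) s.
Proof.
  intros H eps He. destruct (has_sum_lim f s eps H He) as (N & HN).
  exists (S N). intros [|n] Hn; [lia|]. rewrite <- sum_n_lsum. apply HN. lia.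
Qed.

Lemma Cexp_cont z : ccont Cexp z.
Proof. apply (cderiv_cont _ _ _ (cderiv_Cexp z)). Qed.

Lemma Cprod_Cexp q n : (Cmod q < 1)%R ->
  Cprod_n (fun n => 1 - q ^ S n) n = Cexp (- lsum (fun n => logser (q ^ S n)) (seq 0 n)).
Proof.
  intros Hq. induction n.
  - simpl. replace (- 0) with (RtoC 0) by ring. now rewrite Cexp_0.
  - rewrite lsum_seq_S. cbn [Cprod_n]. rewrite IHn.
    rewrite <- (Cexp_logser (q ^ S n)) by now apply Cmod_pow_lt1.
    rewrite <- Cexp_plus. f_equal. ring.
Qed.

Lemma CProd_elog q : (Cmod q < 1)%R -> CProd (fun n => 1 - q ^ S n) = Cexp (- elog q).
Proof.
  intros Hq. apply CLim_seq_correct.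
  apply (clim_ext (fun n => Cexp (- lsum (fun n => logser (q ^ S n)) (seq 0 n)))).
  - intros n. now rewrite Cprod_Cexp.
  - apply (clim_comp (fun y => Cexp (- y))).
    + apply (ccont_comp Cexp (fun y => - y)); [apply Cexp_cont|apply ccont_opp, ccont_id].
    + now apply clim_lsum, elog_sum2.
Qed.

Lemma geom_lsum_bound r l : (0 <= r < 1)%R -> NoDup l -> (lsumR (pow r) l <= / (1 - r))%R.
Proof.
  intros Hr. apply nat_lsum_bound.
  - intros; apply pow_le; lra.
  - intros n. apply (Rmult_le_reg_l (1 - r)); [lra|]. rewrite Rinv_r by lra.
    assert (E : ((1 - r) * lsumR (pow r) (seq 0 n) = 1 - r ^ n)%R).
    { induction n; [simpl; ring|]. rewrite seq_S, lsumR_app, Rmult_plus_distr_l, IHn. simpl. ring. }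
    rewrite E. pose proof (pow_le r n (proj1 Hr)). lra.
Qed.

Lemma logser_bound z : (Cmod z < 1)%R -> (Cmod (logser z) <= Cmod z * / (1 - Cmod z))%R.
Proof.
  intros Hz. pose proof (Cmod_ge_0 z) as H0.
  apply (has_sum_norm_le _ _ _ (summable_CSeries _ (logser_summable z Hz))).
  intros l Hl. eapply Rle_trans; [|apply Rmult_le_compat_l; [auto|apply (geom_lsum_bound (Cmod z) l); auto]].
  rewrite <- lsumR_scal. apply lsumR_le. intros n _.
  rewrite Cmod_mult, Cmod_inv, Cmod_INR, Cmod_pow by apply INR_S_neq0.
  change (Cmod z ^ S n)%R with (Cmod z * Cmod z ^ n)%R.
  rewrite <- (Rmult_1_l (Cmod z * Cmod z ^ n)) at 2.
  apply Rmult_le_compat_r; [apply Rmult_le_pos; auto; now apply pow_le|].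
  rewrite <- Rinv_1. apply Rinv_le_contravar; [lra|]. rewrite S_INR. pose proof (pos_INR n). lra.
Qed.

Lemma logser_pow_summable x : (Cmod x < 1)%R -> summable (fun n => logser (x ^ S n)).
Proof.
  intros Hx. pose proof (Cmod_ge_0 x) as H0.
  apply (summable_le_scal (/ (1 - Cmod x)) _ (fun n => x ^ n)); [|now apply summable_geom].
  intros n. eapply Rle_trans; [apply logser_bound, Cmod_pow_lt1, Hx|].
  rewrite !Cmod_pow. rewrite Rmult_comm.
  assert (A : (Cmod x ^ n <= 1)%R) by (rewrite <- (pow1 n); apply pow_incr; lra).
  pose proof (pow_le (Cmod x) n H0).
  assert (B : (Cmod x ^ S n <= Cmod x)%R) by (simpl; nra).
  apply Rmult_le_compat.
  - left. apply Rinv_0_lt_compat. lra.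
  - now apply pow_le.
  - apply Rinv_le_contravar; lra.
  - simpl. nra.
Qed.

Section Gauss.
Variable q : C.
Hypothesis Hq : (Cmod q < 1)%R.

Let l1 (n : nat) : C := logser (q ^ S n).
Let l2 (n : nat) : C := logser ((q ^ 2) ^ S n).

(* Shanks' partial products, in exponential form *)
Definition shanks (n : nat) : C := Cexp (lsum l1 (seq 0 (2 * n)) - 2 * lsum l2 (seq 0 n)).

Lemma q2_lt1 : (Cmod (q ^ 2) < 1)%R.
Proof. now apply Cmod_sqr_lt1. Qed.

(** So [shanks n] is the product of [(1 - q^(2k)) / (1 - q^(2k-1))] over [1 <= k <= n]. *)
Lemma shanks_S n : shanks (S n) * (1 - q ^ (2 * n + 1)) = shanks n * (1 - q ^ (2 * n + 2)).
Proof.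
  unfold shanks. replace (2 * S n)%nat with (S (S (2 * n))) by lia.
  rewrite !lsum_seq_S.
  replace (lsum l1 (seq 0 (2 * n)) + l1 (2 * n)%nat + l1 (S (2 * n)) - 2 * (lsum l2 (seq 0 n) + l2 n))
    with (((lsum l1 (seq 0 (2 * n)) - 2 * lsum l2 (seq 0 n)) + - - l1 (2 * n)%nat) + - - l1 (S (2 * n)) + (- l2 n + - l2 n)) by ring.
  assert (L1 : forall n, Cexp (- l1 n) = 1 - q ^ S n) by (intros; now apply Cexp_logser, Cmod_pow_lt1).
  assert (L2 : Cexp (- l2 n) = 1 - (q ^ 2) ^ S n) by (apply Cexp_logser, Cmod_pow_lt1, q2_lt1).
  rewrite !Cexp_plus. rewrite (Cexp_opp (- l1 _)), (Cexp_opp (- l1 (S (2 * n)))), !L1, L2.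
  rewrite <- Cpow_mult_r. replace (2 * S n)%nat with (S (S (2 * n))) by lia.
  replace (2 * n + 1)%nat with (S (2 * n)) by lia. replace (2 * n + 2)%nat with (S (S (2 * n))) by lia.
  pose proof (lam_den q (2 * n) Hq). pose proof (lam_den q (S (2 * n)) Hq). field. auto.
Qed.

Lemma shanks_neq0 n : shanks n <> 0.
Proof. apply Cexp_neq0. Qed.

(** The summand is the difference of consecutive right-hand sides, which vanish at [k = 0]; this
    discrete antiderivative drives the induction in [shanks_identity]. *)
Lemma shanks_telescope n k :
  lsum (fun s => shanks n / shanks s * q ^ (s * (2 * n + 1)) *
     ((1 - q ^ (2 * n + 2)) * q ^ (2 * s) - (1 - q ^ (2 * n + 1)))) (seq 0 k) =
  shanks n / shanks k * (1 - q ^ (2 * k)) * q ^ (k * (2 * n + 1)).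
Proof.
  induction k.
  - simpl. ring.
  - rewrite lsum_seq_S, IHk.
    pose proof (shanks_S k) as HS. pose proof (shanks_neq0 k) as N0. pose proof (shanks_neq0 (S k)) as N1.
    assert (D1 : 1 - q ^ (2 * k + 1) <> 0) by (replace (2 * k + 1)%nat with (S (2 * k)) by lia; now apply lam_den).
    assert (D2 : 1 - q ^ (2 * k + 2) <> 0) by (replace (2 * k + 2)%nat with (S (2 * k + 1)) by lia; now apply lam_den).
    replace (2 * S k)%nat with (2 * k + 2)%nat by lia.
    replace (S k * (2 * n + 1))%nat with (k * (2 * n + 1) + (2 * n + 1))%nat by lia.
    rewrite (Cpow_add_r q (k * (2 * n + 1)) (2 * n + 1)).
    assert (E : shanks k = shanks (S k) * (1 - q ^ (2 * k + 1)) / (1 - q ^ (2 * k + 2)))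
      by (rewrite HS; field; auto).
    rewrite E. clear E HS.
    replace (2 * n + 2)%nat with (S (2 * n + 1)) by lia. rewrite (Cpow_S _ (2 * n + 1)).
    replace (q ^ (2 * k + 1)) with (q * q ^ (2 * k)) in * by (rewrite <- Cpow_S; f_equal; lia).
    replace (q ^ (2 * k + 2)) with (q * q * q ^ (2 * k)) in * by (rewrite <- Cmult_assoc, <- !Cpow_S; f_equal; lia).
    field. auto.
Qed.

(** Shanks' finite form of Gauss's theorem. Passing to [n + 1] multiplies the term [s] by
    [q^(2s) (1 - q^(2n+2)) / (1 - q^(2n+1))]; the correction telescopes and accounts for the two new
    exponents [n (2n+1)] and [(n+1) (2n+1)]. *)
Lemma shanks_identity n :
  lsum (fun s => q ^ (s * (s + 1) / 2)) (seq 0 (2 * n)) =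
  lsum (fun s => shanks n / shanks s * q ^ (s * (2 * n + 1))) (seq 0 n).
Proof.
  induction n; [reflexivity|].
  replace (2 * S n)%nat with (S (S (2 * n))) by lia. rewrite !lsum_seq_S, IHn.
  assert (D1 : 1 - q ^ (2 * n + 1) <> 0) by (replace (2 * n + 1)%nat with (S (2 * n)) by lia; now apply lam_den).
  pose proof (shanks_telescope n n) as T.
  set (f := fun s => shanks n / shanks s * q ^ (s * (2 * n + 1))) in *.
  assert (E1 : lsum (fun s => shanks (S n) / shanks s * q ^ (s * (S (S (2 * n)) + 1))) (seq 0 n) =
     (1 - q ^ (2 * n + 2)) / (1 - q ^ (2 * n + 1)) * lsum (fun s => f s * q ^ (2 * s)) (seq 0 n)).
  { rewrite <- lsum_scal. apply lsum_ext. intros s _. unfold f.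
    replace (s * (S (S (2 * n)) + 1))%nat with (s * (2 * n + 1) + 2 * s)%nat by lia. rewrite Cpow_add_r.
    replace (shanks (S n)) with (shanks (S n) * (1 - q ^ (2 * n + 1)) / (1 - q ^ (2 * n + 1))) by (field; auto).
    rewrite shanks_S. pose proof (shanks_neq0 s). field. auto. }
  rewrite E1.
  assert (E2 : (1 - q ^ (2 * n + 2)) * lsum (fun s => f s * q ^ (2 * s)) (seq 0 n) =
     (1 - q ^ (2 * n + 1)) * lsum f (seq 0 n) + (1 - q ^ (2 * n)) * q ^ (n * (2 * n + 1))).
  { pose proof (shanks_neq0 n). replace (1 - q ^ (2 * n)) with (shanks n / shanks n * (1 - q ^ (2 * n))) by (field; auto).
    rewrite <- T. rewrite <- !lsum_scal, <- lsum_plus. apply lsum_ext. intros s _. unfold f. ring. }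
  assert (E3 : shanks (S n) / shanks n = (1 - q ^ (2 * n + 2)) / (1 - q ^ (2 * n + 1))).
  { pose proof (shanks_neq0 n).
    replace (shanks (S n)) with (shanks (S n) * (1 - q ^ (2 * n + 1)) / (1 - q ^ (2 * n + 1))) by (field; auto).
    rewrite shanks_S. field. auto. }
  rewrite E3.
  replace ((2 * n) * (2 * n + 1) / 2)%nat with (n * (2 * n + 1))%nat.
  2:{ rewrite <- (Nat.div_mul (n * (2 * n + 1)) 2) at 1 by lia. f_equal. lia. }
  replace (S (2 * n) * (S (2 * n) + 1) / 2)%nat with (n * (2 * n + 1) + (2 * n + 1))%nat.
  2:{ rewrite <- (Nat.div_mul (n * (2 * n + 1) + (2 * n + 1)) 2) at 1 by lia. f_equal. lia. }
  replace (n * (S (S (2 * n)) + 1))%nat with (n * (2 * n + 1) + 2 * n)%nat by lia.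
  rewrite !Cpow_add_r.
  transitivity (((1 - q ^ (2 * n + 2)) * lsum (fun s => f s * q ^ (2 * s)) (seq 0 n)
     + (1 - q ^ (2 * n + 2)) * (q ^ (n * (2 * n + 1)) * q ^ (2 * n))) / (1 - q ^ (2 * n + 1))).
  - rewrite E2. rewrite <- (Cpow_add_r q (2 * n) 1) in *.
    replace (2 * n + 2)%nat with (S (2 * n + 1)) by lia. rewrite (Cpow_S _ (2 * n + 1)).
    replace (q ^ (2 * n + 1)) with (q * q ^ (2 * n)) in * by (rewrite <- Cpow_S; f_equal; lia).
    field. auto.
  - rewrite <- (Cpow_add_r q (2 * n) 2), <- (Cpow_add_r q (2 * n) 1). field. auto.
Qed.

Lemma shanks_ratio_bound : exists B : R, forall n s, (Cmod (shanks n / shanks s) <= B)%R.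
Proof.
  destruct (logser_pow_summable q Hq) as (M1 & HM1). destruct (logser_pow_summable (q ^ 2) q2_lt1) as (M2 & HM2).
  exists (exp (2 * (M1 + 2 * M2))).
  intros n s. unfold shanks. rewrite <- Cexp_minus, Cmod_Cexp.
  match goal with |- (exp ?a <= exp ?b)%R => assert (H : (a <= b)%R) end.
  { eapply Rle_trans; [apply Rle_abs|]. eapply Rle_trans; [apply Cmod_Re_Im|].
    assert (B1 : forall m, (Cmod (lsum l1 (seq 0 m)) <= M1)%R).
    { intros m. eapply Rle_trans; [apply Cmod_lsum|]. apply HM1, seq_NoDup. }
    assert (B2 : forall m, (Cmod (2 * lsum l2 (seq 0 m)) <= 2 * M2)%R).
    { intros m. rewrite Cmod_mult, Cmod_R, Rabs_right by lra. apply Rmult_le_compat_l; [lra|].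
      eapply Rle_trans; [apply Cmod_lsum|]. apply HM2, seq_NoDup. }
    unfold Cminus. eapply Rle_trans; [apply Cmod_triangle|]. rewrite Cmod_opp.
    eapply Rle_trans; [apply Rplus_le_compat; apply Cmod_triangle|]. rewrite !Cmod_opp.
    pose proof (B1 (2 * n)%nat). pose proof (B1 (2 * s)%nat). pose proof (B2 n). pose proof (B2 s). lra. }
  destruct H as [H|H]; [left; now apply exp_increasing|right; now rewrite H].
Qed.

Lemma shanks_lim : clim shanks (Cexp (elog q - 2 * elog (q ^ 2))).
Proof.
  apply (clim_comp Cexp); [apply Cexp_cont|].
  apply (clim_plus (fun n => lsum l1 (seq 0 (2 * n)))).
  - apply (clim_subseq (fun n => lsum l1 (seq 0 n)) (fun n => (2 * n)%nat)); [intros; lia|].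
    apply clim_lsum. now apply elog_sum2.
  - apply (clim_ext (fun n => - (2) * lsum l2 (seq 0 n))); [intros; ring|].
    replace (- (2 * elog (q ^ 2))) with (- (2) * elog (q ^ 2)) by ring.
    apply clim_scal, clim_lsum. apply elog_sum2, q2_lt1.
Qed.

(** In [shanks_identity] every term with [s >= 1] carries an exponent at least [2n + 1] and a
    bounded ratio, so in the limit only the term [s = 0], equal to [shanks n], survives. *)
Lemma triangular_sum_lim :
  clim (fun n => lsum (fun s => q ^ (s * (s + 1) / 2)) (seq 0 (2 * n))) (Cexp (elog q - 2 * elog (q ^ 2))).
Proof.
  pose proof shanks_lim as HL. destruct shanks_ratio_bound as (B & HB).
  pose proof (Cmod_ge_0 q) as Hq0.
  assert (HB0 : (0 <= B)%R) by (eapply Rle_trans; [apply (Cmod_ge_0 (shanks 0 / shanks 0))|apply HB]).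
  intros eps He. destruct (HL (eps / 2)%R) as (N & HN); [lra|].
  set (C0 := (B * / (1 - Cmod q) + 1)%R).
  assert (HC0 : (0 < C0)%R).
  { unfold C0. assert (0 < / (1 - Cmod q))%R by (apply Rinv_0_lt_compat; lra). nra. }
  destruct (pow_lt_1_zero (Cmod q)) with (y := (eps / 2 / C0)%R) as (M & HM).
  { rewrite Rabs_right; lra. }
  { apply Rdiv_lt_0_compat; lra. }
  exists (S (max N M)). intros n Hn. rewrite shanks_identity.
  destruct n as [|m]; [lia|]. set (n := S m) in *.
  assert (E : lsum (fun s => shanks n / shanks s * q ^ (s * (2 * n + 1))) (seq 0 n) =
    shanks n + lsum (fun s => shanks n / shanks s * q ^ (s * (2 * n + 1))) (seq 1 m)).
  { unfold n at 3. simpl seq. simpl lsum. simpl Nat.mul at 1. simpl Cpow.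
    assert (E0 : shanks 0 = 1).
    { unfold shanks. simpl. replace (0 - 2 * 0) with (RtoC 0) by ring. apply Cexp_0. }
    rewrite E0. field. }
  rewrite E.
  match goal with |- (Cmod (?a + ?b - ?c) < _)%R => replace (a + b - c) with ((a - c) + b) by ring end.
  eapply Rle_lt_trans; [apply Cmod_triangle|].
  specialize (HN n ltac:(lia)).
  assert (T : (Cmod (lsum (fun s => shanks n / shanks s * q ^ (s * (2 * n + 1)))%C (seq 1 m)) <= C0 * Cmod q ^ n)%R).
  { eapply Rle_trans; [apply Cmod_lsum|].
    apply Rle_trans with (lsumR (fun s => (B * Cmod q ^ n) * Cmod q ^ s)%R (seq 1 m)).
    - apply lsumR_le. intros s Hs. apply in_seq in Hs. rewrite Cmod_mult, Cmod_pow, Rmult_assoc.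
      apply Rmult_le_compat; [apply Cmod_ge_0|now apply pow_le|apply HB|].
      rewrite <- pow_add. replace (s * (2 * n + 1))%nat with ((n + s) + (s * (2 * n) - n))%nat by nia.
      rewrite (pow_add _ (n + s)). pose proof (pow_le (Cmod q) (n + s) Hq0).
      assert (Cmod q ^ (s * (2 * n) - n) <= 1)%R by (rewrite <- (pow1 (s * (2 * n) - n)); apply pow_incr; lra).
      nra.
    - rewrite lsumR_scal. pose proof (geom_lsum_bound (Cmod q) (seq 1 m) ltac:(lra) (seq_NoDup _ _)).
      pose proof (pow_le (Cmod q) n Hq0). unfold C0.
      assert (B * Cmod q ^ n * lsumR (fun s => Cmod q ^ s) (seq 1 m) <= B * Cmod q ^ n * / (1 - Cmod q))%R.
      { apply Rmult_le_compat_l; auto. apply Rmult_le_pos; auto. }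
      replace ((B * / (1 - Cmod q) + 1) * Cmod q ^ n)%R with (B * Cmod q ^ n * / (1 - Cmod q) + Cmod q ^ n)%R by ring.
      change (fun s : nat => (Cmod q ^ s)%R) with (pow (Cmod q)) in *; lra. }
  specialize (HM n ltac:(lia)). rewrite Rabs_right in HM by (apply Rle_ge; now apply pow_le).
  apply Rlt_div_r in HM; auto. rewrite Rmult_comm in T. lra.
Qed.

(** The negative integers repeat the sum over the nonnegative ones by [n -> -n-1], which gives the
    factor 2. *)
Lemma psi2_gauss : psi2 q = 2 * Cexp (elog q - 2 * elog (q ^ 2)).
Proof.
  assert (Sn : summable (fun n => zpow q (tri (Z.of_nat n)))).
  { apply (summable_inj Z.of_nat (fun n => zpow q (tri n))); [intros; lia|now apply summable_psi]. }
  assert (HS := summable_CSeries _ Sn). set (s := CSeries _) in HS.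
  assert (E1 : psi2 q = s + s).
  { apply (has_sum_unique (fun n => zpow q (tri n))); [now apply psi2_sum|].
    apply has_sum_Z; auto. eapply has_sum_ext; [|exact HS].
    intros n. cbv beta. f_equal. unfold tri. f_equal. lia. }
  rewrite E1. replace (s + s) with (2 * s) by ring. f_equal.
  apply (clim_unique (fun n => lsum (fun s => q ^ (s * (s + 1) / 2)) (seq 0 (2 * n)))).
  - apply (clim_subseq (fun n => lsum (fun s => q ^ (s * (s + 1) / 2)) (seq 0 n)) (fun n => (2 * n)%nat)); [intros; lia|].
    apply clim_lsum. eapply has_sum_ext; [|exact HS]. intros n. cbv beta. unfold zpow. f_equal.
    unfold tri. replace (Z.of_nat n + 1)%Z with (Z.of_nat (n + 1)) by lia. rewrite <- Nat2Z.inj_mul.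
    change 2%Z with (Z.of_nat 2). rewrite <- Nat2Z.inj_div. apply Nat2Z.id.
  - apply triangular_sum_lim.
Qed.

End Gauss.

Lemma logser_add_neg x : (Cmod x < 1)%R -> logser x + logser (- x) = logser (x ^ 2).
Proof.
  intros Hx.
  assert (E : logser x + logser (- x) - logser (x ^ 2) = logser 0 + logser (- 0) - logser (0 ^ 2)).
  { apply (Euler_const (fun x => logser x + logser (- x) - logser (x ^ 2)) x Hx).
    intros z Hz. pose proof (Cmod_opp_lt1 z Hz) as Hn. pose proof (Cmod_sqr_lt1 z Hz) as H2.
    pose proof (one_minus_neq0 z Hz) as D1. pose proof (one_minus_neq0 _ Hn) as D2.
    eexists. split.
    - apply cderiv_minus; [apply cderiv_plus|].
      + now apply logser_deriv.
      + apply (cderiv_comp logser (fun y => - y)); [now apply logser_deriv|apply cderiv_opp, cderiv_id].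
      + apply (cderiv_comp logser (fun y => y ^ 2)); [now apply logser_deriv|apply cderiv_sqr, cderiv_id].
    - cbv beta. replace (1 - z ^ 2) with ((1 - z) * (1 - - z)) by ring.
      field. split; [|exact D1]. intros E; apply D2. rewrite <- E. ring. }
  replace (- 0) with (RtoC 0) in E by ring. rewrite sq0, logser_0 in E.
  apply (Clin _ _ _ _ 1 E). ring.
Qed.

Lemma elog_add_neg q : (Cmod q < 1)%R -> elog q + elog (- q) = 3 * elog (q ^ 2) - elog ((q ^ 2) ^ 2).
Proof.
  intros Hq. pose proof (Cmod_opp_lt1 q Hq) as Hn. pose proof (Cmod_sqr_lt1 q Hq) as H2.
  pose proof (Cmod_sqr_lt1 _ H2) as H4.
  pose proof (proj2 (elog_sum2 _ Hq)) as S1. pose proof (proj2 (elog_sum2 _ Hn)) as Sn.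
  pose proof (proj2 (elog_sum2 _ H2)) as S2. pose proof (proj2 (elog_sum2 _ H4)) as S4.
  assert (A : has_sum (fun n => (- (1)) ^ S n * logser ((q ^ 2) ^ S n)) (2 * elog ((q ^ 2) ^ 2) - elog (q ^ 2))).
  { apply alternating_split; auto. eapply has_sum_ext; [|exact S4].
    intros j. cbv beta. f_equal. rewrite <- (Cpow_mult_r (q ^ 2) 2). f_equal. lia. }
  assert (B : has_sum (fun n => logser (q ^ S n) * (1 + (- (1)) ^ S n)) (2 * elog (q ^ 2))).
  { assert (A' : has_sum (fun n => (- (1)) ^ S n * logser (q ^ S n)) (2 * elog (q ^ 2) - elog q)).
    { apply alternating_split; auto. eapply has_sum_ext; [|exact S2].
      intros j. cbv beta. f_equal. rewrite <- (Cpow_mult_r q 2). f_equal. lia. }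
    replace (2 * elog (q ^ 2)) with (elog q + (2 * elog (q ^ 2) - elog q)) by ring.
    eapply has_sum_ext; [|apply (has_sum_plus _ _ _ _ S1 A')]. intros n; cbv beta; ring. }
  (* odd n contribute logser(q^n) + logser(-q^n) = logser(q^(2n)), even n contribute twice logser(q^n) *)
  apply (has_sum_unique (fun n => logser (q ^ S n) + logser ((- q) ^ S n))); [now apply has_sum_plus|].
  replace (3 * elog (q ^ 2) - elog ((q ^ 2) ^ 2)) with
    (2 * elog (q ^ 2) + / 2 * (elog (q ^ 2) - (2 * elog ((q ^ 2) ^ 2) - elog (q ^ 2)))) by field.
  eapply has_sum_ext; [|apply (has_sum_plus _ _ _ _ B (has_sum_scal (/ 2) _ _ (has_sum_minus _ _ _ _ S2 A)))].
  intros n. cbv beta.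
  replace (- q) with (- (1) * q) by ring. rewrite Cpow_mult_l.
  assert (Ev : forall m, (- (1)) ^ m = 1 \/ (- (1)) ^ m = - (1)).
  { induction m as [|m [E|E]]; [left; simpl; auto|right|left]; rewrite Cpow_S, E; ring. }
  destruct (Ev (S n)) as [E|E]; rewrite E.
  - replace (1 * q ^ S n) with (q ^ S n) by ring. field.
  - replace (- (1) * q ^ S n) with (- q ^ S n) by ring.
    replace ((q ^ 2) ^ S n) with ((q ^ S n) ^ 2) by (rewrite <- !Cpow_mult_r; f_equal; lia).
    rewrite <- (logser_add_neg (q ^ S n)) by now apply Cmod_pow_lt1. field.
Qed.

(** Gauss's square series needs no second limit argument: in
    [psi2 (-q) ^ 2 = 2 phi (-q) psi2 (q ^ 2)] both values of [psi2] are known products. *)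
Lemma phi_neg q : (Cmod q < 1)%R -> phi (- q) = Cexp (elog (q ^ 2) - 2 * elog q).
Proof.
  intros Hq. pose proof (Cmod_opp_lt1 q Hq) as Hn. pose proof (Cmod_sqr_lt1 q Hq) as H2.
  pose proof (psi2_sqr (- q) Hn) as P. replace ((- q) ^ 2) with (q ^ 2) in P by ring.
  rewrite (psi2_gauss (- q) Hn), (psi2_gauss (q ^ 2) H2) in P.
  replace ((- q) ^ 2) with (q ^ 2) in P by ring.
  assert (E : elog (- q) = 3 * elog (q ^ 2) - elog ((q ^ 2) ^ 2) - elog q) by (rewrite <- elog_add_neg; auto; ring).
  rewrite E in P.
  set (y := elog ((q ^ 2) ^ 2)) in *. set (x := elog (q ^ 2)) in *. set (z := elog q) in *.
  pose proof (Cexp_neq0 (x - 2 * y)) as N.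
  assert (F : phi (- q) = Cexp (3 * x - y - z - 2 * x) * Cexp (3 * x - y - z - 2 * x) / Cexp (x - 2 * y)).
  { apply (Clin _ _ _ _ (- / (4 * Cexp (x - 2 * y))) P). field. auto. }
  rewrite F, <- Cexp_plus, <- Cexp_minus. f_equal. ring.
Qed.

(** * Jacobi's theta constants and the two Hauptmoduln *)

Section Theta.
Variable tau : C.
Hypothesis Htau : (0 < Im tau)%R.

Let Q : C := Cexp (PI * Ci * tau).
Let q : C := nome tau.

Lemma Q_sqr : Q ^ 2 = q.
Proof. unfold Q, q, nome. rewrite Cexp_pow. f_equal. simpl. rewrite RtoC_plus. ring. Qed.

Lemma Re_piI z : Re (PI * Ci * z) = (- (PI * Im z))%R.
Proof. destruct z. simpl. ring. Qed.

Lemma Q_lt1 : (Cmod Q < 1)%R.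
Proof.
  unfold Q. rewrite Cmod_Cexp, <- exp_0. apply exp_increasing. rewrite Re_piI.
  pose proof PI_RGT_0. nra.
Qed.

Lemma q_lt1 : (Cmod q < 1)%R.
Proof. now apply Cmod_nome_lt1. Qed.

Lemma CSeriesZ_ext (f g : Z -> C) : (forall n, f n = g n) -> CSeriesZ f = CSeriesZ g.
Proof.
  intros H. unfold CSeriesZ, CSeries, CLim_seq. f_equal; f_equal; f_equal; apply Lim_seq_ext; intros n;
  f_equal; apply sum_n_ext; auto.
Qed.

Lemma Cexp_zpow z k : (0 <= k)%Z -> zpow (Cexp z) k = Cexp (RtoC (IZR k) * z).
Proof.
  intros Hk. unfold zpow. rewrite Cexp_pow, INR_IZR_INZ, Z2Nat.id; auto.
Qed.

Lemma theta3_phi : theta3 tau = phi Q.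
Proof.
  apply CSeriesZ_ext. intros n. unfold Q. rewrite Cexp_zpow by nia. f_equal.
  rewrite mult_IZR, RtoC_mult. ring.
Qed.

Lemma theta4_phi : theta4 tau = phi (- Q).
Proof.
  apply CSeriesZ_ext. intros n. rewrite zpow_opp. f_equal.
  (* The integers [n], [|n|] and [n * n] have the same parity. *)
  - transitivity (zpow (- (1)) (Z.abs n)).
    + assert (P : forall k, ((-1) ^ k = 1 \/ (-1) ^ k = -1)%R).
      { induction k as [|k [E|E]]; simpl; [auto|right; rewrite E; ring|left; rewrite E; ring]. }
      assert (H : powerRZ (-1) n = ((-1) ^ Z.to_nat (Z.abs n))%R).
      { destruct n; simpl; auto. destruct (P (Pos.to_nat p)) as [E|E]; rewrite E; field. }
      rewrite H, RtoC_pow. unfold zpow. f_equal. now rewrite <- RtoC_opp.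
    + apply zpow_minus1_parity; [lia|nia|]. rewrite Z.even_mul.
      destruct (Z.abs_spec n) as [[_ ->]|[_ ->]]; rewrite ?Z.even_opp; now destruct (Z.even n).
  - unfold Q. rewrite Cexp_zpow by nia. f_equal. rewrite mult_IZR, RtoC_mult. ring.
Qed.

Lemma theta2_psi2 : theta2 tau = Cexp (PI * Ci * tau / 4) * psi2 q.
Proof.
  assert (Et : forall n, Cexp (PI * Ci * tau / 4) * zpow q (tri n) = Cexp (PI * Ci * (IZR n + / 2) ^ 2 * tau)).
  { intros n. unfold q, nome. rewrite Cexp_zpow by apply tri_nonneg. rewrite <- Cexp_plus. f_equal.
    assert (E : 2 * RtoC (IZR (tri n)) = RtoC (IZR n) * (RtoC (IZR n) + 1)).
    { rewrite <- !RtoC_plus, <- !RtoC_mult. f_equal. rewrite <- (mult_IZR 2), tri_double, mult_IZR, plus_IZR. auto. }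
    apply (Clin _ _ _ _ (PI * Ci * tau) E). field. }
  apply CSeriesZ_has_sum.
  - eapply has_sum_ext; [exact Et|apply has_sum_scal, (psi2_sum _ q_lt1)].
  - eapply summable_ext; [exact Et|apply summable_scal, summable_psi, q_lt1].
Qed.

(** By [phi_sqr] at [Q] and [-Q] the squares differ by [2 Q psi2(q^2)^2] and add up to [2 phi(q)^2];
    [psi2_sqr] recognises the product of the two. *)
Lemma theta_jacobi : theta3 tau ^ 4 - theta4 tau ^ 4 = theta2 tau ^ 4.
Proof.
  rewrite theta3_phi, theta4_phi, theta2_psi2.
  pose proof Q_lt1 as HQ. pose proof (Cmod_opp_lt1 _ HQ) as HnQ. pose proof q_lt1 as Hq.
  pose proof (phi_sqr Q HQ) as A. pose proof (phi_sqr (- Q) HnQ) as B.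
  pose proof (psi2_sqr q Hq) as D.
  replace ((- Q) ^ 2) with (Q ^ 2) in B by ring. replace ((- Q) ^ 4) with ((Q ^ 2) ^ 2) in B by ring.
  replace (Q ^ 4) with ((Q ^ 2) ^ 2) in A by ring. rewrite Q_sqr in A, B.
  transitivity ((phi Q ^ 2 - phi (- Q) ^ 2) * (phi Q ^ 2 + phi (- Q) ^ 2)); [ring|]. rewrite A, B.
  transitivity (Q * (2 * (phi q * psi2 (q ^ 2))) ^ 2); [ring|]. rewrite <- D.
  replace Q with (Cexp (PI * Ci * tau / 4) ^ 4) at 1; [ring|].
  unfold Q. rewrite Cexp_pow. f_equal. simpl. rewrite !RtoC_plus. field.
Qed.

(** Gauss's formulas turn both sides into [256 q] times the same eta product, and exponentials do
    not vanish. *)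
Lemma theta_hT : theta2 tau ^ 8 = -4 * hT q * (theta3 tau * theta4 tau) ^ 4 /\ theta3 tau * theta4 tau <> 0.
Proof.
  rewrite theta3_phi, theta4_phi, theta2_psi2, (phi_mult_neg Q Q_lt1), Q_sqr, (phi_neg q q_lt1), (psi2_gauss q q_lt1).
  split; [|now apply Cpow_nz, Cexp_neq0].
  set (x := elog (q ^ 2)). set (z := elog q).
  transitivity (256 * (Cexp (PI * Ci * tau / 4) ^ 8 * Cexp (z - 2 * x) ^ 8)); [ring|].
  assert (E : Cexp (PI * Ci * tau / 4) ^ 8 = q).
  { unfold q, nome. rewrite Cexp_pow. f_equal. simpl. rewrite !RtoC_plus. field. }
  rewrite E. unfold hT. fold x z.
  replace ((Cexp (x - 2 * z) ^ 2) ^ 4) with (Cexp (x - 2 * z) ^ 8) by ring.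
  rewrite !Cexp_pow.
  transitivity (256 * (q * Cexp (24 * (z - x) + RtoC (INR 8) * (x - 2 * z)))); [|rewrite Cexp_plus; ring].
  do 3 f_equal. simpl. rewrite !RtoC_plus. ring.
Qed.

(** Only the square of [theta3 ^ 4 + theta4 ^ 4] matters; by Jacobi's relation it is
    [theta2 ^ 8 + 4 (theta3 theta4) ^ 4], hence a multiple of [(theta3 theta4) ^ 4] by
    [theta_hT]. *)
Lemma v_haupt_hT : v_haupt tau = (1 - hT q) ^ 2 / (-4 * hT q).
Proof.
  destruct theta_hT as [E N]. pose proof theta_jacobi as J.
  pose proof (hT_neq0 q (nome_neq0 tau)) as Nt.
  assert (N3 : theta3 tau <> 0) by (intros E0; apply N; rewrite E0; ring).
  assert (N4 : theta4 tau <> 0) by (intros E0; apply N; rewrite E0; ring).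
  assert (N2 : theta2 tau <> 0).
  { intros E0. rewrite E0 in E. assert (Z : -4 * hT q * (theta3 tau * theta4 tau) ^ 4 <> 0).
    - apply Cmult_neq_0; [|now apply Cpow_nz]. apply Cmult_neq_0; auto. apply (RtoC_IZR_neq0 (-4)). lia.
    - apply Z. rewrite <- E. ring. }
  unfold v_haupt. set (x2 := theta2 tau) in *. set (x3 := theta3 tau) in *. set (x4 := theta4 tau) in *.
  assert (S : (x3 ^ 4 + x4 ^ 4) ^ 2 = 4 * (x3 * x4) ^ 4 * (1 - hT q)).
  { transitivity ((x3 ^ 4 - x4 ^ 4) ^ 2 + 4 * (x3 * x4) ^ 4); [ring|]. rewrite J.
    transitivity (x2 ^ 8 + 4 * (x3 * x4) ^ 4); [ring|]. rewrite E. ring. }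
  transitivity (/ 16 * (((x3 ^ 4 + x4 ^ 4) ^ 2) ^ 2 / (x2 ^ 8 * (x3 * x4) ^ 4))).
  { field. auto. }
  rewrite S, E. field. auto.
Qed.

Lemma eta_ratio : t_haupt tau = / hT q.
Proof.
  pose proof q_lt1 as Hq. pose proof (Cmod_sqr_lt1 _ Hq) as Hq2.
  assert (En : nome (2 * tau) = q ^ 2).
  { unfold q, nome. rewrite Cexp_pow. f_equal. simpl. rewrite RtoC_plus. ring. }
  unfold t_haupt, eta. rewrite En. fold q. rewrite (CProd_elog q Hq), (CProd_elog (q ^ 2) Hq2).
  rewrite <- !Cexp_plus, <- Cexp_minus, Cexp_pow.
  replace (RtoC (INR 24) * (2 * PI * Ci * tau / 24 + - elog q - (2 * PI * Ci * (2 * tau) / 24 + - elog (q ^ 2))))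
    with (- (2 * PI * Ci * tau + 24 * (elog q - elog (q ^ 2)))).
  2:{ replace (RtoC (INR 24)) with (RtoC 24) by (f_equal; simpl; ring). field. }
  rewrite Cexp_opp, Cexp_plus. fold (nome tau). fold q. unfold hT.
  pose proof (nome_neq0 tau). pose proof (Cexp_neq0 (24 * (elog q - elog (q ^ 2)))). fold q in H.
  field. auto.
Qed.

End Theta.

(** * The Lipschitz formula *)

Lemma clim_norm_le u s M : clim u s -> (forall n, (Cmod (u n) <= M)%R) -> (Cmod s <= M)%R.
Proof.
  intros Hu HM. apply Rnot_lt_le. intros Hlt.
  destruct (Hu (Cmod s - M)%R) as (N & HN); [lra|]. specialize (HN N (le_n _)). specialize (HM N).
  assert (Cmod s <= Cmod (u N) + Cmod (u N - s))%R; [|lra].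
  replace s with (u N + - (u N - s)) at 1 by ring.
  eapply Rle_trans; [apply Cmod_triangle|]. rewrite Cmod_opp; lra.
Qed.

Lemma clim_const c : clim (fun _ => c) c.
Proof.
  intros eps He. exists 0%nat. intros n _. replace (c - c) with (RtoC 0) by ring. now rewrite Cmod_0.
Qed.

Lemma clim_finite_sum {I : Type} (F : nat -> I -> C) G (l : list I) :
  (forall i, clim (fun j => F j i) (G i)) -> clim (fun j => lsum (F j) l) (lsum G l).
Proof.
  intros H. induction l; simpl; [apply clim_const|]. now apply clim_plus.
Qed.

Lemma summable_tail {I : Type} (b : I -> C) eps : summable b -> (0 < eps)%R ->
  exists l0, NoDup l0 /\ forall r, NoDup r -> (forall i, In i r -> ~ In i l0) ->
    (lsumR (fun i => Cmod (b i)) r <= eps)%R.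
Proof.
  intros (M & HM) He.
  destruct (has_sum_nonneg (fun i => Cmod (b i)) M) as (s & Hs); auto.
  { intros; apply Cmod_ge_0. }
  destruct (Hs (eps / 2)%R) as (l0 & Hl0 & H); [lra|].
  exists l0; split; auto. intros r Hr Hdis.
  assert (E : forall l, lsum (fun i => RtoC (Cmod (b i))) l = RtoC (lsumR (fun i => Cmod (b i)) l)).
  { induction l; simpl; auto. now rewrite IHl, RtoC_plus. }
  assert (A := H l0 Hl0 (incl_refl _)).
  assert (B := H (r ++ l0)). rewrite E, <- RtoC_minus, Cmod_R in A.
  rewrite E, <- RtoC_minus, Cmod_R, lsumR_app in B.
  assert (B' : (Rabs (lsumR (fun i => Cmod (b i)) r + lsumR (fun i => Cmod (b i)) l0 - s) < eps / 2)%R).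
  { apply B; [|intros i Hi; apply in_app_iff; auto].
    apply NoDup_app; auto. }
  apply Rabs_def2 in A. apply Rabs_def2 in B'. lra.
Qed.

Lemma has_sum_tail {I : Type} (F b : I -> C) s l0 eps : has_sum F s ->
  (forall i, (Cmod (F i) <= Cmod (b i))%R) -> (0 < eps)%R -> NoDup l0 ->
  (forall r, NoDup r -> (forall i, In i r -> ~ In i l0) -> (lsumR (fun i => Cmod (b i)) r <= eps)%R) ->
  (Cmod (s - lsum F l0) <= 2 * eps)%R.
Proof.
  intros Hs Hb He Hl0 Ht. destruct (Hs eps He) as (l1 & Hl1 & H).
  destruct (union_nodup l0 l1) as (l & Hl & I0 & I1).
  specialize (H l Hl I1).
  destruct (incl_split l0 l Hl0 Hl I0) as (r & Hr & Hp & Hin).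
  rewrite (lsum_perm _ _ _ Hp), lsum_app in H.
  assert (A : (Cmod (lsum F r) <= eps)%R).
  { eapply Rle_trans; [apply Cmod_lsum|]. eapply Rle_trans; [apply lsumR_le; intros; apply Hb|].
    apply Ht; auto. intros i Hi. apply Hin, Hi. }
  replace (s - lsum F l0) with (- (lsum F l0 + lsum F r - s) + lsum F r) by ring.
  eapply Rle_trans; [apply Cmod_triangle|]. rewrite Cmod_opp. lra.
Qed.

(** Dominated convergence for series: finitely many indices carry all but [eps] of the majorant,
    uniformly in [j]. All approximants have the same sum, as is the case for the rescaled
    multiplication formula. *)
Lemma tannery {I : Type} (F : nat -> I -> C) (G b : I -> C) s :
  summable b -> (forall j i, (Cmod (F j i) <= Cmod (b i))%R) ->
  (forall i, clim (fun j => F j i) (G i)) -> (forall j, has_sum (F j) s) -> has_sum G s.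
Proof.
  intros Sb Hb HG HF.
  assert (HGb : forall i, (Cmod (G i) <= Cmod (b i))%R).
  { intros i. apply (clim_norm_le _ _ _ (HG i)). auto. }
  destruct (summable_has_sum G (summable_le _ _ HGb Sb)) as (t & Ht).
  replace s with t; auto. apply NNPP; intros Hne.
  assert (Hd : (0 < Cmod (t - s))%R) by (now apply Cmod_gt_0, Cminus_eq_contra).
  (* The errors are [2 eps], [eps] and [2 eps], in total less than [6 eps]. *)
  set (eps := (Cmod (t - s) / 6)%R). assert (He : (0 < eps)%R) by (unfold eps; lra).
  destruct (summable_tail b eps Sb He) as (l0 & Hl0 & Htail).
  destruct (clim_finite_sum F G l0 HG eps He) as (N & HN). specialize (HN N (le_n _)).
  assert (A := has_sum_tail G b t l0 eps Ht HGb He Hl0 Htail).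
  assert (B := has_sum_tail (F N) b s l0 eps (HF N) (Hb N) He Hl0 Htail).
  assert (Cmod (t - s) <= Cmod (t - lsum G l0) + Cmod (lsum (F N) l0 - lsum G l0) + Cmod (s - lsum (F N) l0))%R.
  { replace (t - s) with ((t - lsum G l0) + - (lsum (F N) l0 - lsum G l0) + - (s - lsum (F N) l0)) by ring.
    eapply Rle_trans; [apply Cmod_triangle|]. rewrite Cmod_opp.
    apply Rplus_le_compat_r. eapply Rle_trans; [apply Cmod_triangle|]. rewrite Cmod_opp. lra. }
  unfold eps in *. lra.
Qed.

Lemma exp_lower s : (Rabs s * exp (- Rabs s) <= Rabs (1 - exp (- s)))%R.
Proof.
  destruct (Rle_lt_dec 0 s) as [Hs|Hs].
  - rewrite (Rabs_right s) by lra.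
    assert (H : (1 + s <= exp s)%R) by apply exp_ineq1_le.
    assert (E : (exp s * exp (- s) = 1)%R) by (rewrite <- exp_plus, Rplus_opp_r; apply exp_0).
    pose proof (exp_pos (- s)). rewrite Rabs_right; nra.
  - rewrite (Rabs_left s) by lra.
    assert (H : (1 + - s <= exp (- s))%R) by apply exp_ineq1_le.
    assert (E : (exp (- - s) <= 1)%R).
    { rewrite <- exp_0. destruct (Req_dec s 0); [subst; lra|]. left. apply exp_increasing. lra. }
    pose proof (exp_pos (- - s)). rewrite Rabs_left; nra.
Qed.

Lemma sin_lower x : (Rabs x <= PI / 2)%R -> (x * x / 4 <= sin x * sin x)%R.
Proof.
  intros Hx.
  assert (H : forall y, (0 <= y <= PI / 2)%R -> (y / 2 <= sin y)%R).
  { intros y Hy. pose proof PI_RGT_0.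
    destruct (sin_bound y 0) as [H1 _]; [lra|lra|].
    eapply Rle_trans; [|exact H1]. unfold sin_approx, sin_term. simpl.
    pose proof PI_4. assert (y <= 2)%R by lra.
    assert (Hpi : (y * y <= 3)%R).
    { pose proof PI2_3_2. assert (PI / 2 <= 8 / 5)%R; [|nra].
      (* PI <= 16/5 from cos(8/5) < 0 *)
      destruct (Rle_lt_dec (PI / 2) (8 / 5)); auto. exfalso.
      assert (0 < cos (8 / 5))%R by (apply cos_gt_0; lra).
      destruct (cos_bound (8 / 5) 0) as [_ H6]; [lra|lra|].
      unfold cos_approx, cos_term in H6. simpl in H6. lra. }
    replace (y * (y * (y * 1)))%R with (y * (y * y))%R by ring. nra. }
  destruct (Rle_lt_dec 0 x).
  - rewrite Rabs_right in Hx by lra. specialize (H x ltac:(lra)). nra.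
  - rewrite Rabs_left in Hx by lra. specialize (H (- x)%R ltac:(lra)). rewrite sin_neg in H. nra.
Qed.

(** In the strip the only zero is [w = 0]. With [w = u + i v] and [X = exp (-2 pi v)] the squared
    modulus is [(1 - X)^2 + 4 X sin^2 (pi u)]: the first term controls [v], the second [u]. The
    factor 3 is a lower bound for pi. *)
Lemma one_minus_Cexp_lower (w : C) Y : (Rabs (Re w) <= / 2)%R -> (Rabs (Im w) <= Y)%R ->
  (3 * exp (- (2 * PI * Y)) * Cmod w <= Cmod (1 - Cexp (2 * PI * Ci * w)))%R.
Proof.
  intros Hu HY. pose proof PI_RGT_0 as Hpi.
  assert (Hpi3 : (3 <= PI)%R) by (pose proof PI2_3_2; lra).
  assert (HY0 : (0 <= Y)%R) by (pose proof (Rabs_pos (Im w)); lra).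
  set (E := exp (- (2 * PI * Y))). assert (HE : (0 < E)%R) by apply exp_pos.
  assert (HE1 : (E <= 1)%R).
  { unfold E. rewrite <- exp_0. destruct (Req_dec Y 0) as [->|]; [right; f_equal; ring|].
    left. apply exp_increasing. nra. }
  apply Rsqr_incr_0_var; [|apply Cmod_ge_0]. unfold Rsqr.
  rewrite <- (nsq_Cmod (1 - Cexp (2 * PI * Ci * w))).
  replace (3 * E * Cmod w * (3 * E * Cmod w))%R with (9 * (E * E) * (Cmod w * Cmod w))%R by ring.
  rewrite <- nsq_Cmod.
  set (u := Re w) in *. set (v := Im w) in *.
  assert (H1 : Re (2 * PI * Ci * w) = (- (2 * PI * v))%R) by apply Re_2piI.
  assert (H2 : Im (2 * PI * Ci * w) = (2 * (PI * u))%R).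
  { unfold u. destruct w; simpl. ring. }
  unfold nsq. fold u v.
  replace (Re (1 - Cexp (2 * PI * Ci * w))) with (1 - exp (- (2 * PI * v)) * cos (2 * (PI * u)))%R.
  2:{ unfold Cexp. rewrite H1, H2. simpl. ring. }
  replace (Im (1 - Cexp (2 * PI * Ci * w))) with (- (exp (- (2 * PI * v)) * sin (2 * (PI * u))))%R.
  2:{ unfold Cexp. rewrite H1, H2. simpl. ring. }
  set (X := exp (- (2 * PI * v))). assert (HX : (0 < X)%R) by apply exp_pos.
  rewrite cos_2a_sin, sin_2a.
  pose proof (sin2_cos2 (PI * u)) as SC. unfold Rsqr in SC.
  assert (Hs := sin_lower (PI * u)).
  set (s := sin (PI * u)) in *. set (c := cos (PI * u)) in *.
  assert (Hs' : (PI * u * (PI * u) / 4 <= s * s)%R).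
  { apply Hs. rewrite Rabs_mult, (Rabs_right PI) by lra. nra. }
  replace ((1 - X * (1 - 2 * s * s)) * (1 - X * (1 - 2 * s * s)) + - (X * (2 * s * c)) * - (X * (2 * s * c)))%R
    with ((1 - X) * (1 - X) + 4 * X * (s * s) + 4 * X * X * (s * s) * (s * s + c * c - 1))%R by ring.
  rewrite SC, Rminus_diag, Rmult_0_r, Rplus_0_r.
  assert (HXE : (E <= X)%R).
  { unfold E, X. assert (- (2 * PI * Y) <= - (2 * PI * v))%R.
    { assert (v <= Y)%R by (pose proof (Rle_abs v); lra). nra. }
    destruct H; [left; now apply exp_increasing|right; now rewrite H]. }
  assert (Hlow : (2 * PI * Rabs v * E <= Rabs (1 - X))%R).
  { pose proof (exp_lower (2 * PI * v)) as L. fold X in L.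
    rewrite !Rabs_mult, (Rabs_right 2), (Rabs_right PI) in L by lra.
    eapply Rle_trans; [|exact L]. apply Rmult_le_compat_l.
    - pose proof (Rabs_pos v). nra.
    - unfold E. assert (- (2 * PI * Y) <= - (2 * PI * Rabs v))%R by nra.
      destruct H; [left; now apply exp_increasing|right; now rewrite H]. }
  assert (HvE : (4 * (PI * PI) * (v * v) * (E * E) <= (1 - X) * (1 - X))%R).
  { assert (Q : ((2 * PI * Rabs v * E) * (2 * PI * Rabs v * E) <= Rabs (1 - X) * Rabs (1 - X))%R).
    { apply Rmult_le_compat; auto; pose proof (Rabs_pos v); apply Rmult_le_pos; try lra; nra. }
    assert (Sq : forall t, (Rabs t * Rabs t = t * t)%R).
    { intros t. rewrite <- Rabs_mult. apply Rabs_right. nra. }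
    rewrite Sq in Q. rewrite <- (Sq v).
    replace (4 * (PI * PI) * (Rabs v * Rabs v) * (E * E))%R with (2 * PI * Rabs v * E * (2 * PI * Rabs v * E))%R by ring.
    exact Q. }
  assert (HuE : (9 * (u * u) * (E * E) <= 4 * X * (s * s))%R).
  { pose proof (Rle_0_sqr s) as Q1. pose proof (Rle_0_sqr u) as Q2. pose proof (Rle_0_sqr E) as Q3. unfold Rsqr in *.
    assert (9 * (u * u) <= PI * PI * (u * u))%R by (apply Rmult_le_compat_r; nra).
    assert (9 * (u * u) <= 4 * (s * s))%R by lra.
    assert (E * E <= X)%R by nra.
    apply Rle_trans with (4 * (s * s) * (E * E))%R; [apply Rmult_le_compat_r; auto|].
    replace (4 * X * (s * s))%R with (4 * (s * s) * X)%R by ring. apply Rmult_le_compat_l; nra. }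
  assert (Hv9 : (9 * (v * v) * (E * E) <= 4 * (PI * PI) * (v * v) * (E * E))%R).
  { apply Rmult_le_compat_r; [nra|]. apply Rmult_le_compat_r; nra. }
  nra.
Qed.

Lemma lsum_seq_shift (f : nat -> C) a n : lsum f (seq a n) = lsum (fun l => f (a + l)%nat) (seq 0 n).
Proof.
  revert a. induction n; intros a; [reflexivity|].
  rewrite seq_S, lsum_app, IHn, lsum_seq_S. simpl. ring.
Qed.

Lemma pow2_neq0 j : 2 ^ j <> 0 :> C.
Proof. apply Cpow_nz, (RtoC_IZR_neq0 2). lia. Qed.

Lemma Cexp_2piI_int (n : Z) : Cexp (2 * PI * Ci * RtoC (IZR n)) = 1.
Proof.
  assert (H : Cexp (2 * PI * Ci) = 1).
  { unfold Cexp. replace (Re (2 * PI * Ci)) with 0%R by (simpl; ring).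
    replace (Im (2 * PI * Ci)) with (2 * PI)%R by (simpl; ring).
    rewrite exp_0, cos_2PI, sin_2PI. unfold Cmult, RtoC; simpl. f_equal; ring. }
  assert (P : forall k : nat, Cexp (2 * PI * Ci * RtoC (INR k)) = 1).
  { intros k. rewrite (Cmult_comm _ (RtoC (INR k))), <- Cexp_pow, H. apply Cpow_1_l. }
  destruct (Z_le_dec 0 n) as [Hn|Hn].
  - rewrite <- (Z2Nat.id n Hn), <- INR_IZR_INZ. apply P.
  - replace n with (- Z.of_nat (Z.to_nat (- n)))%Z by lia. rewrite opp_IZR, <- INR_IZR_INZ, RtoC_opp.
    replace (2 * PI * Ci * - RtoC (INR (Z.to_nat (- n)))) with (- (2 * PI * Ci * RtoC (INR (Z.to_nat (- n))))) by ring.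
    rewrite Cexp_opp, P. field.
Qed.

Lemma Zpow2_nat j : Z.of_nat (2 ^ j) = (2 ^ Z.of_nat j)%Z.
Proof.
  induction j; [reflexivity|].
  rewrite Nat.pow_succ_r', Nat2Z.inj_mul, IHj, (Nat2Z.inj_succ j), Z.pow_succ_r by lia. reflexivity.
Qed.

Lemma Cinv_0 : / RtoC 0 = 0.
Proof. unfold Cinv, RtoC. simpl. unfold Rdiv. f_equal; ring. Qed.

Section Lipschitz.
Variables (k : nat) (num : C -> C) (cst : C).
Let h (x : C) : C := num x / (1 - x) ^ k.
Hypothesis num_1 : num 1 = cst.
Hypothesis num_cont : ccont num 1.
Hypothesis num_bounded : forall X : R, exists B : R, forall x, (Cmod x <= X)%R -> (Cmod (num x) <= B)%R.
Hypothesis doubling : forall y, y ^ 2 <> 1 -> h y + h (- y) = 2 ^ k * h (y ^ 2).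

Definition cis (w : C) : C := Cexp (2 * PI * Ci * w).

Lemma cis_sqr w : cis w ^ 2 = cis (2 * w).
Proof. unfold cis. rewrite Cexp_pow. f_equal. simpl. rewrite RtoC_plus. ring. Qed.

Lemma cis_half w : cis (w + / 2) = - cis w.
Proof.
  unfold cis. rewrite Cmult_plus_distr_l, Cexp_plus.
  replace (Cexp (2 * PI * Ci * / 2)) with (- (1)); [ring|].
  replace (2 * PI * Ci * / 2) with (PI * Ci) by field.
  unfold Cexp. replace (Re (PI * Ci)) with 0%R by (simpl; ring).
  replace (Im (PI * Ci)) with PI by (simpl; ring).
  rewrite exp_0, cos_PI, sin_PI. unfold Cmult, RtoC, Copp; simpl. f_equal; ring.
Qed.

Lemma cis_int w n : cis (w + RtoC (IZR n)) = cis w.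
Proof. unfold cis. rewrite Cmult_plus_distr_l, Cexp_plus, Cexp_2piI_int. ring. Qed.

(** Iterated doubling, with the [2^j] roots of [cis z] parametrised by [l]. It plays the part of the
    functional equation in Herglotz's treatment of the cotangent. *)
Lemma multiplication_formula z j : cis z <> 1 ->
  lsum (fun l => h (cis ((z + RtoC (INR l)) / 2 ^ j))) (seq 0 (2 ^ j)) = (2 ^ k) ^ j * h (cis z).
Proof.
  revert z. induction j; intros z Hz.
  - simpl. replace ((z + 0) / 1) with z by field. ring.
  - replace (2 ^ S j)%nat with (2 ^ j + 2 ^ j)%nat by (simpl; lia).
    rewrite seq_app, lsum_app, (lsum_seq_shift _ (0 + 2 ^ j)), <- lsum_plus.
    simpl Cpow at 3. rewrite <- Cmult_assoc, <- IHj by auto. rewrite <- lsum_scal.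
    apply lsum_ext. intros l _.
    replace ((z + RtoC (INR (0 + 2 ^ j + l))) / 2 ^ S j) with ((z + RtoC (INR l)) / 2 ^ S j + / 2).
    2:{ rewrite Nat.add_0_l, plus_INR, pow_INR, RtoC_plus, RtoC_pow. simpl INR. rewrite RtoC_plus.
        rewrite Cpow_S. pose proof (pow2_neq0 j) as N.
        replace (1 + 1) with (RtoC 2) by ring. field. auto. }
    rewrite cis_half.
    assert (E : cis ((z + RtoC (INR l)) / 2 ^ S j) ^ 2 = cis ((z + RtoC (INR l)) / 2 ^ j)).
    { rewrite cis_sqr. f_equal. rewrite Cpow_S. pose proof (pow2_neq0 j). field. auto. }
    rewrite <- E. apply doubling. rewrite E. intros E1. apply Hz.
    rewrite <- (cis_int z (Z.of_nat l)), <- INR_IZR_INZ.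
    replace (z + RtoC (INR l)) with (2 ^ j * ((z + RtoC (INR l)) / 2 ^ j)) by (field; apply pow2_neq0).
    assert (P : forall m w, cis w = 1 -> cis (2 ^ m * w) = 1).
    { intros m w Hw. induction m; [simpl; now rewrite Cmult_1_l|].
      rewrite Cpow_S, <- Cmult_assoc, <- cis_sqr, IHm. apply Cpow_1_l. }
    now apply P.
Qed.

(** The [2^(j+1)] terms are centred at 0 so that every fixed [n] eventually occurs and, for [Re z]
    in [[0, 1]], the arguments stay in the strip [|Re w| <= 1/2]. *)
Lemma has_sum_centered z j : cis z <> 1 ->
  has_sum (fun n : Z => if (Z_le_dec (- 2 ^ Z.of_nat j) n) then
     (if Z_lt_dec n (2 ^ Z.of_nat j) then h (cis ((z + RtoC (IZR n)) / 2 ^ S j)) / (2 ^ k) ^ S j else 0) else 0)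
    (h (cis z)).
Proof.
  intros Hz. set (f := fun n : Z => _).
  apply (has_sum_reindex (fun l => (Z.of_nat l - 2 ^ Z.of_nat j)%Z) f).
  - intros; lia.
  - intros n. unfold f. destruct Z_le_dec; [|tauto]. intros _. exists (Z.to_nat (n + 2 ^ Z.of_nat j)). lia.
  - assert (Hz' : cis (z - RtoC (IZR (2 ^ Z.of_nat j))) = cis z).
    { unfold Cminus. rewrite <- RtoC_opp, <- opp_IZR. apply cis_int. }
    assert (E : h (cis z) = lsum (fun l => f (Z.of_nat l - 2 ^ Z.of_nat j)%Z) (seq 0 (2 ^ S j))).
    { assert (N : (2 ^ k) ^ S j <> 0) by (apply Cpow_nz, pow2_neq0).
      rewrite <- Hz'.
      assert (Hm := multiplication_formula (z - RtoC (IZR (2 ^ Z.of_nat j))) (S j) ltac:(now rewrite Hz')).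
      replace (h (cis (z - RtoC (IZR (2 ^ Z.of_nat j))))) with
        (/ ((2 ^ k) ^ S j) * ((2 ^ k) ^ S j * h (cis (z - RtoC (IZR (2 ^ Z.of_nat j)))))) by (field; auto).
      rewrite <- Hm, <- lsum_scal. apply lsum_ext. intros l Hl. apply in_seq in Hl.
      unfold f.
      assert (P : (Z.of_nat (2 ^ S j) = 2 * 2 ^ Z.of_nat j)%Z).
      { rewrite Nat.pow_succ_r', Nat2Z.inj_mul, Zpow2_nat. reflexivity. }
      destruct Z_le_dec; [|lia]. destruct Z_lt_dec; [|lia].
      rewrite minus_IZR, <- INR_IZR_INZ, RtoC_minus.
      replace (z - RtoC (IZR (2 ^ Z.of_nat j)) + RtoC (INR l)) with (z + (RtoC (INR l) - RtoC (IZR (2 ^ Z.of_nat j)))) by ring.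
      field. auto. }
    rewrite E. apply has_sum_finite; [apply seq_NoDup|]. intros l Hl. unfold f.
    destruct Z_le_dec; auto. destruct Z_lt_dec; auto. exfalso. apply Hl, in_seq.
    assert (P : (Z.of_nat (2 ^ S j) = 2 * 2 ^ Z.of_nat j)%Z).
    { rewrite Nat.pow_succ_r', Nat2Z.inj_mul, Zpow2_nat. reflexivity. }
    lia.
Qed.

Lemma half_pow_lim a : clim (fun j => a / 2 ^ S j) 0.
Proof.
  intros eps He. pose proof (Cmod_ge_0 a).
  destruct (pow_lt_1_zero (/ 2)) with (y := (eps / (Cmod a + 1))%R) as (N & HN).
  { rewrite Rabs_right; lra. }
  { apply Rdiv_lt_0_compat; lra. }
  exists N. intros n Hn. replace (a / 2 ^ S n - 0) with (a / 2 ^ S n) by ring.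
  rewrite Cmod_div, Cmod_pow, Cmod_R, Rabs_right by (try apply pow2_neq0; lra).
  specialize (HN (S n) ltac:(lia)). rewrite Rabs_right in HN by (apply Rle_ge, pow_le; lra).
  rewrite pow_inv in HN. apply Rlt_div_r in HN; [|lra].
  unfold Rdiv. assert (0 < / 2 ^ S n)%R by (apply Rinv_0_lt_compat, pow_lt; lra). nra.
Qed.

(** To first order [1 - cis w] is [-2 pi i w]; the [k]-th power of the denominator of [w] cancels
    the normalising power of 2. *)
Lemma scaled_limit (a : C) : a <> 0 ->
  clim (fun j => h (cis (a / 2 ^ S j)) / (2 ^ k) ^ S j) (cst / (- (2 * PI * Ci * a)) ^ k).
Proof.
  intros Ha.
  destruct (cderiv_Cexp 0) as (ph & Hph & E0 & Cph). rewrite Cexp_0 in E0.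
  set (w := fun j => a / 2 ^ S j).
  assert (N : forall j, 2 ^ S j <> 0 :> C) by (intros; apply pow2_neq0).
  assert (H2 : 2 * PI * Ci <> 0).
  { apply Cmult_neq_0; [apply Cmult_neq_0|apply Ci_nz]; [apply (RtoC_IZR_neq0 2); lia|].
    intros E. apply RtoC_inj in E. pose proof PI_RGT_0. lra. }
  assert (L0 : clim (fun j => 2 * PI * Ci * w j) 0).
  { replace (RtoC 0) with (2 * PI * Ci * 0) by ring. apply clim_scal, half_pow_lim. }
  assert (Ex : forall j, 1 - cis (w j) = - (ph (2 * PI * Ci * w j) * (2 * PI * Ci * a) / 2 ^ S j)).
  { intros j. unfold cis. rewrite (Hph (2 * PI * Ci * w j)), Cexp_0.
    unfold w at 2. unfold Cminus, Cdiv. ring. }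
  apply (clim_ext (fun j => num (cis (w j)) * / ((- (ph (2 * PI * Ci * w j) * (2 * PI * Ci * a))) ^ k))).
  - intros j. unfold h. fold (w j). rewrite Ex.
    replace (- (ph (2 * PI * Ci * w j) * (2 * PI * Ci * a) / 2 ^ S j)) with
      (- (ph (2 * PI * Ci * w j) * (2 * PI * Ci * a)) * / 2 ^ S j) by (unfold Cdiv; ring).
    rewrite Cpow_mult_l, Cpow_inv by auto.
    rewrite <- !Cpow_mult_r, (Nat.mul_comm (S j) k).
    unfold Cdiv.
    set (A := (- (ph (2 * PI * Ci * w j) * (2 * PI * Ci * a))) ^ k).
    assert (NP : 2 ^ (k * S j) <> 0 :> C) by apply pow2_neq0.
    (* For small [j] the slope [ph] might vanish; both sides are then 0 by the convention for
       [/ 0]. *)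
    destruct (Ceq_dec A 0) as [EA|NA].
    + rewrite EA. replace (0 * / 2 ^ (k * S j)) with (RtoC 0) by ring.
      rewrite Cinv_0. ring.
    + field. auto.
  - unfold Cdiv.
    assert (C1 : ccont (fun y => num (Cexp y)) 0).
    { apply (ccont_comp num Cexp); [rewrite Cexp_0; apply num_cont|apply Cexp_cont]. }
    assert (C2 : ccont (fun y => num (Cexp y) * / (- (ph y * (2 * PI * Ci * a))) ^ k) 0).
    { apply ccont_mult; auto. apply ccont_inv.
      - apply ccont_pow, ccont_opp, ccont_mult; auto. apply ccont_const.
      - apply Cpow_nz. rewrite E0. intros E.
        assert (E2 : 2 * PI * Ci * a = 0) by (rewrite <- (Cmult_1_l (2 * PI * Ci * a)); transitivity (- - (1 * (2 * PI * Ci * a))); [ring|rewrite E; ring]).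
        exact (Cmult_neq_0 _ _ H2 Ha E2). }
    assert (R := clim_comp _ _ _ C2 L0). cbv beta in R.
    rewrite Cexp_0, num_1, E0, Cmult_1_l in R. exact R.
Qed.

(** Tannery's theorem for the centred formula: [one_minus_Cexp_lower] bounds every term by a fixed
    multiple of [|z + n| ^ (-k)]. *)
Lemma lipschitz_strip z : (0 <= Re z <= 1)%R -> cis z <> 1 ->
  (forall n : Z, z + RtoC (IZR n) <> 0) ->
  summable (fun n : Z => / (z + RtoC (IZR n)) ^ k) ->
  has_sum (fun n : Z => cst / (- (2 * PI * Ci * (z + RtoC (IZR n)))) ^ k) (h (cis z)).
Proof.
  intros Hre Hz Hn Hs.
  set (Y := Rabs (Im z)). set (e := (3 * exp (- (2 * PI * Y)))%R).
  assert (He : (0 < e)%R) by (pose proof (exp_pos (- (2 * PI * Y))); unfold e; lra).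
  destruct (num_bounded (exp (2 * PI * Y))) as (B & HB).
  assert (HB0 : (0 <= B)%R).
  { eapply Rle_trans; [apply (Cmod_ge_0 (num 0))|apply HB]. rewrite Cmod_0. left; apply exp_pos. }
  apply (tannery (fun j (n : Z) => if (Z_le_dec (- 2 ^ Z.of_nat j) n) then
     (if Z_lt_dec n (2 ^ Z.of_nat j) then h (cis ((z + RtoC (IZR n)) / 2 ^ S j)) / (2 ^ k) ^ S j else 0) else 0)
    _ (fun n => RtoC (B / e ^ k) * / (z + RtoC (IZR n)) ^ k)).
  - now apply summable_scal.
  - intros j n.
    destruct Z_le_dec as [H1|]; [|rewrite Cmod_0; apply Cmod_ge_0].
    destruct Z_lt_dec as [H2|]; [|rewrite Cmod_0; apply Cmod_ge_0].
    set (a := z + RtoC (IZR n)) in *. assert (Ha : a <> 0) by apply Hn.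
    set (w := a / 2 ^ S j).
    assert (P2 : (0 < 2 ^ S j)%R) by (apply pow_lt; lra).
    assert (Ew : w = RtoC (/ 2 ^ S j) * a).
    { unfold w. rewrite RtoC_inv, RtoC_pow by lra. unfold Cdiv. ring. }
    assert (Eb : (IZR (2 ^ Z.of_nat j) * 2 = 2 ^ S j)%R).
    { rewrite <- pow_IZR. simpl. ring. }
    assert (P1 : (1 <= 2 ^ S j)%R) by (apply pow_R1_Rle; lra).
    assert (Hu : (Rabs (Re w) <= / 2)%R).
    { rewrite Ew, re_scal_l. unfold a. rewrite re_plus, re_RtoC.
      rewrite Rabs_mult, Rabs_right by (left; now apply Rinv_0_lt_compat).
      apply (Rmult_le_reg_l (2 ^ S j)); auto. rewrite <- Rmult_assoc, Rinv_r, Rmult_1_l by lra.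
      apply IZR_le in H1. rewrite opp_IZR in H1.
      assert (H3 : (n + 1 <= 2 ^ Z.of_nat j)%Z) by lia. apply IZR_le in H3. rewrite plus_IZR in H3.
      apply Rabs_le. lra. }
    assert (Hv : (Rabs (Im w) <= Y)%R).
    { rewrite Ew, im_scal_l. unfold a. rewrite im_plus, im_RtoC, Rplus_0_r.
      rewrite Rabs_mult, Rabs_right by (left; now apply Rinv_0_lt_compat). fold Y.
      assert (/ 2 ^ S j <= 1)%R by (rewrite <- Rinv_1; apply Rinv_le_contravar; lra).
      pose proof (Rabs_pos (Im z)). fold Y in H0. nra. }
    assert (L := one_minus_Cexp_lower w Y Hu Hv). fold e in L. fold (cis w) in L.
    assert (Hw0 : w <> 0).
    { unfold w. intros E0. apply Ha. replace a with (a / 2 ^ S j * 2 ^ S j) by (field; apply pow2_neq0). rewrite E0. ring. }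
    pose proof (proj1 (Cmod_gt_0 _) Hw0) as Hwp.
    assert (Hd0 : 1 - cis w <> 0) by (apply Cmod_gt_0; nra).
    assert (Hx : (Cmod (cis w) <= exp (2 * PI * Y))%R).
    { unfold cis. rewrite Cmod_Cexp, Re_2piI.
      assert (- (2 * PI * Im w) <= 2 * PI * Y)%R.
      { pose proof (Rle_abs (- Im w)). rewrite Rabs_Ropp in H. pose proof PI_RGT_0. nra. }
      destruct H; [left; now apply exp_increasing|right; now rewrite H]. }
    unfold h. rewrite !Cmod_div, !Cmod_mult, !Cmod_pow by (try apply Cpow_nz; auto; apply pow2_neq0).
    rewrite Cmod_inv, Cmod_pow by now apply Cpow_nz.
    rewrite !Cmod_R, (Rabs_right 2), (Rabs_right (B / e ^ k)).
    2:{ apply Rle_ge. apply Rmult_le_pos; auto. left. apply Rinv_0_lt_compat, pow_lt; auto. }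
    2:{ lra. }
    assert (Ea : Cmod a = (Cmod w * 2 ^ S j)%R).
    { rewrite Ew, Cmod_mult, Cmod_R, Rabs_right by (left; now apply Rinv_0_lt_compat). field. lra. }
    rewrite Ea, Rpow_mult_distr.
    replace ((2 ^ k) ^ S j)%R with ((2 ^ S j) ^ k)%R by (rewrite <- !pow_mult; f_equal; lia).
    replace (B / e ^ k * / (Cmod w ^ k * (2 ^ S j) ^ k))%R with (B * / (e * Cmod w) ^ k / (2 ^ S j) ^ k)%R.
    2:{ rewrite Rpow_mult_distr. field. repeat split; apply pow_nonzero; lra. }
    unfold Rdiv. apply Rmult_le_compat_r; [left; apply Rinv_0_lt_compat; now apply pow_lt|].
    apply Rmult_le_compat; [apply Cmod_ge_0| |now apply HB|].
    + left. apply Rinv_0_lt_compat, pow_lt. now apply Cmod_gt_0.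
    + apply Rinv_le_contravar; [apply pow_lt; nra|]. apply pow_incr. split; [nra|auto].
  - intros n.
    intros eps Heps. destruct (scaled_limit (z + RtoC (IZR n)) (Hn n) eps Heps) as (N & HN).
    exists (max N (Z.to_nat (Z.abs n))). intros j Hj. specialize (HN j ltac:(lia)).
    assert (Hbig : (Z.of_nat j < 2 ^ Z.of_nat j)%Z) by (apply Z.pow_gt_lin_r; lia).
    destruct Z_le_dec; [|lia]. destruct Z_lt_dec; [|lia]. exact HN.
  - intros j. now apply has_sum_centered.
Qed.

Lemma lipschitz z : cis z <> 1 -> (forall n : Z, z + RtoC (IZR n) <> 0) ->
  summable (fun n : Z => / (z + RtoC (IZR n)) ^ k) ->
  has_sum (fun n : Z => cst / (- (2 * PI * Ci * (z + RtoC (IZR n)))) ^ k) (h (cis z)).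
Proof.
  intros Hz Hn Hs.
  (* The translate by [m] has real part in [[0, 1]], and neither side changes under integer
     translation. *)
  set (m := (1 - up (Re z))%Z).
  assert (Ez : forall n, z + RtoC (IZR m) + RtoC (IZR n) = z + RtoC (IZR (n + m))).
  { intros n. rewrite plus_IZR, RtoC_plus. ring. }
  assert (H : has_sum (fun n : Z => cst / (- (2 * PI * Ci * (z + RtoC (IZR m) + RtoC (IZR n)))) ^ k) (h (cis (z + RtoC (IZR m))))).
  { apply lipschitz_strip.
    - rewrite re_plus, re_RtoC. unfold m. rewrite minus_IZR. destruct (archimed (Re z)). lra.
    - now rewrite cis_int.
    - intros n. rewrite Ez. apply Hn.
    - apply (summable_ext (fun n => / (z + RtoC (IZR (n + m))) ^ k)); [intros n; now rewrite Ez|].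
      apply (summable_inj (fun n => (n + m)%Z) (fun n : Z => / (z + RtoC (IZR n)) ^ k)); auto. intros; lia. }
  rewrite cis_int in H.
  apply (has_sum_reindex (fun n => (n + m)%Z)).
  - intros; lia.
  - intros i _. exists (i - m)%Z. lia.
  - eapply has_sum_ext; [|exact H]. intros n. cbv beta. now rewrite Ez.
Qed.

End Lipschitz.

(** * Modular transformation of Eisenstein series *)

Lemma has_sum_euler_step k (f g : C -> C) :
  (forall x, (Cmod x < 1)%R -> has_sum (fun n => RtoC (INR n) ^ k * x ^ n) (f x)) ->
  (forall x, (Cmod x < 1)%R -> eulerD f x (g x)) ->
  forall x, (Cmod x < 1)%R -> has_sum (fun n => RtoC (INR n) ^ S k * x ^ n) (g x).
Proof.
  intros Hf Hg x Hx.
  destruct (gps_deriv_D (fun n => RtoC (INR n) ^ k) (fun n => n) f) with (z := x) as (l & Hl & Hs); auto.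
  - intros r Hr. apply (summable_poly_geom _ k 1 r Hr). intros n.
    rewrite Cmod_mult, !Cmod_pow, Cmod_INR, Cmod_R, (Rabs_right r), Rmult_1_l by lra.
    apply Rmult_le_compat_r; [apply pow_le; lra|]. apply pow_incr.
    split; [apply pos_INR|apply le_INR; lia].
  - replace (g x) with (x * l).
    + eapply has_sum_ext; [|exact Hs]. intros n. cbv beta. rewrite (Cpow_S _ k). ring.
    + apply (eulerD_unique f x); auto. exists l. auto.
Qed.

(** [eul4] and [eul6] are the numerators of the sums of [n^3 x^n] and [n^5 x^n], that is, [x] times
    Eulerian polynomials; their values at 1 are [3!] and [5!]. *)
Definition eul4 (x : C) : C := x * (1 + 4 * x + x * x).
Definition eul6 (x : C) : C := x * (1 + 26 * x + 66 * (x * x) + 26 * (x * x * x) + x * x * x * x).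

Lemma eulerD_rational (a da : C -> C) k x : (Cmod x < 1)%R -> cderiv a x (da x) ->
  eulerD (fun y => a y / (1 - y) ^ S k) x
    (x * (da x * (1 - x) + RtoC (INR (S k)) * a x) / (1 - x) ^ S (S k)).
Proof.
  intros Hx Ha. pose proof (one_minus_neq0 x Hx) as N.
  assert (P : forall j, cderiv (fun y => (1 - y) ^ j) x (- (RtoC (INR j) * (1 - x) ^ j / (1 - x)))).
  { induction j.
    - simpl. eapply cderiv_eq; [apply cderiv_const|]. unfold Cdiv. ring.
    - apply (cderiv_ext (fun y => (1 - y) * (1 - y) ^ j)); [intros; reflexivity|].
      eapply cderiv_eq; [apply cderiv_mult; [apply cderiv_minus; [apply cderiv_const|apply cderiv_id]|apply IHj]|].
      cbv beta. rewrite S_INR, RtoC_plus, Cpow_S. field. auto. }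
  eexists. split.
  - apply cderiv_div; [exact Ha|apply P|now apply Cpow_nz].
  - cbv beta. rewrite (Cpow_S _ (S k)). assert (N2 : (1 - x) ^ S k <> 0) by now apply Cpow_nz.
    set (d := (1 - x) ^ S k) in *. field. auto.
Qed.

Ltac cd := repeat first [apply cderiv_plus | apply cderiv_mult | apply cderiv_const | apply cderiv_id].

Lemma eulerian_sums x : (Cmod x < 1)%R ->
  has_sum (fun n => RtoC (INR n) ^ 3 * x ^ n) (eul4 x / (1 - x) ^ 4) /\
  has_sum (fun n => RtoC (INR n) ^ 5 * x ^ n) (eul6 x / (1 - x) ^ 6).
Proof.
  assert (S0 : forall x, (Cmod x < 1)%R -> has_sum (fun n => RtoC (INR n) ^ 0 * x ^ n) (1 / (1 - x) ^ 1)).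
  { intros y Hy. pose proof (one_minus_neq0 y Hy).
    replace (1 / (1 - y) ^ 1) with (/ (1 - y)) by (field; auto).
    eapply has_sum_ext; [|apply has_sum_geom, Hy]. intros; simpl; ring. }
  assert (S1 := has_sum_euler_step 0 _ (fun x => x / (1 - x) ^ 2) S0).
  assert (S2 := fun H => has_sum_euler_step 1 _ (fun x => (x * (1 + x)) / (1 - x) ^ 3) (S1 H)).
  assert (S3 := fun H H' => has_sum_euler_step 2 _ (fun x => eul4 x / (1 - x) ^ 4) (S2 H H')).
  assert (S4 := fun H H' H2 => has_sum_euler_step 3 _ (fun x => (x * (1 + 11 * x + 11 * (x * x) + x * x * x)) / (1 - x) ^ 5) (S3 H H' H2)).
  assert (S5 := fun H H' H2 H3 => has_sum_euler_step 4 _ (fun x => eul6 x / (1 - x) ^ 6) (S4 H H' H2 H3)).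
  assert (Q1 : forall x, (Cmod x < 1)%R -> eulerD (fun x => 1 / (1 - x) ^ 1) x (x / (1 - x) ^ 2)).
  { intros y Hy. eapply eulerD_eq; [apply (eulerD_rational (fun _ => 1) (fun _ => 0)); auto; apply cderiv_const|].
    rewrite INR_IZR_INZ; simpl Z.of_nat; cbv beta. f_equal. ring. }
  assert (Q2 : forall x, (Cmod x < 1)%R -> eulerD (fun x => x / (1 - x) ^ 2) x ((x * (1 + x)) / (1 - x) ^ 3)).
  { intros y Hy. eapply eulerD_eq; [apply (eulerD_rational (fun y => y) (fun _ => 1)); auto; apply cderiv_id|].
    rewrite INR_IZR_INZ; simpl Z.of_nat; cbv beta. f_equal. ring. }
  assert (Q3 : forall x, (Cmod x < 1)%R -> eulerD (fun x => (x * (1 + x)) / (1 - x) ^ 3) x (eul4 x / (1 - x) ^ 4)).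
  { intros y Hy. eapply eulerD_eq; [apply (eulerD_rational (fun y => y * (1 + y)) (fun y => 1 * (1 + y) + y * (0 + 1))); auto; cd|].
    rewrite INR_IZR_INZ; simpl Z.of_nat; cbv beta. unfold eul4. f_equal. ring. }
  assert (Q4 : forall x, (Cmod x < 1)%R -> eulerD (fun x => eul4 x / (1 - x) ^ 4) x ((x * (1 + 11 * x + 11 * (x * x) + x * x * x)) / (1 - x) ^ 5)).
  { intros y Hy. eapply eulerD_eq; [apply (eulerD_rational eul4 (fun y => 1 + 8 * y + 3 * (y * y))); auto|].
    { eapply cderiv_eq; [unfold eul4; cd|cbv beta; ring]. }
    rewrite INR_IZR_INZ; simpl Z.of_nat; cbv beta. unfold eul4. f_equal. ring. }
  assert (Q5 : forall x, (Cmod x < 1)%R -> eulerD (fun x => (x * (1 + 11 * x + 11 * (x * x) + x * x * x)) / (1 - x) ^ 5) x (eul6 x / (1 - x) ^ 6)).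
  { intros y Hy. eapply eulerD_eq; [apply (eulerD_rational (fun y => y * (1 + 11 * y + 11 * (y * y) + y * y * y))
      (fun y => 1 + 22 * y + 33 * (y * y) + 4 * (y * y * y))); auto|].
    { eapply cderiv_eq; [cd|cbv beta; ring]. }
    rewrite INR_IZR_INZ; simpl Z.of_nat; cbv beta. unfold eul6. f_equal. ring. }
  intros Hx. split; [apply S3|apply S5]; auto.
Qed.

Definition loc_bounded (f : C -> C) : Prop :=
  forall X : R, exists B : R, forall x, (Cmod x <= X)%R -> (Cmod (f x) <= B)%R.

Lemma loc_bounded_const c : loc_bounded (fun _ => c).
Proof. intros X. exists (Cmod c). intros; lra. Qed.

Lemma loc_bounded_id : loc_bounded (fun x => x).
Proof. intros X. exists X. auto. Qed.

Lemma loc_bounded_plus f g : loc_bounded f -> loc_bounded g -> loc_bounded (fun x => f x + g x).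
Proof.
  intros Hf Hg X. destruct (Hf X) as (B & HB). destruct (Hg X) as (B' & HB').
  exists (B + B')%R. intros x Hx. eapply Rle_trans; [apply Cmod_triangle|].
  specialize (HB x Hx). specialize (HB' x Hx). lra.
Qed.

Lemma loc_bounded_mult f g : loc_bounded f -> loc_bounded g -> loc_bounded (fun x => f x * g x).
Proof.
  intros Hf Hg X. destruct (Hf X) as (B & HB). destruct (Hg X) as (B' & HB').
  exists (B * B')%R. intros x Hx. rewrite Cmod_mult. apply Rmult_le_compat; auto; apply Cmod_ge_0.
Qed.

(** * Summability over the lattice *)

Lemma inv_sqr_summable : summable (fun n => RtoC (/ (INR (S n) * INR (S n)))).
Proof.
  assert (P : forall n, (0 < INR (S n))%R) by (intros; apply lt_0_INR; lia).
  exists 2%R. intros l Hl.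
  apply (nat_lsum_bound (fun n => Cmod (RtoC (/ (INR (S n) * INR (S n)))))); auto.
  - intros; apply Cmod_ge_0.
  (* A telescoping majorant: [1/x^2 <= 2/x - 2/(x+1)] for [x >= 1]. *)
  - intros n. assert (A : (lsumR (fun n => Cmod (RtoC (/ (INR (S n) * INR (S n))))) (seq 0 n) <= 2 - 2 / INR (S n))%R).
    { induction n; [simpl; lra|].
      assert (St : forall f : nat -> R, lsumR f (seq 0 (S n)) = (lsumR f (seq 0 n) + f n)%R).
      { intros f. rewrite seq_S, lsumR_app. cbn. ring. }
      rewrite St. cbv beta. assert (Pos : (0 < INR (S n) * INR (S n))%R) by (apply Rmult_lt_0_compat; apply P).
      rewrite (Cmod_R (/ (INR (S n) * INR (S n)))), Rabs_right by (apply Rle_ge; left; now apply Rinv_0_lt_compat).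
      pose proof (P n) as Pn. rewrite (S_INR (S n)). set (x := INR (S n)) in *.
      assert (1 <= x)%R by (unfold x; rewrite S_INR; pose proof (pos_INR n); lra).
      assert (/ (x * x) <= 2 / x - 2 / (x + 1))%R; [|lra].
      replace (2 / x - 2 / (x + 1))%R with (2 / (x * (x + 1)))%R by (field; lra).
      apply (Rmult_le_reg_r (x * x * (x + 1))); [nra|].
      replace (/ (x * x) * (x * x * (x + 1)))%R with (x + 1)%R by (field; lra).
      replace (2 / (x * (x + 1)) * (x * x * (x + 1)))%R with (2 * x)%R by (field; lra). lra. }
    assert (0 < 2 / INR (S n))%R by (apply Rdiv_lt_0_compat; [lra|apply P]). lra.
Qed.

(** A product of two such weights dominates lattice terms of degree at least 4: if [M >= 1] is the
    larger of [|m|] and [|n|], the product is at least [1 / (16 M^4)]. *)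
Definition zwt (n : Z) : C := RtoC (/ ((1 + Rabs (IZR n)) * (1 + Rabs (IZR n)))).

Lemma zwt_summable : summable zwt.
Proof.
  assert (P : forall n, (0 < INR (S n))%R) by (intros; apply lt_0_INR; lia).
  apply summable_Z; apply (summable_le _ _) with (2 := inv_sqr_summable); intros n; unfold zwt.
  - rewrite <- INR_IZR_INZ, (Rabs_right (INR n)), S_INR by (apply Rle_ge, pos_INR). right. do 2 f_equal. f_equal; f_equal; ring.
  - rewrite opp_IZR, <- INR_IZR_INZ, Rabs_Ropp, (Rabs_right (INR (S n))) by (apply Rle_ge, pos_INR).
    rewrite !Cmod_R. pose proof (P n). rewrite !Rabs_right.
    + apply Rinv_le_contravar; nra.
    + apply Rle_ge; left; apply Rinv_0_lt_compat; nra.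
    + apply Rle_ge; left; apply Rinv_0_lt_compat; nra.
Qed.

(** For [k > 0] the term at the origin is 0 by the convention for [/ 0], so the sum runs over the
    full lattice. *)
Definition lat (k : nat) (tau : C) (p : Z * Z) : C :=
  / (RtoC (IZR (fst p)) * tau + RtoC (IZR (snd p))) ^ k.

Lemma lattice_lower tau : (0 < Im tau)%R -> exists c, (0 < c <= 1)%R /\ forall m n : Z, (m, n) <> (0, 0)%Z ->
  (c * Rmax (Rabs (IZR m)) (Rabs (IZR n)) <= Cmod (RtoC (IZR m) * tau + RtoC (IZR n)))%R /\
  (1 <= Rmax (Rabs (IZR m)) (Rabs (IZR n)))%R.
Proof.
  intros Ht. set (y := Im tau) in *. set (T := Cmod tau). assert (HT : (0 <= T)%R) by apply Cmod_ge_0.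
  set (c := Rmin 1 (Rmin y (/ (1 + T / y)))).
  assert (Hty : (0 <= T / y)%R) by (apply Rmult_le_pos; auto; left; now apply Rinv_0_lt_compat).
  assert (Hc : (0 < c)%R).
  { unfold c. repeat apply Rmin_glb_lt; auto; [lra|]. apply Rinv_0_lt_compat. lra. }
  assert (Hc1 : (c <= 1)%R) by apply Rmin_l.
  assert (Hcy : (c <= y)%R) by (eapply Rle_trans; [apply Rmin_r|apply Rmin_l]).
  assert (Hct : (c <= / (1 + T / y))%R) by (eapply Rle_trans; [apply Rmin_r|apply Rmin_r]).
  exists c. split; auto. intros m n Hmn. split.
  - set (w := RtoC (IZR m) * tau + RtoC (IZR n)).
    assert (Him : (Rabs (IZR m) * y <= Cmod w)%R).
    { replace (Rabs (IZR m) * y)%R with (Rabs (Im w)); [apply Cmod_Re_Im|].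
      unfold w. rewrite im_plus, im_scal_l, im_RtoC, Rplus_0_r, Rabs_mult. fold y. f_equal.
      apply Rabs_right. lra. }
    assert (Hn : (Rabs (IZR n) <= Cmod w * (1 + T / y))%R).
    { assert (A : (Rabs (IZR n) <= Cmod w + Rabs (IZR m) * T)%R).
      { rewrite <- (Cmod_R (IZR n)). replace (RtoC (IZR n)) with (w + - (RtoC (IZR m) * tau)) by (unfold w; ring).
        eapply Rle_trans; [apply Cmod_triangle|]. rewrite Cmod_opp, Cmod_mult, Cmod_R. fold T. lra. }
      assert (B : (Rabs (IZR m) * T <= Cmod w * (T / y))%R).
      { replace (Rabs (IZR m) * T)%R with (Rabs (IZR m) * y * (T / y))%R by (field; lra).
        apply Rmult_le_compat_r; auto. }
      lra. }
    unfold Rmax. destruct Rle_dec.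
    + apply Rle_trans with (/ (1 + T / y) * Rabs (IZR n))%R; [apply Rmult_le_compat_r; auto; apply Rabs_pos|].
      apply (Rmult_le_reg_l (1 + T / y)); [lra|]. rewrite <- Rmult_assoc, Rinv_r by lra. lra.
    + pose proof (Rabs_pos (IZR m)). nra.
  - assert (H : (1 <= Z.abs m \/ 1 <= Z.abs n)%Z).
    { destruct (Z.eq_dec m 0), (Z.eq_dec n 0); subst; try lia. now elim Hmn. }
    rewrite <- !abs_IZR. destruct H as [H|H]; apply IZR_le in H;
      [eapply Rle_trans; [exact H|apply Rmax_l]|eapply Rle_trans; [exact H|apply Rmax_r]].
Qed.

Lemma lat_neq0 tau m n : (0 < Im tau)%R -> (m, n) <> (0, 0)%Z -> RtoC (IZR m) * tau + RtoC (IZR n) <> 0.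
Proof.
  intros Ht Hmn. destruct (lattice_lower tau Ht) as (c & Hc & H). destruct (H m n Hmn) as [H1 H2].
  apply Cmod_gt_0. nra.
Qed.

Lemma lat_summable k tau : (0 < Im tau)%R -> (4 <= k)%nat -> summable (lat k tau).
Proof.
  intros Ht Hk. destruct (lattice_lower tau Ht) as (c & Hc & H).
  apply (summable_le_scal (16 / c ^ k) _ (fun p => zwt (fst p) * zwt (snd p))).
  2:{ apply summable_prod; apply zwt_summable. }
  intros [m n]. unfold lat. cbn [fst snd].
  assert (Hpos : (0 <= 16 / c ^ k * Cmod (zwt m * zwt n))%R).
  { apply Rmult_le_pos; [|apply Cmod_ge_0]. apply Rmult_le_pos; [lra|]. left. apply Rinv_0_lt_compat, pow_lt; lra. }
  destruct (classic ((m, n) = (0, 0)%Z)) as [E|Hmn].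
  - inversion E; subst. replace (RtoC (IZR 0) * tau + RtoC (IZR 0)) with (RtoC 0) by ring.
    destruct k; [lia|]. replace (0 ^ S k) with (RtoC 0) by (simpl; ring). rewrite Cinv_0, Cmod_0. auto.
  - destruct (H m n Hmn) as [H1 H2]. set (M := Rmax (Rabs (IZR m)) (Rabs (IZR n))) in *.
    rewrite Cmod_inv, Cmod_pow by (now apply Cpow_nz, lat_neq0).
    apply Rle_trans with (/ (c * M) ^ k)%R.
    { apply Rinv_le_contravar; [apply pow_lt; nra|]. apply pow_incr. split; [nra|auto]. }
    rewrite Rpow_mult_distr, Rinv_mult. unfold Rdiv. rewrite (Rmult_comm 16), Rmult_assoc.
    apply Rmult_le_compat_l; [left; apply Rinv_0_lt_compat, pow_lt; lra|].
    unfold zwt. rewrite Cmod_mult, !Cmod_R.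
    pose proof (Rabs_pos (IZR m)) as Pm. pose proof (Rabs_pos (IZR n)) as Pn.
    set (a := Rabs (IZR m)) in *. set (b := Rabs (IZR n)) in *.
    assert (Ma : (a <= M)%R) by apply Rmax_l. assert (Mb : (b <= M)%R) by apply Rmax_r.
    rewrite !Rabs_right by (apply Rle_ge; left; apply Rinv_0_lt_compat; nra).
    rewrite <- Rinv_mult.
    apply Rle_trans with (/ M ^ 4)%R.
    { apply Rinv_le_contravar; [apply pow_lt; lra|]. apply Rle_pow; auto. }
    replace (/ M ^ 4)%R with (16 * / (2 * M * (2 * M) * (2 * M * (2 * M))))%R by (field; lra).
    apply Rmult_le_compat_l; [lra|]. apply Rinv_le_contravar.
    + apply Rmult_lt_0_compat; nra.
    + apply Rmult_le_compat; try nra.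
Qed.

Lemma has_sum_nat_cons (f : nat -> C) s : has_sum (fun n => f (S n)) s -> has_sum f (f 0%nat + s).
Proof.
  intros H.
  assert (H1 : has_sum (fun n : nat => match n with O => f O | S _ => 0 end) (f 0%nat)).
  { apply (has_sum_single (fun n : nat => match n with O => f O | S _ => 0 end) 0%nat).
    intros [|i] Hi; [tauto|auto]. }
  assert (H2 : has_sum (fun n : nat => match n with O => 0 | S _ => f n end) s).
  { apply (has_sum_reindex S); [intros; lia| |exact H]. intros [|i] Hi; [tauto|eauto]. }
  eapply has_sum_ext; [|apply (has_sum_plus _ _ _ _ H1 H2)]. intros [|n]; simpl; ring.
Qed.

(** * Eisenstein series as lattice sums *)

Section Eisenstein.
Variables (j : nat) (num : C -> C) (cst : C).
(** The weight is even, which removes the sign in Lipschitz's formula, and at least 4, which gives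
    absolute convergence; [k'] is [k - 1]. *)
Let k : nat := (2 * S (S j))%nat.
Let k' : nat := (2 * j + 3)%nat.
Let h (x : C) : C := num x / (1 - x) ^ k.
Hypothesis cst_neq0 : cst <> 0.
Hypothesis num_1 : num 1 = cst.
Hypothesis num_cont : ccont num 1.
Hypothesis num_bounded : loc_bounded num.
Hypothesis doubling : forall y, y ^ 2 <> 1 -> h y + h (- y) = 2 ^ k * h (y ^ 2).
Hypothesis series : forall x, (Cmod x < 1)%R -> has_sum (fun n => RtoC (INR n) ^ k' * x ^ n) (h x).

Lemma twopii_neq0 : 2 * PI * Ci <> 0.
Proof.
  apply Cmult_neq_0; [apply Cmult_neq_0|apply Ci_nz]; [apply (RtoC_IZR_neq0 2); lia|].
  intros E. apply RtoC_inj in E. pose proof PI_RGT_0. lra.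
Qed.

(** In both uses [cst] is [(k - 1)!], so this is the classical Lipschitz constant. *)
Let kap : C := (2 * PI * Ci) ^ k / cst.

Lemma lipschitz_even z : cis z <> 1 -> (forall n : Z, z + RtoC (IZR n) <> 0) ->
  summable (fun n : Z => / (z + RtoC (IZR n)) ^ k) ->
  has_sum (fun n : Z => / (z + RtoC (IZR n)) ^ k) (kap * h (cis z)).
Proof.
  intros Hz Hn Hs.
  pose proof (lipschitz k num cst num_1 num_cont num_bounded doubling z Hz Hn Hs) as H.
  eapply has_sum_ext; [|apply (has_sum_scal kap _ _ H)].
  intros n. cbv beta. unfold kap.
  replace ((- (2 * PI * Ci * (z + RtoC (IZR n)))) ^ k) with ((2 * PI * Ci) ^ k * (z + RtoC (IZR n)) ^ k).
  - pose proof (Cpow_nz _ k twopii_neq0). pose proof (Cpow_nz _ k (Hn n)). field. auto.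
  - rewrite <- Cpow_mult_l. unfold k. rewrite !(Cpow_mult_r _ 2). f_equal. ring.
Qed.

Lemma Im_Ci_pos : (0 < Im Ci)%R.
Proof. simpl. lra. Qed.

Lemma zeta_summable : summable (fun n : Z => / RtoC (IZR n) ^ k).
Proof.
  apply (summable_ext (fun n => lat k Ci (0%Z, n))).
  - intros n. unfold lat. cbn [fst snd]. f_equal. f_equal. ring.
  - apply (summable_inj (fun n : Z => (0%Z, n)) (lat k Ci)); [congruence|].
    apply lat_summable; [apply Im_Ci_pos|unfold k; lia].
Qed.

Lemma cis_half_value : cis (/ 2) = - (1).
Proof.
  replace (/ 2) with (0 + / 2) by ring. rewrite cis_half. unfold cis.
  replace (2 * PI * Ci * 0) with (RtoC 0) by ring. now rewrite Cexp_0.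
Qed.

(** Lipschitz's formula at [z = 1/2], where [cis z = -1], sums over half-integers and so over odd
    integers. The even integers contribute [2^(-k) Z0]; thus the zeta value comes out without
    Bernoulli numbers. *)
Lemma zeta_value Z0 : has_sum (fun n : Z => / RtoC (IZR n) ^ k) Z0 ->
  (2 ^ k - 1) * Z0 = kap * h (- (1)).
Proof.
  intros HZ.
  assert (N2 : 2 ^ k <> 0 :> C) by apply pow2_neq0.
  assert (E0 : forall n : Z, / 2 + RtoC (IZR n) = RtoC (IZR (2 * n + 1)) / 2).
  { intros n. rewrite plus_IZR, mult_IZR, RtoC_plus, RtoC_mult. field. }
  assert (E1 : forall n : Z, / (/ 2 + RtoC (IZR n)) ^ k = 2 ^ k * / RtoC (IZR (2 * n + 1)) ^ k).
  { intros n. rewrite E0. unfold Cdiv. rewrite Cpow_mult_l, Cpow_inv by (apply (RtoC_IZR_neq0 2); lia).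
    assert (N : RtoC (IZR (2 * n + 1)) ^ k <> 0) by (apply Cpow_nz, RtoC_IZR_neq0; lia).
    field. auto. }
  assert (HO : has_sum (fun n : Z => / (/ 2 + RtoC (IZR n)) ^ k) (kap * h (- (1)))).
  { rewrite <- cis_half_value. apply lipschitz_even.
    - rewrite cis_half_value. intros E. apply (f_equal Re) in E. simpl in E. lra.
    - intros n. rewrite E0. intros E.
      assert (N : RtoC (IZR (2 * n + 1)) <> 0) by (apply RtoC_IZR_neq0; lia).
      apply N. replace (RtoC (IZR (2 * n + 1))) with (RtoC (IZR (2 * n + 1)) / 2 * 2) by field. rewrite E. ring.
    - apply (summable_ext (fun n => 2 ^ k * / RtoC (IZR (2 * n + 1)) ^ k)); [intros n; now rewrite E1|].
      apply summable_scal. apply (summable_inj (fun n => (2 * n + 1)%Z) (fun n : Z => / RtoC (IZR n) ^ k)); [intros; lia|apply zeta_summable]. }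
  assert (HO' : has_sum (fun n : Z => / RtoC (IZR (2 * n + 1)) ^ k) (/ 2 ^ k * (kap * h (- (1))))).
  { eapply has_sum_ext; [|apply (has_sum_scal (/ 2 ^ k) _ _ HO)]. intros n. cbv beta. rewrite E1. field. 
    split; auto. apply Cpow_nz, RtoC_IZR_neq0; lia. }
  assert (H1 : has_sum (fun n : Z => if Z.even n then 0 else / RtoC (IZR n) ^ k) (/ 2 ^ k * (kap * h (- (1))))).
  { apply (has_sum_reindex (fun n => (2 * n + 1)%Z)); [intros; lia| |].
    - intros n. destruct (Z.even n) eqn:E; [tauto|]. intros _.
      rewrite <- Z.negb_odd in E. apply Bool.negb_false_iff, Z.odd_spec in E. destruct E as (m & ->). eauto.
    - eapply has_sum_ext; [|exact HO']. intros n. cbv beta. now rewrite Z.even_add, Z.even_mul. }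
  assert (H2 : has_sum (fun n : Z => if Z.even n then / RtoC (IZR n) ^ k else 0) (/ 2 ^ k * Z0)).
  { apply (has_sum_reindex (fun n => (2 * n)%Z)); [intros; lia| |].
    - intros n. destruct (Z.even n) eqn:E; [|tauto]. intros _. apply Z.even_spec in E. destruct E as (m & ->). eauto.
    - eapply has_sum_ext; [|apply (has_sum_scal (/ 2 ^ k) _ _ HZ)]. intros n. cbv beta. rewrite Z.even_mul. simpl orb.
      rewrite mult_IZR, RtoC_mult, Cpow_mult_l.
      destruct (Z.eq_dec n 0) as [->|Hn].
      + assert (Ez0 : RtoC (IZR 0) ^ k = 0).
        { replace k with (S (2 * j + 3)) by (unfold k; lia). rewrite Cpow_S. apply Cmult_0_l. }
        rewrite Ez0, Cmult_0_r, Cinv_0. ring.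
      + assert (N : RtoC (IZR n) ^ k <> 0) by (now apply Cpow_nz, RtoC_IZR_neq0). field. auto. }
  assert (E : Z0 = / 2 ^ k * (kap * h (- (1))) + / 2 ^ k * Z0).
  { apply (has_sum_unique _ _ _ HZ). eapply has_sum_ext; [|apply (has_sum_plus _ _ _ _ H1 H2)].
    intros n. cbv beta. destruct (Z.even n); ring. }
  apply (Clin _ _ _ _ (2 ^ k) E). field. auto.
Qed.

Lemma cis_nome tau m : cis (RtoC (INR m) * tau) = nome tau ^ m.
Proof. unfold cis, nome. rewrite Cexp_pow. f_equal. ring. Qed.

Lemma row_pos tau m : (0 < Im tau)%R ->
  has_sum (fun n : Z => / (RtoC (INR (S m)) * tau + RtoC (IZR n)) ^ k) (kap * h (nome tau ^ S m)).
Proof.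
  intros Ht. rewrite <- cis_nome.
  assert (E : INR (S m) = IZR (Z.of_nat (S m))) by apply INR_IZR_INZ.
  apply lipschitz_even.
  - rewrite cis_nome. intros E1. pose proof (Cmod_pow_lt1 _ m (Cmod_nome_lt1 tau Ht)) as B.
    rewrite E1, Cmod_1 in B. lra.
  - intros n. rewrite E. apply lat_neq0; auto. intros E1. inversion E1.
  - apply (summable_ext (fun n => lat k tau (Z.of_nat (S m), n))); [intros n; unfold lat; cbn [fst snd]; now rewrite E|].
    apply (summable_inj (fun n : Z => (Z.of_nat (S m), n)) (lat k tau)); [congruence|].
    apply lat_summable; auto. unfold k; lia.
Qed.

(** The double series of [n^k' q^(mn)], summed over [n] first. *)
Lemma lambert_rows q : (Cmod q < 1)%R -> has_sum (fun m => h (q ^ S m)) (wlam 1 k' q).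
Proof.
  intros Hq. apply (has_sum_fubini _ _ _ (has_sum_swap _ _ (wlam_gps k' q Hq))).
  intros m. cbn [fst snd].
  assert (H := series _ (Cmod_pow_lt1 q m Hq)). apply has_sum_nat_shift in H.
  - eapply has_sum_ext; [|exact H]. intros n. cbv beta. unfold cidx.
    rewrite <- Cpow_mult_r, (Nat.mul_comm (S m)). ring.
  - replace k' with (S (2 * j + 2)) by (unfold k'; lia). rewrite Cpow_S. change (INR 0) with 0%R.
    now rewrite !Cmult_0_l.
Qed.

(** Row 0 is the zeta value, the rows [m] and [-m] agree because [k] is even, and Lipschitz's
    formula evaluates each of them. *)
Lemma eisenstein_value tau Z0 G : (0 < Im tau)%R -> has_sum (fun n : Z => / RtoC (IZR n) ^ k) Z0 ->
  has_sum (lat k tau) G -> G = Z0 + 2 * (kap * wlam 1 k' (nome tau)).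
Proof.
  intros Ht HZ HG.
  pose proof (has_sum_scal kap _ _ (lambert_rows _ (Cmod_nome_lt1 tau Ht))) as HL.
  set (row' := fun m : Z => if Z.eq_dec m 0 then Z0 else kap * h (nome tau ^ Z.to_nat (Z.abs m))).
  assert (H1 : has_sum row' G).
  { apply (has_sum_fubini _ _ _ HG). intros m. unfold lat, row'. cbn [fst snd].
    destruct (Z.eq_dec m 0) as [->|Hm].
    - eapply has_sum_ext; [|exact HZ]. intros n. cbv beta. f_equal. f_equal. ring.
    - destruct (Z_lt_dec 0 m) as [Hp|Hp].
      + assert (Em : exists n, m = Z.of_nat (S n)) by (exists (Z.to_nat (m - 1)); lia).
        destruct Em as (n & ->). rewrite Z.abs_eq, Nat2Z.id, <- INR_IZR_INZ by lia. now apply row_pos.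
      + assert (Em : exists n, m = (- Z.of_nat (S n))%Z) by (exists (Z.to_nat (- m - 1)); lia).
        destruct Em as (n & ->). rewrite Z.abs_opp, Z.abs_eq, Nat2Z.id by lia.
        apply (has_sum_reindex (fun i => (- i)%Z)); [intros; lia|intros i _; exists (- i)%Z; lia|].
        eapply has_sum_ext; [|apply (row_pos tau n Ht)]. intros i. cbv beta. f_equal.
        rewrite !opp_IZR, <- INR_IZR_INZ, !RtoC_opp. unfold k. rewrite !(Cpow_mult_r _ 2). f_equal. ring. }
  apply (has_sum_unique _ _ _ H1).
  replace (Z0 + 2 * (kap * wlam 1 k' (nome tau))) with ((Z0 + kap * wlam 1 k' (nome tau)) + kap * wlam 1 k' (nome tau)) by ring.
  apply has_sum_Z.
  - replace Z0 with (row' (Z.of_nat 0)) by reflexivity.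
    apply has_sum_nat_cons. eapply has_sum_ext; [|exact HL].
    intros n. unfold row'. destruct Z.eq_dec; [lia|]. now rewrite Z.abs_eq, Nat2Z.id by lia.
  - eapply has_sum_ext; [|exact HL].
    intros n. unfold row'. destruct Z.eq_dec; [lia|]. now rewrite Z.abs_opp, Z.abs_eq, Nat2Z.id by lia.
Qed.

Lemma Im_S tau : (0 < Im tau)%R -> (0 < Im (-1 / tau))%R.
Proof.
  intros Ht. destruct tau as [x y]. simpl in *.
  assert (0 < x * (x * 1) + y * (y * 1))%R by nra.
  match goal with |- (0 < ?e)%R => replace e with (y / (x * (x * 1) + y * (y * 1)))%R by (field; lra) end.
  now apply Rdiv_lt_0_compat.
Qed.

Lemma tau_neq0 tau : (0 < Im tau)%R -> tau <> 0.
Proof. intros H E. rewrite E in H. simpl in H. lra. Qed.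

(** [m (-1/tau) + n = (n tau - m) / tau], and the unordered sum is invariant under
    [(m, n) -> (n, -m)]. *)
Lemma eisenstein_S tau G : (0 < Im tau)%R -> has_sum (lat k tau) G -> has_sum (lat k (-1 / tau)) (tau ^ k * G).
Proof.
  intros Ht HG. pose proof (tau_neq0 tau Ht) as N.
  assert (H : has_sum (fun p : Z * Z => lat k tau (snd p, - fst p)%Z) G).
  { apply (has_sum_reindex (fun p : Z * Z => (snd p, - fst p)%Z)); auto.
    - intros [a b] [c d] E. simpl in E. inversion E. f_equal; lia.
    - intros [m n] _. exists (- n, m)%Z. simpl. f_equal. lia. }
  eapply has_sum_ext; [|apply (has_sum_scal (tau ^ k) _ _ H)].
  intros [m n]. unfold lat. cbn [fst snd].
  replace (RtoC (IZR m) * (-1 / tau) + RtoC (IZR n)) with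
    ((RtoC (IZR n) * tau + RtoC (IZR (- m))) * / tau) by (rewrite opp_IZR, RtoC_opp; field; auto).
  rewrite Cpow_mult_l, Cpow_inv by auto.
  pose proof (Cpow_nz tau k N) as Nk.
  destruct (classic ((n, - m)%Z = (0, 0)%Z)) as [E|Hne].
  - injection E as E1 E2. rewrite E2, E1. replace (RtoC (IZR 0) * tau + RtoC (IZR 0)) with (RtoC 0) by ring.
    assert (E0 : RtoC 0 ^ k = 0).
    { replace k with (S (2 * j + 3)) by (unfold k; lia). rewrite Cpow_S. apply Cmult_0_l. }
    rewrite E0, Cmult_0_l, Cinv_0. ring.
  - pose proof (Cpow_nz _ k (lat_neq0 tau n (- m) Ht Hne)). field. auto.
Qed.

Lemma eisenstein_transformation tau Z0 : (0 < Im tau)%R -> has_sum (fun n : Z => / RtoC (IZR n) ^ k) Z0 ->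
  Z0 + 2 * (kap * wlam 1 k' (nome (-1 / tau))) = tau ^ k * (Z0 + 2 * (kap * wlam 1 k' (nome tau))).
Proof.
  intros Ht HZ.
  destruct (summable_has_sum _ (lat_summable k tau Ht ltac:(unfold k; lia))) as (G & HG).
  rewrite <- (eisenstein_value tau Z0 G Ht HZ HG). symmetry.
  apply (eisenstein_value (-1 / tau) Z0); auto; [now apply Im_S|now apply eisenstein_S].
Qed.

End Eisenstein.

Lemma PI_neq0_C : RtoC PI <> 0.
Proof. intros E. apply RtoC_inj in E. pose proof PI_RGT_0. lra. Qed.

Lemma sqr_neq1 (y : C) : y ^ 2 <> 1 -> 1 - y <> 0 /\ 1 + y <> 0.
Proof.
  intros H. split; intros E; apply H.
  - replace y with (1 - (1 - y)) by ring. rewrite E. ring.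
  - replace y with ((1 + y) - 1) by ring. rewrite E. ring.
Qed.

Ltac cc := repeat first [apply ccont_plus | apply ccont_mult | apply ccont_const | apply ccont_id].
Ltac lb := repeat first [apply loc_bounded_plus | apply loc_bounded_mult | apply loc_bounded_const | apply loc_bounded_id].

Lemma Ci_sqr : Ci * Ci = - (1).
Proof. unfold Ci, Cmult, Copp, RtoC; simpl. f_equal; ring. Qed.

Lemma qE4_S tau : (0 < Im tau)%R -> qE4 (nome (-1 / tau)) = tau ^ 4 * qE4 (nome tau).
Proof.
  intros Ht.
  assert (D : forall y, y ^ 2 <> 1 -> eul4 y / (1 - y) ^ 4 + eul4 (- y) / (1 - - y) ^ 4 = 2 ^ 4 * (eul4 (y ^ 2) / (1 - y ^ 2) ^ 4)).
  { intros y Hy. destruct (sqr_neq1 y Hy) as [N1 N2]. unfold eul4.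
    replace (1 - y ^ 2) with ((1 - y) * (1 + y)) by ring. replace (1 - - y) with (1 + y) by ring. field. auto. }
  assert (C6 : RtoC 6 <> 0) by (apply (RtoC_IZR_neq0 6); lia).
  assert (B : loc_bounded eul4) by (unfold eul4; lb).
  assert (Cn : ccont eul4 1) by (unfold eul4; cc).
  assert (N1 : eul4 1 = 6) by (unfold eul4; ring).
  destruct (summable_has_sum _ (zeta_summable 0)) as (Z0 & HZ).
  pose proof (zeta_value 0 eul4 6 C6 N1 Cn B D Z0 HZ) as V.
  pose proof (eisenstein_transformation 0 eul4 6 C6 N1 Cn B D (fun x Hx => proj1 (eulerian_sums x Hx)) tau Z0 Ht HZ) as T.
  change (2 * 2)%nat with 4%nat in *. change (2 * 0 + 3)%nat with 3%nat in *.
  assert (K : (2 * PI * Ci) ^ 4 = 16 * PI ^ 4).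
  { transitivity (16 * PI ^ 4 * ((Ci * Ci) * (Ci * Ci))); [ring|]. rewrite Ci_sqr. ring. }
  rewrite K in *.
  (* This is [2 zeta(4)], the sum over both signs. *)
  assert (EZ : Z0 = PI ^ 4 / 45).
  { assert (V' : 15 * Z0 = PI ^ 4 / 3).
    { transitivity ((2 ^ 4 - 1) * Z0); [ring|]. rewrite V. unfold eul4.
      replace (1 - - (1)) with (RtoC 2) by ring. field. }
    apply (Clin _ _ _ _ (/ 15) V'). field. }
  rewrite EZ in T. unfold qE4.
  pose proof (Cpow_nz _ 4 PI_neq0_C) as NP. clear V K EZ.
  apply (Clin _ _ _ _ (45 / PI ^ 4) T). field. apply PI_neq0_C.
Qed.

Lemma qE6_S tau : (0 < Im tau)%R -> qE6 (nome (-1 / tau)) = tau ^ 6 * qE6 (nome tau).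
Proof.
  intros Ht.
  assert (D : forall y, y ^ 2 <> 1 -> eul6 y / (1 - y) ^ 6 + eul6 (- y) / (1 - - y) ^ 6 = 2 ^ 6 * (eul6 (y ^ 2) / (1 - y ^ 2) ^ 6)).
  { intros y Hy. destruct (sqr_neq1 y Hy) as [N1 N2]. unfold eul6.
    replace (1 - y ^ 2) with ((1 - y) * (1 + y)) by ring. replace (1 - - y) with (1 + y) by ring. field. auto. }
  assert (C6 : RtoC 120 <> 0) by (apply (RtoC_IZR_neq0 120); lia).
  assert (B : loc_bounded eul6) by (unfold eul6; lb).
  assert (Cn : ccont eul6 1) by (unfold eul6; cc).
  assert (N1 : eul6 1 = 120) by (unfold eul6; ring).
  destruct (summable_has_sum _ (zeta_summable 1)) as (Z0 & HZ).
  pose proof (zeta_value 1 eul6 120 C6 N1 Cn B D Z0 HZ) as V.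
  pose proof (eisenstein_transformation 1 eul6 120 C6 N1 Cn B D (fun x Hx => proj2 (eulerian_sums x Hx)) tau Z0 Ht HZ) as T.
  change (2 * 3)%nat with 6%nat in *. change (2 * 1 + 3)%nat with 5%nat in *.
  assert (K : (2 * PI * Ci) ^ 6 = -64 * PI ^ 6).
  { transitivity (64 * PI ^ 6 * ((Ci * Ci) * (Ci * Ci) * (Ci * Ci))); [ring|]. rewrite Ci_sqr. ring. }
  rewrite K in *.
  (* This is [2 zeta(6)]. *)
  assert (EZ : Z0 = 2 * PI ^ 6 / 945).
  { assert (V' : 63 * Z0 = 2 * PI ^ 6 / 15).
    { transitivity ((2 ^ 6 - 1) * Z0); [ring|]. rewrite V. unfold eul6.
      replace (1 - - (1)) with (RtoC 2) by ring. field. }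
    apply (Clin _ _ _ _ (/ 63) V'). field. }
  rewrite EZ in T. unfold qE6.
  pose proof (Cpow_nz _ 6 PI_neq0_C) as NP. clear V K EZ.
  apply (Clin _ _ _ _ (945 / (2 * PI ^ 6)) T). field. apply PI_neq0_C.
Qed.

(** * Zeros of E6 and the main theorem *)

Lemma Im_near z y : (Cmod (y - z) < Im z)%R -> (0 < Im y)%R.
Proof.
  intros H. replace y with (z + (y - z)) by ring. rewrite im_plus.
  destruct (Cmod_Re_Im (y - z)) as [_ A]. apply Rabs_le_between in A. lra.
Qed.

(** In weight 2 the lattice sum does not converge absolutely. Instead the law for E4 is
    differentiated: [D E4] contains [E2 * E4], and the derivative of [tau ^ 4] produces the anomaly
    [6 tau / (pi i)]. *)
Lemma qE2_S tau : (0 < Im tau)%R -> qE4 (nome tau) <> 0 ->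
  qE2 (nome (-1 / tau)) = tau ^ 2 * qE2 (nome tau) + 6 * tau / (PI * Ci).
Proof.
  intros Ht N4. pose proof (tau_neq0 tau Ht) as N. pose proof (Im_S tau Ht) as Ht'.
  assert (D : (2 * PI * Ci * ((qE2 (nome (-1 / tau)) * qE4 (nome (-1 / tau)) - qE6 (nome (-1 / tau))) / 3)) * (1 / tau ^ 2) =
     4 * tau ^ 3 * qE4 (nome tau) + tau ^ 4 * (2 * PI * Ci * ((qE2 (nome tau) * qE4 (nome tau) - qE6 (nome tau)) / 3))).
  { apply (cderiv_unique (fun z => qE4 (nome (-1 / z))) tau).
    - apply (cderiv_comp (fun z => qE4 (nome z)) (fun z => -1 / z)).
      + apply eulerD_nome, eulerD_qE4. now apply Cmod_nome_lt1.
      + eapply cderiv_eq; [apply cderiv_div; [apply cderiv_const|apply cderiv_id|exact N]|].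
        cbv beta. field. exact N.
    - apply (cderiv_ext_loc (fun z => z ^ 4 * qE4 (nome z)) _ tau _ (Im tau) Ht).
      + intros y Hy. symmetry. apply qE4_S. now apply Im_near with tau.
      + eapply cderiv_eq.
        * apply cderiv_mult; [|apply eulerD_nome, eulerD_qE4; now apply Cmod_nome_lt1].
          apply (cderiv_ext (fun z => (z * z) * (z * z))); [intros; ring|]. cd.
        * cbv beta. ring. }
  rewrite (qE4_S tau Ht), (qE6_S tau Ht) in D.
  pose proof PI_neq0_C. pose proof Ci_nz.
  apply (Clin _ _ _ _ (3 / (2 * PI * Ci * tau ^ 2 * qE4 (nome tau))) D). field. auto.
Qed.

Lemma qE4_qE6_not_both q : (Cmod q < 1)%R -> qE6 q = 0 -> qE4 q <> 0.
Proof.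
  intros Hq H6 H4. pose proof (qE6_eisP q Hq) as E. rewrite H6, H4 in E.
  apply (eisP_U_neq0 q Hq). rewrite H4.
  destruct (Ceq_dec (eisP q) 0) as [->|Hp]; [ring|]. exfalso.
  apply (Cpow_nz _ 3 Hp). apply (Clin _ _ _ _ (- / 4) E). field.
Qed.

Lemma Ci_S : -1 / Ci = Ci.
Proof.
  transitivity ((Ci * Ci) / Ci); [rewrite Ci_sqr; f_equal; ring|]. field. apply Ci_nz.
Qed.

(** At the fixed point [i] the factor [i^6 = -1] makes the value equal to its own negative. *)
Lemma qE6_Ci : qE6 (nome Ci) = 0.
Proof.
  pose proof (qE6_S Ci Im_Ci_pos) as H. rewrite Ci_S in H.
  replace (Ci ^ 6) with ((Ci * Ci) * (Ci * Ci) * (Ci * Ci)) in H by ring. rewrite Ci_sqr in H.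
  apply (Clin _ _ _ _ (/ 2) H). field.
Qed.

(** At the fixed point the law is the linear equation [E2 = - E2 + 6 / pi]. *)
Lemma qE2_Ci : qE2 (nome Ci) = 3 / PI.
Proof.
  assert (N : qE4 (nome Ci) <> 0) by (apply qE4_qE6_not_both; [apply Cmod_nome_lt1, Im_Ci_pos|apply qE6_Ci]).
  pose proof (qE2_S Ci Im_Ci_pos N) as H. rewrite Ci_S in H.
  replace (Ci ^ 2) with (- (1)) in H by (rewrite <- Ci_sqr; ring).
  pose proof PI_neq0_C. pose proof Ci_nz.
  apply (Clin _ _ _ _ (/ 2) H). field. auto.
Qed.

Lemma dpowR_S n r : dpowR (S n) r = (INR (S n) * r ^ n)%R.
Proof.
  induction n; [simpl; ring|]. change (dpowR (S (S n)) r) with (r * dpowR (S n) r + r ^ S n)%R.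
  rewrite IHn, (S_INR (S n)). simpl pow. ring.
Qed.

(** Consecutive left sides have ratio at most [(3/2)^6 / 100 < 1/8], and [2^6 / 100] starts the
    induction. The sixth power is the fifth power in E6 times the [n] from differences of [q^n]. *)
Lemma sixth_power_geom n : (INR (S (S n)) ^ 6 * (/ 100) ^ S n <= 64 / 100 * (/ 8) ^ n)%R.
Proof.
  induction n; [simpl; lra|].
  assert (P : (0 < INR (S (S n)))%R) by (apply lt_0_INR; lia).
  assert (H : (INR (S (S (S n))) <= 3 / 2 * INR (S (S n)))%R).
  { rewrite !S_INR. pose proof (pos_INR n). lra. }
  assert (H6 : (INR (S (S (S n))) ^ 6 <= (3 / 2 * INR (S (S n))) ^ 6)%R).
  { apply pow_incr. split; auto. apply pos_INR. }
  rewrite Rpow_mult_distr in H6.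
  change ((/ 100) ^ S (S n))%R with (/ 100 * (/ 100) ^ S n)%R. change ((/ 8) ^ S n)%R with (/ 8 * (/ 8) ^ n)%R.
  assert (Pg : (0 < (/ 100) ^ S n)%R) by (apply pow_lt; lra).
  assert (P6 : (0 < INR (S (S n)) ^ 6)%R) by (apply pow_lt; auto).
  set (x := (INR (S (S n)) ^ 6)%R) in *. set (g := ((/ 100) ^ S n)%R) in *. set (e := ((/ 8) ^ n)%R) in *.
  assert (H7 : (INR (S (S (S n))) ^ 6 <= 125 / 10 * x)%R).
  { eapply Rle_trans; [exact H6|]. apply Rmult_le_compat_r; [lra|]. simpl. lra. }
  apply Rle_trans with (125 / 10 * x * (/ 100 * g))%R; [apply Rmult_le_compat_r; [nra|auto]|]. nra.
Qed.

Lemma lam_diff q q' n : (Cmod q < 1)%R -> (Cmod q' < 1)%R ->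
  lam q n - lam q' n = (q ^ S n - q' ^ S n) / ((1 - q ^ S n) * (1 - q' ^ S n)).
Proof.
  intros H H'. pose proof (lam_den q n H). pose proof (lam_den q' n H'). unfold lam. field. auto.
Qed.

(** The term of Lambert index 1 dominates: it contributes at least [98/100] of [|q - q'|], while all
    the others together give at most [65/100 * 8/7], which is less than [75/100]. *)
Lemma qE6_injective q q' : (Cmod q <= / 100)%R -> (Cmod q' <= / 100)%R -> qE6 q = qE6 q' -> q = q'.
Proof.
  intros Hq Hq' E.
  assert (H1 : (Cmod q < 1)%R) by lra. assert (H1' : (Cmod q' < 1)%R) by lra.
  set (f := fun n => cidx n ^ 5 * (lam q n - lam q' n)).
  assert (Hf : has_sum f 0).
  { replace (RtoC 0) with (wlam 1 5 q - wlam 1 5 q').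
    - eapply has_sum_ext; [|apply (has_sum_minus _ _ _ _ (wlam_sum 1 5 q Cmod_1 H1) (wlam_sum 1 5 q' Cmod_1 H1'))].
      intros n. unfold f. cbv beta. rewrite Cpow_1_l. ring.
    - unfold qE6 in E. apply (Clin _ _ _ _ (- / 504) E). field. }
  set (D := Cmod (q - q')).
  assert (HD : (0 <= D)%R) by apply Cmod_ge_0.
  assert (Hb : forall n, (Cmod (f (S n)) <= 65 / 100 * D * (/ 8) ^ n)%R).
  { intros n. unfold f. rewrite lam_diff, Cmod_mult, Cmod_cidx_pow by auto.
    assert (Pm : forall x, (Cmod x <= / 100)%R -> (Cmod (x ^ S (S n)) <= / 1000)%R).
    { intros x Hx. rewrite Cmod_pow. pose proof (Cmod_ge_0 x).
      assert (Cmod x ^ n <= 1)%R by (rewrite <- (pow1 n); apply pow_incr; lra).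
      assert (0 <= Cmod x ^ n)%R by now apply pow_le.
      simpl. assert (Cmod x * Cmod x ^ n <= / 100)%R by nra. nra. }
    pose proof (lam_den q (S n) H1) as N1. pose proof (lam_den q' (S n) H1') as N2.
    rewrite Cmod_div, Cmod_mult by now apply Cmult_neq_0.
    pose proof (Cmod_one_minus (q ^ S (S n))). pose proof (Cmod_one_minus (q' ^ S (S n))).
    pose proof (Pm q Hq). pose proof (Pm q' Hq').
    assert (Hden : (998 / 1000 <= Cmod (1 - q ^ S (S n)) * Cmod (1 - q' ^ S (S n)))%R) by nra.
    assert (Hnum : (Cmod (q ^ S (S n) - q' ^ S (S n)) <= D * (INR (S (S n)) * (/ 100) ^ S n))%R).
    { rewrite <- dpowR_S. apply (pow_taylor (S (S n)) q q' (/ 100) Hq Hq'). }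
    pose proof (sixth_power_geom n) as G.
    set (x := INR (S (S n))) in *. assert (Hx : (0 <= x)%R) by apply pos_INR.
    set (g := ((/ 100) ^ S n)%R) in *. assert (Hg : (0 <= g)%R) by (apply pow_le; lra).
    set (A := Cmod (q ^ S (S n) - q' ^ S (S n))) in *. assert (HA : (0 <= A)%R) by apply Cmod_ge_0.
    set (B := (Cmod (1 - q ^ S (S n)) * Cmod (1 - q' ^ S (S n)))%R) in *.
    apply Rle_trans with (x ^ 5 * (D * (x * g) / (998 / 1000)))%R.
    - apply Rmult_le_compat_l; [now apply pow_le|]. unfold Rdiv. apply Rmult_le_compat; auto.
      + left. apply Rinv_0_lt_compat. lra.
      + apply Rinv_le_contravar; lra.
    - replace (x ^ 5 * (D * (x * g) / (998 / 1000)))%R with (D * (x ^ 6 * g) * (1000 / 998))%R by (simpl; field).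
      assert (0 <= x ^ 6 * g)%R by (apply Rmult_le_pos; auto; now apply pow_le).
      assert (D * (x ^ 6 * g) <= D * (64 / 100 * (/ 8) ^ n))%R by (apply Rmult_le_compat_l; auto).
      assert (0 <= (/ 8) ^ n)%R by (apply pow_le; lra).
      assert (0 <= D * (/ 8) ^ n)%R by now apply Rmult_le_pos. nra. }
  assert (Hs : has_sum (fun n => f (S n)) (- f 0%nat)).
  { assert (Sf : summable (fun n => f (S n))).
    { apply (summable_le_scal (65 / 100 * D) _ (fun n => RtoC (/ 8) ^ n)).
      - intros n. rewrite Cmod_pow, Cmod_R, (Rabs_right (/ 8)) by lra. apply Hb.
      - apply summable_geom. rewrite Cmod_R, Rabs_right; lra. }
    destruct (summable_has_sum _ Sf) as (s & Hs).
    pose proof (has_sum_unique _ _ _ Hf (has_sum_nat_cons f s Hs)) as Es.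
    replace (- f 0%nat) with s; auto. apply (Clin _ _ _ _ (-1) Es). ring. }
  assert (Ht : (Cmod (f 0%nat) <= 65 / 100 * D * (8 / 7))%R).
  { rewrite <- Cmod_opp. apply (has_sum_norm_le _ _ _ Hs). intros l Hl.
    apply Rle_trans with (lsumR (fun n => 65 / 100 * D * (/ 8) ^ n)%R l); [apply lsumR_le; auto|].
    rewrite lsumR_scal. apply Rmult_le_compat_l; [nra|].
    eapply Rle_trans; [apply (geom_lsum_bound (/ 8) l); [lra|exact Hl]|lra]. }
  assert (Hl : (98 / 100 * D <= Cmod (f 0%nat))%R).
  { unfold f. rewrite lam_diff, Cmod_mult, Cmod_cidx_pow by auto.
    replace (q ^ 1) with q by ring. replace (q' ^ 1) with q' by ring.
    replace (INR 1 ^ 5)%R with 1%R by (simpl; ring). rewrite Rmult_1_l.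
    pose proof (one_minus_neq0 q H1) as N1. pose proof (one_minus_neq0 q' H1') as N2.
    rewrite Cmod_div, Cmod_mult by now apply Cmult_neq_0. fold D.
    assert (T : forall x, (Cmod x <= / 100)%R -> (Cmod (1 - x) <= 101 / 100)%R).
    { intros x Hx. eapply Rle_trans; [apply Cmod_triangle|]. rewrite Cmod_opp, Cmod_1. lra. }
    pose proof (T q Hq). pose proof (T q' Hq').
    pose proof (proj1 (Cmod_gt_0 _) N1). pose proof (proj1 (Cmod_gt_0 _) N2).
    apply (proj1 (Rle_div_r _ _ _ (Rmult_lt_0_compat _ _ H2 H3))).
    assert (Q : (Cmod (1 - q) * Cmod (1 - q') <= 101 / 100 * (101 / 100))%R)
      by (apply Rmult_le_compat; auto; apply Cmod_ge_0).
    apply Rle_trans with (98 / 100 * D * (101 / 100 * (101 / 100)))%R; [apply Rmult_le_compat_l; lra|lra]. }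
  assert (D0 : (D = 0)%R) by lra.
  apply Ceq_minus. now apply Cmod_eq_0.
Qed.

Lemma nome_small tau : (85 / 100 <= Im tau)%R -> (Cmod (nome tau) <= / 100)%R.
Proof.
  intros H. rewrite Cmod_nome, exp_Ropp.
  apply Rinv_le_contravar; [lra|].
  assert (Hpi : (3 <= PI)%R) by (pose proof PI2_3_2; lra).
  (* With [PI >= 3] the exponent is at least [2 * 3 * 85/100 = 51/10], and [exp (1/10) >= 11/10]. *)
  apply Rle_trans with ((11 / 10) ^ 51)%R; [simpl; lra|].
  apply Rle_trans with (exp (INR 51 * (1 / 10))).
  - assert (E : forall n x, exp (INR n * x) = (exp x ^ n)%R).
    { induction n; intros x; [simpl; rewrite Rmult_0_l; apply exp_0|].
      rewrite S_INR, Rmult_plus_distr_r, exp_plus, IHn, Rmult_1_l. simpl. ring. }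
    rewrite E. apply pow_incr. split; [lra|].
    eapply Rle_trans; [|apply exp_ineq1_le]. lra.
  - assert (Hx : (INR 51 * (1 / 10) <= 2 * PI * Im tau)%R).
    { replace (INR 51) with 51%R by (simpl; ring). nra. }
    destruct Hx as [Hx|Hx]; [left; now apply exp_increasing|right; now rewrite Hx].
Qed.

Lemma qE6_zero_high tau : (85 / 100 <= Im tau)%R -> qE6 (nome tau) = 0 ->
  qE2 (nome tau) = 3 / PI /\ Im tau = 1%R.
Proof.
  intros H H6.
  assert (E : nome tau = nome Ci).
  { apply qE6_injective; [now apply nome_small|apply nome_small; simpl; lra|]. now rewrite H6, qE6_Ci. }
  split; [rewrite E; apply qE2_Ci|].
  apply (f_equal Cmod) in E. rewrite !Cmod_nome in E. apply exp_inv in E. simpl (Im Ci) in E.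
  pose proof PI_RGT_0. nra.
Qed.

(** One of [tau] and [-1/tau] has imaginary part at least [85/100]: with [y = Im tau], the region
    gives [y > 1/2] and [|tau|^2 < 1/4 + y^2], so [Im (-1/tau) = y / |tau|^2] is large enough for
    [y] below [85/100]. *)
Lemma e2star_zero tau : F_2A tau -> qE6 (nome tau) = 0 -> qE2 (nome tau) = 3 / (PI * Im tau).
Proof.
  intros (Ht & Hm & Hr) H6. pose proof PI_neq0_C as NP.
  destruct (Rle_lt_dec (85 / 100) (Im tau)) as [Hy|Hy].
  - destruct (qE6_zero_high tau Hy H6) as [E2 EI]. rewrite E2, EI. field. auto.
  - pose proof (tau_neq0 tau Ht) as N.
    assert (Hmod : (Cmod tau ^ 2 = Re tau ^ 2 + Im tau ^ 2)%R) by apply Cmod2_alt.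
    assert (Hre : (Re tau ^ 2 < 1 / 4)%R).
    { simpl. rewrite Rmult_1_r. apply Rabs_def2 in Hr. nra. }
    assert (EI : (Im (-1 / tau) = Im tau / (Cmod tau ^ 2))%R).
    { rewrite Hmod. destruct tau as [x y]. simpl in *. field. nra. }
    set (y := Im tau) in *.
    assert (Hy1 : (1 / 2 < y)%R).
    { apply Rnot_le_lt. intros Hle. assert (y ^ 2 <= 1 / 4)%R by (simpl; nra). lra. }
    assert (Hm2 : (Cmod tau ^ 2 < 1 / 4 + y ^ 2)%R) by lra.
    assert (Hbig : (85 / 100 <= Im (-1 / tau))%R).
    { rewrite EI. apply (proj1 (Rle_div_r (85 / 100) y (Cmod tau ^ 2) ltac:(lra))).
      assert (85 / 100 * (1 / 4 + y ^ 2) <= y)%R by (simpl; nra). lra. }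
    assert (H6' : qE6 (nome (-1 / tau)) = 0) by (rewrite (qE6_S tau Ht), H6; ring).
    destruct (qE6_zero_high _ Hbig H6') as [E2 EIm].
    rewrite EIm in EI.
    assert (Hyy : (y = Cmod tau ^ 2)%R).
    { assert (Ey : (y / Cmod tau ^ 2 * Cmod tau ^ 2 = y)%R) by (unfold Rdiv; rewrite Rmult_assoc, Rinv_l; lra).
      rewrite <- EI in Ey. lra. }
    pose proof (qE2_S tau Ht (qE4_qE6_not_both _ (Cmod_nome_lt1 tau Ht) H6)) as T.
    rewrite E2 in T.
    assert (Hc : RtoC y = tau * Cconj tau) by (rewrite Hyy; apply Cmod2_conj).
    assert (Hd : tau - Cconj tau = 2 * Ci * RtoC y) by apply im_alt'.
    assert (Ny : RtoC y <> 0) by (intros E; apply RtoC_inj in E; lra).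
    (* Since [Im (-1/tau) = 1], [y] is [tau] times its conjugate. With [tau] minus its conjugate
       equal to [2 i y], the anomaly combines with [3 / PI] into a multiple of [tau ^ 2]. *)
    assert (E : tau ^ 2 * qE2 (nome tau) = tau ^ 2 * (3 / (PI * RtoC y))).
    { transitivity (3 / PI - 6 * tau / (PI * Ci)).
      - rewrite T. ring.
      - assert (Nc : Cconj tau <> 0) by (intros E; apply Ny; rewrite Hc, E; ring).
        assert (Id : Cconj tau + 2 * Ci * (tau * Cconj tau) = tau) by (rewrite <- Hc, <- Hd; ring).
        rewrite Hc. transitivity (3 * (Cconj tau + 2 * Ci * (tau * Cconj tau)) / (PI * Cconj tau)).
        + replace (6 * tau / (PI * Ci)) with (- (6 * tau * Ci / PI)).
          * field. auto.
          * replace (6 * tau * Ci / PI) with (6 * tau * (Ci * Ci) / (PI * Ci)) by (field; split; auto; apply Ci_nz).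
            rewrite Ci_sqr. field. split; auto. apply Ci_nz.
        + rewrite Id. field. auto. }
    replace (qE2 (nome tau)) with (tau ^ 2 * qE2 (nome tau) / tau ^ 2) by (field; auto).
    rewrite E. field. auto.
Qed.

(** * From the region of the theorem to the identities in [q] *)

Lemma region_goodq z : region_inv_v z -> goodq (nome z) /\ 1 / v_haupt z = hW (nome z).
Proof.
  intros ((Ht & _) & Hv & Hm).
  pose proof (v_haupt_hT z Ht) as E. pose proof (hT_neq0 _ (nome_neq0 z)) as Nt.
  assert (N1 : hT (nome z) <> 1).
  { intros E1. apply Hv. rewrite E, E1. unfold Cdiv. ring. }
  assert (N2 : 1 - hT (nome z) <> 0) by (apply Cminus_eq_contra; auto).
  assert (Ew : 1 / v_haupt z = hW (nome z)).
  { rewrite E. unfold hW. field. auto. }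
  split; auto. split; [now apply Cmod_nome_lt1|]. split; auto. now rewrite <- Ew.
Qed.

Lemma open_of_Cmod (D : C -> Prop) :
  (forall z, D z -> exists r, (0 < r)%R /\ forall y, (Cmod (y - z) < r)%R -> D y) -> open D.
Proof.
  intros H z Hz. destruct (H z Hz) as (r & Hr & Hy).
  (* Balls of the product space [C] are squares: two coordinates below [r / 2] keep the modulus
     below [r]. *)
  assert (Hr2 : (0 < r / 2)%R) by lra.
  exists (mkposreal _ Hr2). intros y [B1 B2]. apply Hy.
  eapply Rle_lt_trans; [apply Cmod_le_Re_Im|].
  unfold ball in B1, B2; simpl in B1, B2. unfold AbsRing_ball, abs, minus, plus, opp in B1, B2; simpl in B1, B2.
  destruct y as [y1 y2], z as [z1 z2]. simpl in *. lra.
Qed.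

Lemma large_Im r : (0 < r)%R -> exists M : R, forall z, (M < Im z)%R -> (Cmod (nome z) < r)%R.
Proof.
  intros Hr. exists (/ r)%R. intros z Hz. rewrite Cmod_nome, exp_Ropp.
  assert (Hi : (0 < / r)%R) by now apply Rinv_0_lt_compat.
  rewrite <- (Rinv_inv r). apply Rinv_lt_contravar.
  - apply Rmult_lt_0_compat; auto. apply exp_pos.
  - pose proof (exp_ineq1_le (2 * PI * Im z)). pose proof PI2_3_2. nra.
Qed.

(** Vanishing of the defects is an open condition by local uniqueness and non-vanishing is open by
    continuity; a connected set reaching up to the cusp contains points of the first kind, hence
    none of the second. *)
Lemma component_identity tau : C_inv_v_infty tau -> defY (nome tau) = 0 /\ defN (nome tau) = 0.
Proof.
  intros (Hreg & Hinf).
  destruct defY_defN_near_0 as (r & Hr & Hnear). destruct (large_Im r Hr) as (M & HM).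
  destruct (Hinf M) as (z & (K & HK & HKr & Kt & Kz) & Hz).
  set (U := fun z => goodq (nome z) /\ defY (nome z) = 0 /\ defN (nome z) = 0).
  set (V := fun z => goodq (nome z) /\ ~ (defY (nome z) = 0 /\ defN (nome z) = 0)).
  apply NNPP; intros Hn.
  destruct (HK U V) as (x & _ & (_ & Ux) & (_ & Vx)).
  - apply open_of_Cmod. intros z0 (Hg & Hy & Hnn).
    destruct (goodq_nome_open z0 Hg) as (r1 & Hr1 & H1).
    destruct (defY_defN_local z0 Hg Hy Hnn) as (r2 & Hr2 & H2).
    exists (Rmin r1 r2). split; [now apply Rmin_glb_lt|]. intros y Hyz. split.
    + apply H1. eapply Rlt_le_trans; [exact Hyz|apply Rmin_l].
    + apply H2. eapply Rlt_le_trans; [exact Hyz|apply Rmin_r].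
  - apply open_of_Cmod. intros z0 (Hg & Hnot).
    destruct (goodq_nome_open z0 Hg) as (r1 & Hr1 & H1).
    assert (Cy : ccont (fun z => defY (nome z)) z0).
    { apply (ccont_comp defY nome); [apply (eulerD_cont _ _ _ (eulerD_defY _ Hg))|apply nome_cont]. }
    assert (Cn : ccont (fun z => defN (nome z)) z0).
    { apply (ccont_comp defN nome); [apply (eulerD_cont _ _ _ (eulerD_defN _ Hg))|apply nome_cont]. }
    destruct (Ceq_dec (defY (nome z0)) 0) as [Ey|Ny].
    + assert (Nn : defN (nome z0) <> 0) by (intros En; exact (Hnot (conj Ey En))).
      destruct (ccont_neq0 _ _ Cn Nn) as (r2 & Hr2 & H2).
      exists (Rmin r1 r2). split; [now apply Rmin_glb_lt|]. intros y Hyz. split.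
      * apply H1. eapply Rlt_le_trans; [exact Hyz|apply Rmin_l].
      * intros [_ E]. apply (H2 y); [eapply Rlt_le_trans; [exact Hyz|apply Rmin_r]|exact E].
    + destruct (ccont_neq0 _ _ Cy Ny) as (r2 & Hr2 & H2).
      exists (Rmin r1 r2). split; [now apply Rmin_glb_lt|]. intros y Hyz. split.
      * apply H1. eapply Rlt_le_trans; [exact Hyz|apply Rmin_l].
      * intros [E _]. apply (H2 y); [eapply Rlt_le_trans; [exact Hyz|apply Rmin_r]|exact E].
  - intros y Hy. pose proof (proj1 (region_goodq y (HKr y Hy))) as Hg. unfold U, V.
    destruct (classic (defY (nome y) = 0 /\ defN (nome y) = 0)) as [E|E]; [left|right]; exact (conj Hg E).
  - exists z. exact (conj Kz (conj (proj1 (region_goodq z (HKr z Kz))) (Hnear _ (HM z Hz)))).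
  - exists tau. exact (conj Kt (conj (proj1 (region_goodq tau Hreg)) Hn)).
  - exact (Vx Ux).
Qed.

Lemma cderiv_is_derive (f : C -> C) (z l : C) : cderiv f z l ->
  @is_derive C_AbsRing C_NormedModule f z l.
Proof.
  intros (ph & Hph & E & Hc). split.
  - apply (is_linear_scal_l (K := C_AbsRing) (V := C_NormedModule) l).
  - intros x Hx. pose proof (is_filter_lim_locally_unique (K := C_AbsRing) (V := AbsRing_NormedModule C_AbsRing) z x Hx). subst x.
    intros eps. destruct (Hc eps (cond_pos eps)) as (d & Hd & Hy).
    exists (mkposreal d Hd). intros y By.
    assert (Hyz : (Cmod (y - z) < d)%R) by exact By.
    specialize (Hy y Hyz).
    change (Cmod ((f y - f z) - (y - z) * l) <= eps * Cmod (y - z))%R.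
    replace (f y - f z - (y - z) * l) with ((ph y - ph z) * (y - z)).
    + rewrite Cmod_mult. apply Rmult_le_compat_r; [apply Cmod_ge_0|lra].
    + rewrite (Hph y), E. ring.
Qed.

Theorem mainTheorem15 :
  forall (a b c d : Z) (tau : C),
    (0 < a)%Z ->
    Z.gcd a (Z.gcd b c) = 1%Z ->
    (- d = b * b - 4 * a * c)%Z ->
    tau = (- IZR b + Ci * sqrt (IZR d)) / (2 * IZR a) ->
    IZR a * tau ^ 2 + IZR b * tau + IZR c = 0 ->
    C_inv_v_infty tau ->
    let t := t_haupt tau in
    let v := v_haupt tau in
    let F := hyp2F1 (1 / 8) (3 / 8) 1 (1 / v) in
    exists dF2 : C,
      is_derive (fun x : C => hyp2F1 (1 / 8) (3 / 8) 1 (1 / x) ^ 2) v dF2 /\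
      F ^ 2 / 6 *
        ((t + 2) / (t + 1)
         - (t - 1) * (t + 8) / ((t - 4) * (t + 1)) * s2 tau)
      - v * dF2
      = IZR a / (PI * sqrt (IZR d)) * ((t - 1) / (t + 1)).
Proof.
  intros a b c d tau Ha _ _ Etau _ Hcomp t v F.
  destruct (component_identity tau Hcomp) as [HY HN].
  destruct Hcomp as [Hreg _]. pose proof Hreg as ((Ht & _) & Hv & _).
  destruct (region_goodq tau Hreg) as [(Hq & N1 & Hw) Ew]. fold v in Ew, Hv.
  assert (EF : F = hyp (hW (nome tau))) by (unfold F; rewrite Ew; reflexivity).
  pose proof (eta_ratio tau Ht) as Et. fold t in Et.
  pose proof (hT_neq0 _ (nome_neq0 tau)) as Nt.
  pose proof (eisP_neq0 _ Hq N1) as NP. pose proof (qE4_hT _ Hq N1) as E4v. pose proof (qE6_eisP _ Hq) as E6v.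
  assert (ES2 : s2 tau = qE4 (nome tau) / qE6 (nome tau) * (qE2 (nome tau) - 3 / (PI * Im tau))).
  { unfold s2, E2star, E2, E4, E6, qE2, qE4, qE6. now rewrite !lambert_wlam by auto. }
  pose proof (e2star_zero tau (proj1 Hreg)) as Hzero.
  assert (Ed : RtoC (IZR a) / (PI * sqrt (IZR d)) = 1 / (2 * PI * Im tau)).
  { assert (Pa : (0 < IZR a)%R) by (now apply IZR_lt).
    assert (EI : Im tau = (sqrt (IZR d) / (2 * IZR a))%R).
    { rewrite Etau. replace ((- IZR b + Ci * sqrt (IZR d)) / (2 * IZR a)) with
        (RtoC (/ (2 * IZR a)) * (RtoC (- IZR b) + Ci * sqrt (IZR d))).
      - rewrite im_scal_l, im_plus, im_RtoC, im_mult, re_RtoC, im_RtoC. simpl. field. lra.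
      - rewrite RtoC_inv, RtoC_mult, RtoC_opp by lra. unfold Cdiv. ring. }
    (* Positivity of [Im tau] also rules out the default value 0 of [sqrt] at negative arguments. *)
    assert (Ns : sqrt (IZR d) <> 0%R).
    { intros E0. rewrite EI, E0 in Ht. unfold Rdiv in Ht. rewrite Rmult_0_l in Ht. lra. }
    rewrite EI, RtoC_div, RtoC_mult by lra.
    assert (RtoC (sqrt (IZR d)) <> 0) by (intros E0; apply RtoC_inj in E0; auto).
    assert (RtoC (IZR a) <> 0) by (apply RtoC_IZR_neq0; lia).
    pose proof PI_neq0_C. field. auto. }
  rewrite Ed, ES2. clear Ed ES2 Etau.
  destruct (eulerD_hyp _ Hw) as (dh & Hdh & Eh).
  set (q := nome tau) in *.
  exists (2 * hyp (1 / v) * (dh * (- (1) / v ^ 2))). split.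
  { apply cderiv_is_derive. apply (cderiv_sqr (fun x => hyp2F1 (1 / 8) (3 / 8) 1 (1 / x))).
    apply (cderiv_comp hyp (fun x => 1 / x)).
    - rewrite Ew. exact Hdh.
    - eapply cderiv_eq; [apply cderiv_div; [apply cderiv_const|apply cderiv_id|exact Hv]|].
      cbv beta. field. exact Hv. }
  (* With [w = 1/v] the operator [v d/dv] is [- w d/dw], whose value on [hyp] is [- hyp1]. *)
  assert (Edv : v * (2 * hyp (1 / v) * (dh * (- (1) / v ^ 2))) = - (2 * (hyp (hW q) * hyp1 (hW q)))).
  { rewrite <- Eh, <- Ew. field. exact Hv. }
  rewrite Edv, EF.
  assert (N2 : 1 - hT q <> 0) by (apply Cminus_eq_contra; auto).
  (* The denominators of the claim vanish for [t = -1], where [1/v = 1], and for [t = 4], where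
     [1/v = -16/9]; neither is in the open unit disc. *)
  assert (N3 : 1 + hT q <> 0).
  { intros E. assert (Et1 : hT q = - (1)) by (replace (hT q) with ((1 + hT q) - 1) by ring; rewrite E; ring).
    unfold hW in Hw. rewrite Et1 in Hw.
    replace (-4 * - (1) / (1 - - (1)) ^ 2) with (RtoC 1) in Hw.
    - rewrite Cmod_1 in Hw. lra.
    - replace (1 - - (1)) with (RtoC 2) by ring. field. }
  assert (N4 : 1 - 4 * hT q <> 0).
  { intros E. assert (Et1 : hT q = / 4) by (apply (Clin _ _ _ _ (- / 4) E); field).
    unfold hW in Hw. rewrite Et1 in Hw.
    replace (-4 * / 4 / (1 - / 4) ^ 2) with (RtoC (-16 / 9)) in Hw.
    - rewrite Cmod_R, Rabs_left in Hw by lra. lra.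
    - rewrite RtoC_div by lra. field. }
  unfold defN in HN. unfold defY, hS in HY.
  assert (EN : hyp (hW q) ^ 2 = eisP q) by (apply (Clin _ _ _ _ 1 HN); ring).
  (* Multiplying [defY = 0] by [hyp (hW q)] and replacing its square by [P] exhibits a factor [P],
     which is nonzero and can be cancelled. *)
  assert (EM : 2 * (hyp (hW q) * hyp1 (hW q)) = dlogP q * (1 - hT q) / (1 + hT q)).
  { assert (HY' : eisP q * (dlogP q - 2 * ((1 + hT q) / (1 - hT q)) * (hyp (hW q) * hyp1 (hW q))) = 0).
    { transitivity (hyp (hW q) * (hyp (hW q) * dlogP q - 2 * (eisP q * ((1 + hT q) / (1 - hT q) * hyp1 (hW q))))).
      - rewrite <- EN. ring.
      - rewrite HY. ring. }
    apply (Clin _ _ _ _ (- (1 - hT q) / ((1 + hT q) * eisP q)) HY'). field. auto. }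
  rewrite EM, EN, Et. unfold dlogP.
  assert (NI : RtoC (Im tau) <> 0) by (intros E; apply RtoC_inj in E; lra).
  pose proof PI_neq0_C as Npi.
  assert (N5 : / hT q + 1 <> 0).
  { intros E. apply N3. transitivity (hT q * (/ hT q + 1)); [field; auto|rewrite E; ring]. }
  assert (N6 : / hT q - 4 <> 0).
  { intros E. apply N4. transitivity (hT q * (/ hT q - 4)); [field; auto|rewrite E; ring]. }
  (* The prefactor of [s2] is designed to cancel [E4 / E6] up to [P]. At a zero of E6 the quotient
     has only its default value, and both sides vanish through the factor E2star. *)
  assert (X : eisP q * ((/ hT q - 1) * (/ hT q + 8) / ((/ hT q - 4) * (/ hT q + 1)) *
      (qE4 q / qE6 q * (qE2 q - 3 / (PI * Im tau)))) =
      (1 - hT q) / (1 + hT q) * (qE2 q - 3 / (PI * Im tau))).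
  { assert (E6f : qE6 q = eisP q ^ 3 * (1 + 8 * hT q) / (1 - hT q)).
    { rewrite E6v, E4v. field. auto. }
    destruct (Ceq_dec (qE6 q) 0) as [Z6|Z6].
    - rewrite (Hzero Z6). ring.
    - assert (N8 : 1 + 8 * hT q <> 0).
      { intros E. apply Z6. rewrite E6f, E. unfold Cdiv. ring. }
      rewrite E4v, E6f.
      replace ((/ hT q - 1) * (/ hT q + 8) / ((/ hT q - 4) * (/ hT q + 1))) with
        ((1 - hT q) * (1 + 8 * hT q) / ((1 - 4 * hT q) * (1 + hT q))) by (field; auto).
      field. repeat split; auto. }
  transitivity (eisP q / 6 * ((/ hT q + 2) / (/ hT q + 1)) - / 6 * (eisP q * ((/ hT q - 1) * (/ hT q + 8) / ((/ hT q - 4) * (/ hT q + 1)) *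
      (qE4 q / qE6 q * (qE2 q - 3 / (PI * Im tau)))))
     + (qE2 q - eisP q * (1 + 2 * hT q) / (1 - hT q)) / 6 * (1 - hT q) / (1 + hT q)).
  { unfold Cdiv. ring. }
  rewrite X.
  replace ((/ hT q + 2) / (/ hT q + 1)) with ((1 + 2 * hT q) / (1 + hT q)) by (field; auto).
  replace ((/ hT q - 1) / (/ hT q + 1)) with ((1 - hT q) / (1 + hT q)) by (field; auto).
  field. auto.
Qed.
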